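(* Let $g$ and $m$ be positive integers. For any $\tilde\gamma=(\gamma,(\lambda,\mu;\kappa))\in\Gamma_{\vartheta,g,m}$ with $\gamma=\begin{pmatrix} A&B\\ C&D\end{pmatrix}\in\Gamma_{\vartheta,g}$ (where $A,B,C,D$ are $g\times g$ blocks), and for $(\Omega,Z)\in\mathbb H_g\times\mathbb C^{(m,g)}$, the following functional equation holds: $$\Theta\big((A\Omega+B)(C\Omega+D)^{-1},\,(Z+\lambda\Omega+\mu)(C\Omega+D)^{-1}\big)$$ $$=\zeta(\tilde\gamma)\; e^{\pi i\,\sigma\{(Z+\lambda\Omega+\mu)(C\Omega+D)^{-1}C\,{}^t(Z+\lambda\Omega+\mu)-\lambda\Omega\,{}^t\lambda-2\lambda\,{}^tZ\}}\;\det(C\Omega+D)^{\frac m2}\;\Theta(\Omega,Z),$$ where $\zeta(\tilde\gamma)$ is an eighth root of $1$.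
   Context: For a commutative ring $F$ and positive integers $k,l$, $F^{(k,l)}$ denotes the set of $k\times l$ matrices with entries in $F$; ${}^tM$ is the transpose of $M$; $\sigma(T)$ is the trace of a square matrix $T$; $i=\sqrt{-1}$; $I_g$ is the $g\times g$ identity matrix. Convention for roots: for $z\in\mathbb C$, $z^{1/2}=\sqrt z$ is defined so that $-\pi/2<\arg(z^{1/2})\le\pi/2$, and $z^{\kappa/2}=(z^{1/2})^{\kappa}$ for every $\kappa\in\mathbb Z$. Siegel upper half plane: $\mathbb H_g=\{\Omega\in\mathbb C^{(g,g)} : \Omega={}^t\Omega,\ \mathrm{Im}\,\Omega>0\}$, where $\mathrm{Im}\,\Omega$ is the imaginary part of $\Omega$ and $>0$ means positive definite. Siegel modular group: $\Gamma_g=\{\gamma\in\mathbb Z^{(2g,2g)} : {}^t\gamma J_g\gamma=J_g\}$ with $J_g=\begin{pmatrix}0&I_g\\-I_g&0\end{pmatrix}$. Theta group: $\Gamma_{\vartheta,g}$ is the group of all $\gamma=\begin{pmatrix}A&B\\C&D\end{pmatrix}\in\Gamma_g$ such that the diagonal entries of the matrices ${}^tAC$ and ${}^tBD$ are even integers. Heisenberg group: $H_{\mathbb Z}^{(g,m)}=\{(\lambda,\mu;\kappa) : \lambda,\mu\in\mathbb Z^{(m,g)},\ \kappa\in\mathbb Z^{(m,m)},\ \kappa+\mu\,{}^t\lambda \text{ symmetric}\}$, with multiplication $(\lambda,\mu;\kappa)\circ(\lambda',\mu';\kappa')=(\lambda+\lambda',\mu+\mu';\kappa+\kappa'+\lambda\,{}^t\mu'-\mu\,{}^t\lambda')$.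 $\Gamma_{\vartheta,g,m}=\Gamma_{\vartheta,g}\ltimes H_{\mathbb Z}^{(g,m)}$ is the semidirect product with multiplication $$(\gamma,(\lambda,\mu;\kappa))\cdot(\gamma',(\lambda',\mu';\kappa'))=\big(\gamma\gamma',(\tilde\lambda+\lambda',\tilde\mu+\mu';\kappa+\kappa'+\tilde\lambda\,{}^t\mu'-\tilde\mu\,{}^t\lambda')\big),\quad(\tilde\lambda,\tilde\mu)=(\lambda,\mu)\gamma'.$$ Theta series: for $(\Omega,Z)\in\mathbb H_g\times\mathbb C^{(m,g)}$, $$\Theta(\Omega,Z)=\sum_{N\in\mathbb Z^{(m,g)}}e^{\pi i\,\sigma(N\Omega\,{}^tN+2N\,{}^tZ)}.$$
   Formalization: With the principal root and ζ depending only on γ̃ the formula fails for odd m, g≥2 (e.g. γ=(0,-I;I,0), g=2); a factor ε(Ω)^m is added, ε(Ω)=±1 being the sign making ε·det(CΩ+D)^{1/2} continuous on H_g with ε(iI_g)=1. *)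

(* Defs.v *)
From HB Require Import structures.
From mathcomp Require Import all_boot all_order all_algebra.
From mathcomp Require Import complex.
From mathcomp Require Import all_classical all_reals all_analysis.
From mathcomp Require summability.
Set Implicit Arguments.
Unset Strict Implicit.
Unset Printing Implicit Defensive.
Import Order.TTheory GRing.Theory Num.Theory.
Import numFieldNormedType.Exports.
Local Open Scope classical_set_scope.
Local Open Scope complex_scope.
Local Open Scope ring_scope.

Section Groups.
Variables g m : nat.

Definition symplectic_form : 'M[int]_(g + g) := block_mx 0 1%:M (- 1%:M) 0.

Definition siegel_modular_group : set 'M[int]_(g + g) :=
  [set gamma | gamma^T *m symplectic_form *m gamma = symplectic_form].

Definition theta_group : set 'M[int]_(g + g) :=
  [set gamma | [/\ siegel_modular_group gamma,
    forall i, (2 %| ((ulsubmx gamma)^T *m dlsubmx gamma) i i)%Z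
    & forall i, (2 %| ((ursubmx gamma)^T *m drsubmx gamma) i i)%Z]].

Record heis := Heis {
  heis_lambda : 'M[int]_(m, g);
  heis_mu : 'M[int]_(m, g);
  heis_kappa : 'M[int]_m
}.

Definition heisenberg_group : set heis :=
  [set h | let s := heis_kappa h + heis_mu h *m (heis_lambda h)^T in s^T = s].

Definition heis_mul (h h' : heis) : heis :=
  let: Heis l u k := h in let: Heis l' u' k' := h' in
  Heis (l + l') (u + u') (k + k' + l *m u'^T - u *m l'^T).

Definition heis_act (h : heis) (gamma : 'M[int]_(g + g)) : heis :=
  let v := row_mx (heis_lambda h) (heis_mu h) *m gamma in
  Heis (lsubmx v) (rsubmx v) (heis_kappa h).

Definition jacobi : Type := ('M[int]_(g + g) * heis)%type.

Definition theta_jacobi_group : set jacobi :=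
  theta_group `*` heisenberg_group.

Definition jacobi_mul (x y : jacobi) : jacobi :=
  (x.1 *m y.1, heis_mul (heis_act x.2 y.1) y.2).

End Groups.

Arguments heisenberg_group {g m} _.
Arguments theta_jacobi_group {g m} _.

Section Theta.
Variable R : realType.
Local Notation C := R[i].

Definition cexp (z : C) : C :=
  (expR (complex.Re z))%:C
  * (cos (complex.Im z) +i* sin (complex.Im z))%C.

(* z^(k/2); [sqrtc] is the square root with argument in ]-pi/2, pi/2] (and
   not [sqrtC], whose argument lies in [0, pi[). *)
Definition half_pow (z : C) (k : nat) : C := sqrtc z ^+ k.

Definition toC (k l : nat) (M : 'M[int]_(k, l)) : 'M[C]_(k, l) :=
  map_mx intr M.

Definition posdef (n : nat) (Y : 'M[R]_n) : Prop :=
  Y^T = Y /\ forall v : 'rV[R]_n, v != 0 -> 0 < (v *m Y *m v^T) 0 0.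

Definition siegel_space (g : nat) : set 'M[C]_g :=
  [set Omega | Omega^T = Omega /\ posdef (map_mx (@complex.Im R) Omega)].

Definition epii (s : C) : C := cexp ('i%C * pi%:C * s).

(* Unordered sum over all integral matrices; the regular algebra C^o carries
   the normed topology of C. *)
Definition Theta (g m : nat) (Omega : 'M[C]_g) (Z : 'M[C]_(m, g)) : C :=
  @summability.sum 'M[int]_(m, g) C C^o (fun N =>
    epii (\tr (toC N *m Omega *m (toC N)^T + (toC N *m Z^T) *+ 2))).

Section Automorphy.
Variables (g : nat) (gamma : 'M[int]_(g + g)).

Definition auto_num (Omega : 'M[C]_g) : 'M[C]_g :=
  toC (ulsubmx gamma) *m Omega + toC (ursubmx gamma).

Definition auto_den (Omega : 'M[C]_g) : 'M[C]_g :=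
  toC (dlsubmx gamma) *m Omega + toC (drsubmx gamma).

(* For g >= 2 the number det (C Omega + D) may cross the negative real axis
   when Omega varies in the Siegel space, and its principal square root then
   changes sign, whereas every other factor of the transformation formula is
   continuous in Omega.  [branch_sign eps] says that eps is the sign that turns
   the principal root into the continuous branch of det (C Omega + D)^(1/2)
   equal to the principal root at Omega = i I_g.  Since the Siegel space is
   connected (it is convex) and the determinant does not vanish on it, these
   conditions determine eps there; eps is 1 on it if the principal root is
   continuous, for instance if g = 1. *)
Definition branch_sign (eps : 'M[C]_g -> C) : Prop :=
  [/\ forall Omega, siegel_space Omega -> eps Omega = 1 \/ eps Omega = -1,
      eps ('i%C)%:M = 1
    & {within (@siegel_space g : set 'M[C^o]_g),
       continuous ((fun Omega => eps Omega * half_pow (\det (auto_den Omega)) 1)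
                   : 'M[C^o]_g -> C^o)}].

End Automorphy.
End Theta.

Arguments toC {R k l} M.
Arguments siegel_space {R g} _.

(* Main.v *)
Require Import Defs.
From mathcomp Require Import all_boot all_order all_algebra.
From mathcomp Require Import complex finmap.
From mathcomp Require Import all_classical all_reals all_analysis.
From mathcomp Require Import ring lra zify.
From mathcomp Require summability.
Set Implicit Arguments.
Unset Strict Implicit.
Unset Printing Implicit Defensive.
Import Order.TTheory GRing.Theory Num.Theory.
Import numFieldNormedType.Exports.
Import ComplexField.Normc.
Local Open Scope complex_scope.
Local Open Scope ring_scope.


(** The theta group is generated by the translations [Om -> Om + S] with [S]
    even, the substitutions [Om -> A Om A^T] and the inversions
    [Om_ii -> -1/Om_ii] in one coordinate: Euclid's algorithm reduces the first
    column of a matrix of the group, then the second, and so on; the parity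
    condition is what makes it stop although only even translations are used.

    For [m = 1] and a generator the transformation formula holds with a factor
    [chi Om] that is continuous in [Om] and satisfies
    [chi ^ 8 = det (C Om + D) ^ 4], and these properties are inherited by
    products.  For an inversion the formula is the one-variable Jacobi identity,
    applied on the lines parallel to a coordinate axis; it follows from Poisson
    summation for [x -> gauss (b (x + w))] with complex [b].  Poisson summation
    is obtained from the discrete Fourier transform by letting the mesh tend to
    0, and the complex Gaussian is moved to the real one by a discrete contour
    deformation.

    The function [chi ^ 2 / det (C Om + D)] is continuous on the convex Siegel
    space and its values are fourth roots of unity, hence it is constant, which
    determines [chi] up to the sign of the square root.  For general [m] the
    theta series is the product of the theta series of the rows of [Z]. *)

(** * Complex modulus and exponential *)

(** Principal roots cannot be followed through products: the product of the principal roots of two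
    determinants is the principal root of the product only up to a sign that varies with Om. The
    induction over the generators therefore carries branch-free data, and the sign is recovered
    once, at the end. The exponent 8 comes from the inversions, where chi = sqrt (- i Om_ii) and (-
    i)^4 = 1. Evenness of S is forced by the series: an odd diagonal entry would multiply its terms
    by signs depending on N. No integral occurs. Riemann sums over Z / L stand for Fourier
    integrals, orthogonality of roots of unity stands for Fourier inversion, and the value of the
    Gaussian integral is not computed but read off from a case where both sides of the formula
    coincide. The limit needs two uniform bounds: one on Riemann sums, independent of the mesh, and
    one of order 1 / k^2 on the coefficients with |k| <= K, where L = 2 K + 1. *)

Section ComplexModulus.
Variable R : realType.
Local Notation C := R[i].
Implicit Types (x y z : C) (r s t : R).

Lemma normcD x y : normc (x + y) <= normc x + normc y.
Proof. exact: le_normcD. Qed.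

Lemma normcNE x : normc (- x) = normc x.
Proof. by case: x => a b /=; rewrite !sqrrN. Qed.

Lemma normcBC x y : normc (x - y) = normc (y - x).
Proof. by rewrite -normcNE opprB. Qed.

Lemma normc_ge0 x : 0 <= normc x.
Proof. by case: x => a b; exact: sqrtr_ge0. Qed.

Lemma normc_eq0 x : (normc x == 0) = (x == 0).
Proof.
by apply/eqP/eqP => [/eq0_normc //|->]; exact: normc0.
Qed.

Lemma normc_gt0 x : (0 < normc x) = (x != 0).
Proof. by rewrite lt_def normc_ge0 andbT normc_eq0. Qed.

Lemma normcR r : normc r%:C = `|r|.
Proof. by rewrite /= expr0n addr0 sqrtr_sqr. Qed.

Lemma norm_normc x : `|x| = (normc x)%:C.
Proof. by case: x. Qed.

Lemma normc_sq x : normc x ^+ 2 = complex.Re x ^+ 2 + complex.Im x ^+ 2.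
Proof. by case: x => a b; rewrite sqr_sqrtr // addr_ge0 ?sqr_ge0. Qed.

Lemma normc_Re x : `|complex.Re x| <= normc x.
Proof.
case: x => a b /=; rewrite -sqrtr_sqr ler_wsqrtr // lerDl sqr_ge0 //.
Qed.

Lemma normc_Im x : `|complex.Im x| <= normc x.
Proof.
case: x => a b /=; rewrite -sqrtr_sqr ler_wsqrtr // lerDr sqr_ge0 //.
Qed.

Lemma normc_ReIm x : normc x <= `|complex.Re x| + `|complex.Im x|.
Proof.
rewrite -(ler_sqr (x := normc x)) ?nnegrE ?addr_ge0 ?normc_ge0 // normc_sq.
by rewrite sqrrD !real_normK ?num_real // lerD2r lerDl mulrn_wge0 // mulr_ge0.
Qed.

Lemma normcX x n : normc (x ^+ n) = normc x ^+ n.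
Proof.
elim: n => [|n IH]; first by rewrite !expr0 normc1.
by rewrite !exprS normcM IH.
Qed.

Lemma normc_sum (I : Type) (s : seq I) (P : pred I) (f : I -> C) :
  normc (\sum_(i <- s | P i) f i) <= \sum_(i <- s | P i) normc (f i).
Proof.
elim/big_rec2: _ => [|i a b _ h]; first by rewrite normc0.
by rewrite (le_trans (normcD _ _)) // lerD2l.
Qed.

Lemma normc_nat n : normc (n%:R : C) = n%:R.
Proof. by rewrite -(rmorph_nat (real_complex R)) normcR normr_nat. Qed.

Lemma Re_mul x y : complex.Re (x * y) =
  complex.Re x * complex.Re y - complex.Im x * complex.Im y.
Proof. by case: x y => a b [c d]. Qed.

Lemma Im_mul x y : complex.Im (x * y) =
  complex.Re x * complex.Im y + complex.Im x * complex.Re y.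
Proof. by case: x y => a b [c d]. Qed.

Lemma Re_realM r x : complex.Re (r%:C * x) = r * complex.Re x.
Proof. by rewrite Re_mul /= mul0r subr0. Qed.

Lemma Im_realM r x : complex.Im (r%:C * x) = r * complex.Im x.
Proof. by rewrite Im_mul /= mul0r addr0. Qed.

Lemma Re_add x y : complex.Re (x + y) = complex.Re x + complex.Re y.
Proof. by case: x y => a b [c d]. Qed.

Lemma Im_add x y : complex.Im (x + y) = complex.Im x + complex.Im y.
Proof. by case: x y => a b [c d]. Qed.

Lemma Re_opp x : complex.Re (- x) = - complex.Re x.
Proof. by case: x. Qed.

Lemma Im_opp x : complex.Im (- x) = - complex.Im x.
Proof. by case: x. Qed.

Lemma ReImP x y :
  complex.Re x = complex.Re y -> complex.Im x = complex.Im y -> x = y.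
Proof. by case: x y => a b [c d] /= -> ->. Qed.

End ComplexModulus.

(** * Taylor bounds for the real sine, cosine and exponential *)

Section RealEstimates.
Variable R : realType.
Implicit Types (x y : R).

(** By the mean value theorem. It yields the bounds for sine from those for cosine. *)
Lemma ge0_of_derive (f g : R -> R) :
  (forall x, is_derive x 1 f (g x)) -> 0 <= f 0 ->
  (forall x, 0 <= x -> 0 <= g x) -> forall x, 0 <= x -> 0 <= f x.
Proof.
move=> df f0 g0 x; rewrite le_eqVlt => /predU1P[<-//|x0].
have cf : {within `[0, x], continuous f}%classic.
  apply: continuous_subspaceT => y; apply/differentiable_continuous.
  by apply/derivable1_diffP; apply: ex_derive.
have [c] := @MVT R f g 0 x x0 (fun y _ => df y) cf.
rewrite in_itv /= => /andP[c0 cx] e.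
rewrite -(subrK (f 0) (f x)) addr_ge0 // e mulr_ge0 ?g0 ?subr0 // ltW //.
Qed.

Lemma sin_le x : 0 <= x -> sin x <= x.
Proof.
move=> x0; rewrite -subr_ge0.
apply: (@ge0_of_derive (fun x => x - sin x) (fun x => 1 - cos x)) x0 => //.
by rewrite sin0 subr0.
Qed.

Lemma normr_sin_le x : `|sin x| <= `|x|.
Proof.
wlog x0 : x / 0 <= x => [H|].
  have [/H //|/ltW x0] := leP 0 x.
  by rewrite -normrN -sinN -(normrN x) H // oppr_ge0.
rewrite (ger0_norm x0) ler_norml sin_le // andbT.
rewrite lerNl -sinN; have [x1|x1] := leP x 1; last first.
  by rewrite (le_trans (sin_le1 _)) // ltW.
rewrite sinN; rewrite (@le_trans _ _ 0) // oppr_le0 sin_ge0_pi // x0 /=.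
by rewrite (le_trans x1) // (le_trans _ (pi_ge2 R)) // ler1n.
Qed.

Lemma cos_ge x : 1 - x ^+ 2 / 2 <= cos x.
Proof.
have -> : cos x = 1 - sin (x / 2) ^+ 2 *+ 2.
  rewrite [in LHS](splitr x) -mulr2n cos_mulr2n cos2sin2; ring.
rewrite lerD2l lerN2 -[leLHS]mulr_natr.
have : sin (x/2) ^+ 2 <= (x/2) ^+ 2.
  by rewrite -(real_normK (num_real (sin _))) -[leRHS]real_normK ?num_real // ler_sqr ?nnegrE // normr_sin_le.
by rewrite expr_div_n; lra.
Qed.

Lemma cos_le_dist x : `|cos x - 1| <= x ^+ 2 / 2.
Proof.
by rewrite distrC ger0_norm ?subr_ge0 ?cos_le1 // lerBlDr addrC -lerBlDr cos_ge.
Qed.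

Lemma sin_ge_cubic x : 0 <= x -> x - x ^+ 3 / 6 <= sin x.
Proof.
move=> x0; rewrite -subr_ge0.
apply: (@ge0_of_derive (fun x => sin x - (x - x ^+ 3 / 6))
  (fun x => cos x - (1 - x ^+ 2 / 2))) x0 => [y||y _].
- apply: is_derive_eq; rewrite /GRing.scale /=; by field.
- by rewrite sin0 expr0n /= mul0r !subr0.
- by rewrite subr_ge0 cos_ge.
Qed.

(** On [0, 2] the cubic bound leaves x (1 - x^2 / 6) >= x / 3. The angles pi k / L with 2 |k| <= L,
    which occur in the discrete Fourier transform, lie in this range. *)
Lemma sin_ge_third x : 0 <= x -> x <= 2 -> x / 3 <= sin x.
Proof.
move=> x0 x2; apply: le_trans (sin_ge_cubic x0).
have : 0 <= x * (4 - x ^+ 2) by rewrite mulr_ge0 // subr_ge0; nra.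
by rewrite (_ : x ^+ 3 = x * x ^+ 2) ?exprS //; nra.
Qed.

Lemma normr_sin_ge x : `|x| <= 2 -> `|x| / 3 <= `|sin x|.
Proof.
move=> x2; suff -> : `|sin x| = `|sin `|x| |.
  by rewrite (le_trans _ (ler_norm _)) // sin_ge_third.
by have [x0|x0] := ger0P x; rewrite ?sinN ?normrN.
Qed.

Lemma sin_dist_le x : `|sin x - x| <= x ^+ 2 * `|x|.
Proof.
wlog x0 : x / 0 <= x => [H|].
  have [/H //|/ltW x0] := leP 0 x.
  by have := H (- x); rewrite sinN -opprD normrN sqrrN normrN; apply; rewrite oppr_ge0.
rewrite (ger0_norm x0) distrC ger0_norm ?subr_ge0 ?sin_le //.
have := sin_ge_cubic x0; have : 0 <= x ^+ 3 by rewrite exprn_ge0.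
by rewrite (_ : x ^+ 3 = x ^+ 2 * x) ?exprSr //; lra.
Qed.

Lemma expR_dist1_le x : `|expR x - 1| <= `|x| * expR `|x|.
Proof.
have [x0|x0] := leP 0 x.
  rewrite !ger0_norm // ?subr_ge0 -?expR0 ?ler_expR //.
  have := expR_ge1Dx (- x); rewrite expRN.
  have e0 := expR_gt0 x; rewrite -(ler_pM2r e0) mulVf ?gt_eqF // expR0; nra.
rewrite ler0_norm ?subr_le0 ?expR_le1 ?(ltW x0) // opprB.
have := expR_ge1Dx x; rewrite ltr0_norm //.
have : 1 <= expR (- x) by rewrite -expR0 ler_expR oppr_ge0 ltW.
nra.
Qed.

Lemma expR_taylor1_le x : `|expR x - 1 - x| <= x ^+ 2 * expR `|x|.
Proof.
have h : 0 <= expR x - 1 - x by rewrite -addrA -opprD subr_ge0 expR_ge1Dx.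
rewrite ger0_norm //; apply: (@le_trans _ _ (x * (expR x - 1))).
  have := expR_ge1Dx (- x); rewrite expRN.
  have e0 := expR_gt0 x; rewrite -(ler_pM2r e0) mulVf ?gt_eqF //; nra.
apply: le_trans (ler_norm _) _; rewrite normrM.
rewrite -(real_normK (num_real x)) expr2 -mulrA ler_wpM2l //.
exact: expR_dist1_le.
Qed.

End RealEstimates.

(** * The complex exponential *)

Section ComplexExponential.
Variable R : realType.
Local Notation C := R[i].
Implicit Types (x y z : C) (r s t : R).

Lemma cexpE r s : cexp (r +i* s) = (expR r * cos s) +i* (expR r * sin s).
Proof. by rewrite /cexp /=; simpc. Qed.

Lemma cexpD x y : cexp (x + y) = cexp x * cexp y.
Proof.
case: x y => [a b] [c d]; rewrite !cexpE.
by rewrite /cexp /= expRD cosD sinD; simpc; congr (_ +i* _); ring.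
Qed.

Lemma cexp0 : cexp (0 : C) = 1.
Proof. by rewrite cexpE expR0 cos0 sin0 mulr1 mulr0. Qed.

Lemma normc_cexp z : normc (cexp z) = expR (complex.Re z).
Proof.
case: z => a b; rewrite cexpE /= !exprMn -mulrDr cos2Dsin2 mulr1 sqrtr_sqr.
by rewrite ger0_norm // expR_ge0.
Qed.

Lemma cexp_neq0 z : cexp z != 0.
Proof. by rewrite -normc_gt0 normc_cexp expR_gt0. Qed.

Lemma cexpN z : cexp (- z) = (cexp z)^-1.
Proof.
by apply: (mulfI (cexp_neq0 z)); rewrite -cexpD subrr cexp0 divff ?cexp_neq0.
Qed.

Lemma cexpMn z n : cexp (z *+ n) = cexp z ^+ n.
Proof.
elim: n => [|n IH]; first by rewrite mulr0n cexp0 expr0.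
by rewrite mulrS cexpD IH exprS.
Qed.

Lemma cexpMz z (n : int) : cexp (z *~ n) = cexp z ^ n.
Proof.
case: n => n; first exact: cexpMn.
by rewrite NegzE mulrNz cexpN cexpMn -exprnN.
Qed.

(** Real and imaginary parts are estimated separately, |a b| is absorbed by a^2 + b^2, and 4 is a
    crude total. The factor exp |z| is harmless later, where a Gaussian multiplies it. *)
Lemma cexp_taylor1_le z :
  normc (cexp z - 1 - z) <= 4 * normc z ^+ 2 * expR (normc z).
Proof.
have : normc z ^+ 2 = complex.Re z ^+ 2 + complex.Im z ^+ 2 := normc_sq z.
have : `|complex.Re z| <= normc z := normc_Re z.
have : `|complex.Im z| <= normc z := normc_Im z.
move=> hb ha hN; apply: le_trans (normc_ReIm _) _.
have N0 := normc_ge0 z; pose N : R := normc z.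
rewrite -/N in ha hb hN N0 *; move: N ha hb hN N0 => N.
case: z => a b /= ha hb hN N0; rewrite !mul0r subr0 addr0 subr0.
have ea : expR `|a| <= expR N by rewrite ler_expR.
have eb : `|b| <= expR N.
  by rewrite (le_trans hb) // (le_trans _ (expR_ge1Dx _)) // lerDr.
have e1 : 1 <= expR N by rewrite -expR0 ler_expR.
have sa := sqr_ge0 a; have sb := sqr_ge0 b.
have A : `|expR a * cos b - 1 - a| <= a ^+ 2 * expR N + expR N * b ^+ 2.
  rewrite (_ : _ - _ - _ = (expR a - 1 - a) + expR a * (cos b - 1)); last ring.
  rewrite (le_trans (ler_normD _ _)) // lerD //.
    by rewrite (le_trans (expR_taylor1_le _)) // ler_wpM2l.
  rewrite normrM (ger0_norm (expR_ge0 _)) ler_pM ?expR_ge0 //.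
    by rewrite ler_expR (le_trans (ler_norm _)).
  by rewrite (le_trans (cos_le_dist _)) // ler_pdivrMr //; lra.
have B : `|expR a * sin b - b| <= `|a| * expR N * `|b| + b ^+ 2 * expR N.
  rewrite (_ : _ - _ = (expR a - 1) * sin b + (sin b - b)); last ring.
  rewrite (le_trans (ler_normD _ _)) // lerD //.
    rewrite normrM ler_pM // ?normr_sin_le //.
    by rewrite (le_trans (expR_dist1_le _)) // ler_wpM2l.
  by rewrite (le_trans (sin_dist_le _)) // ler_wpM2l.
have AB : `|a| * `|b| <= a ^+ 2 + b ^+ 2.
  rewrite -(real_normK (num_real a)) -(real_normK (num_real b)).
  by have := sqr_ge0 (`|a| - `|b|); have := sqr_ge0 (`|a| + `|b|); nra.
have AB' := ler_wpM2r (expR_ge0 N) AB.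
rewrite hN (le_trans (lerD A B)) //; nra.
Qed.

Lemma cexp_2pii_int (n : int) : cexp ('i * (pi *+ 2)%:C * n%:~R : C) = 1.
Proof.
rewrite mulrzr cexpMz (_ : cexp _ = 1) ?exp1rz //.
rewrite (_ : 'i * _ = 0 +i* (pi *+ 2)); last by simpc.
by rewrite cexpE expR0 cos2pi sin2pi mulr1 mulr0.
Qed.

End ComplexExponential.

(** * Unordered sums *)

Section UnorderedSums.
Variable R : realType.
Local Notation C := R[i].
Local Open Scope fset_scope.
Local Open Scope ring_scope.

(** Convergence along the finite subsets. Unlike [summability.sum], a limit with a default value on
    divergent families, the predicate carries the existence of the sum. *)
Definition hassum (T : choiceType) (f : T -> C) (s : C) : Prop :=
  forall e : R, 0 < e -> exists A : {fset T}, forall B : {fset T}, A `<=` B ->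
    normc (\sum_(x <- B) f x - s) < e.

Definition abs_bounded (T : choiceType) (f : T -> C) (M : R) : Prop :=
  forall A : {fset T}, \sum_(x <- A) normc (f x) <= M.

Lemma divr2_gt0 (e : R) : 0 < e -> 0 < e / 2.
Proof. by move=> e0; rewrite divr_gt0. Qed.

Lemma hassum_unique (T : choiceType) (f : T -> C) s t :
  hassum f s -> hassum f t -> s = t.
Proof.
move=> hs ht; apply/eqP; rewrite -subr_eq0 -normc_eq0 eq_le normc_ge0 andbT.
apply/ler_addgt0Pr => e e0; rewrite add0r.
have [A hA] := hs (e / 2) (divr2_gt0 e0).
have [B hB] := ht (e / 2) (divr2_gt0 e0).
have h1 := hA (A `|` B) (fsubsetUl _ _).
have h2 := hB (A `|` B) (fsubsetUr _ _).
rewrite (splitr e); apply: le_trans (lerD (ltW h1) (ltW h2)).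
rewrite [X in _ <= X + _]normcBC (le_trans _ (normcD _ _)) //.
by rewrite addrA subrK.
Qed.

Lemma hassum_ext (T : choiceType) (f g : T -> C) s :
  f =1 g -> hassum f s -> hassum g s.
Proof. by move=> /funext ->. Qed.

Lemma hassum0 (T : choiceType) : hassum (fun _ : T => 0 : C) 0.
Proof.
by move=> e e0; exists fset0 => B _; rewrite big1 // subrr normc0.
Qed.

Lemma hassumD (T : choiceType) (f g : T -> C) s t :
  hassum f s -> hassum g t -> hassum (fun x => f x + g x) (s + t).
Proof.
move=> hs ht e e0.
have [A hA] := hs (e / 2) (divr2_gt0 e0).
have [B hB] := ht (e / 2) (divr2_gt0 e0).
exists (A `|` B) => D; rewrite fsubUset => /andP[/hA h1 /hB h2].
rewrite big_split /= opprD addrACA (le_lt_trans (normcD _ _)) //.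
by rewrite (splitr e) ltrD.
Qed.

Lemma hassumZ (T : choiceType) (f : T -> C) s c :
  hassum f s -> hassum (fun x => c * f x) (c * s).
Proof.
move=> hs e e0; have [->|c0] := eqVneq c 0.
  by exists fset0 => B _; rewrite big1 ?mul0r ?subrr ?normc0 // => i; rewrite mul0r.
have nc0 : 0 < normc c by rewrite normc_gt0.
have [A hA] := hs (e / normc c) (divr_gt0 e0 nc0).
exists A => B /hA; rewrite -mulr_sumr -mulrBr normcM ltr_pdivlMr //.
by rewrite mulrC.
Qed.

Lemma hassumN (T : choiceType) (f : T -> C) s :
  hassum f s -> hassum (fun x => - f x) (- s).
Proof.
move=> /(hassumZ (-1)); rewrite mulN1r; apply: hassum_ext => x.
by rewrite mulN1r.
Qed.

Lemma hassumB (T : choiceType) (f g : T -> C) s t :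
  hassum f s -> hassum g t -> hassum (fun x => f x - g x) (s - t).
Proof. by move=> hs /hassumN; exact: hassumD. Qed.

Lemma hassum_big (T : choiceType) (I : Type) (r : seq I) (f : I -> T -> C)
    (s : I -> C) :
  (forall i, hassum (f i) (s i)) ->
  hassum (fun x => \sum_(i <- r) f i x) (\sum_(i <- r) s i).
Proof.
move=> h; elim: r => [|i r IH].
  by rewrite big_nil; apply: hassum_ext (@hassum0 T) => x; rewrite big_nil.
rewrite big_cons; apply: hassum_ext (hassumD (h i) IH) => x.
by rewrite big_cons.
Qed.

Lemma hassum_le (T : choiceType) (f : T -> C) s M :
  hassum f s -> abs_bounded f M -> normc s <= M.
Proof.
move=> hs hM; apply/ler_addgt0Pr => e e0; have [A /(_ A (fsubset_refl A)) h] := hs e e0.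
have -> : s = \sum_(x <- A) f x - (\sum_(x <- A) f x - s) by rewrite opprB addrCA subrr addr0.
rewrite (le_trans (normcD _ _)) // normcNE lerD ?(ltW h) //.
by rewrite (le_trans (normc_sum _ _ _)) // hM.
Qed.

(** Serves bijections, sums over the multiples of L and the decomposition of a lattice into
    lines. *)
Lemma hassum_inj (T U : choiceType) (i : U -> T) (f : T -> C) s :
  injective i -> (forall x, (forall u, i u <> x) -> f x = 0) ->
  hassum f s <-> hassum (f \o i) s.
Proof.
move=> inj f0.
have inv (x : T) : {u | i u = x} + (forall u, i u <> x).
  case: (pselect (exists u, i u = x)) => [/cid [u <-]|h]; first by left; exists u.
  by right=> u e; apply: h; exists u.
have sumE (B : {fset U}) (E : {fset T}) : i @` B `<=` E ->
    (forall u, i u \in E -> u \in B) ->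
    \sum_(x <- E) f x = \sum_(u <- B) f (i u).
  move=> sBE hE; rewrite -(big_fset_incl _ sBE) ?big_imfset //=.
    by move=> u v _ _; exact: inj.
  move=> x xE xB; apply: f0 => u e; case/negP: xB; rewrite -e.
  by apply/imfsetP; exists u => //=; apply: hE; rewrite e.
split=> h e e0; have [A hA] := h e e0.
  pose pre (x : T) := if inv x is inl (exist u _) then [fset u] else fset0.
  exists (\bigcup_(x <- A) pre x) => B hB /=.
  rewrite -(sumE B (i @` B `|` A)) ?fsubsetUl ?hA ?fsubsetUr // => u.
  rewrite inE => /orP[/imfsetP[v /= vB /inj ->] //|uA].
  apply: (fsubsetP hB); apply/bigfcupP; exists (i u); first by rewrite uA.
  rewrite /pre; case: (inv (i u)) => [[v e']|/(_ u) //].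
  by rewrite inE; apply/eqP/inj.
exists (i @` A) => B hB.
pose pre (x : T) := if inv x is inl (exist u _) then [fset u] else fset0.
pose B' := \bigcup_(x <- B) pre x.
have memB' u : (u \in B') = (i u \in B).
  apply/bigfcupP/idP => [[x /andP[xB _]]|uB].
    rewrite /pre; case: (inv x) => [[v e']|_]; last by rewrite inE.
    by rewrite inE => /eqP ->; rewrite e'.
  exists (i u); first by rewrite uB.
  rewrite /pre; case: (inv (i u)) => [[v e']|/(_ u) //].
  by rewrite inE; apply/eqP/inj.
rewrite (sumE B' B) ?hA //.
- apply/fsubsetP => u uA; rewrite memB'; apply: (fsubsetP hB).
  by apply/imfsetP; exists u.
- by apply/fsubsetP => x /imfsetP[u /= uB ->]; rewrite -memB'.
- by move=> u; rewrite memB'.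
Qed.

Lemma hassum_bij (T U : choiceType) (i : U -> T) (f : T -> C) s :
  bijective i -> hassum f s <-> hassum (f \o i) s.
Proof.
move=> [j ij ji]; apply: hassum_inj (can_inj ij) _ => x /(_ (j x)).
by rewrite ji.
Qed.

(** Only finitely many fibres are compared at a time: one finite set of second coordinates serves
    all of them, and the rectangle it spans contains the set given by the convergence of the double
    sum. *)
Lemma hassum_fubini (T U : choiceType) (f : T * U -> C) (g : T -> C) s :
  hassum f s -> (forall t, hassum (fun u => f (t, u)) (g t)) -> hassum g s.
Proof.
move=> hs hg e e0.
have [A hA] := hs (e / 2) (divr2_gt0 e0).
exists [fset p.1 | p in A] => B hB.
(* The error e / 2 is shared by the fibres over B; the successor keeps the denominator nonzero when
   B is empty. *)
pose d := e / 2 / (#|` B|.+1)%:R.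
have d0 : 0 < d by rewrite !divr_gt0.
have [D hD] := choice (fun t => hg t d d0).
pose E := [fset p.2 | p in A] `|` \bigcup_(t <- B) D t.
pose BE := [fset ((t, u) : T * U) | t in B, u in E].
have hBE : A `<=` BE.
  apply/fsubsetP => -[t u] tuA; apply/imfset2P; exists t => /=.
    by apply: (fsubsetP hB); apply/imfsetP; exists (t, u).
  by exists u => //; rewrite inE; apply/orP; left; apply/imfsetP; exists (t, u).
have -> : \sum_(t <- B) g t - s = (\sum_(p <- BE) f p - s) -
    \sum_(t <- B) (\sum_(u <- E) f (t, u) - g t).
  rewrite big_imfset2 /=; last by move=> [??] [??] _ _ /= [-> ->].
  by rewrite sumrB opprB [RHS]addrC addrA subrK.
rewrite (le_lt_trans (normcD _ _)) // normcNE (splitr e) ltr_leD ?hA //.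
rewrite (le_trans (normc_sum _ _ _)) // big_seq.
apply: (@le_trans _ _ (\sum_(t <- B | t \in B) d)).
  apply: ler_sum => t tB; apply/ltW/hD; apply: fsubsetU; apply/orP; right.
  by apply/fsubsetP => u uD; apply/bigfcupP; exists t; rewrite ?tB.
rewrite -big_seq big_const_seq count_predT iter_addr addr0 -[leLHS]mulr_natr /d.
by rewrite -mulrA ler_piMr ?ltW ?divr2_gt0 // ltr_pdivrMl // mulr1 ltr_nat.
Qed.

Lemma hassum_sum (T : choiceType) (f : T -> C) s :
  hassum f s -> @summability.sum T C C^o f = s.
Proof.
move=> hs; have FF := @summability.totally_filter T.
apply: (@cvg_lim C^o) => //; apply/(@cvgrPdist_lt C C^o) => -[e e'].
rewrite ltcE /= => /andP[/eqP -> e0]; have [A hA] := hs e e0.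
exists A => // B /= /hA; rewrite /summability.partial_sum.
rewrite (big_seq_fsetE _ B xpredT f) /= => h.
by rewrite [X in X < _](norm_normc (s - \sum_i f (fsval i))) normcBC ltcR.
Qed.

Lemma hassum_ge0 (T : choiceType) (f : T -> R) (M : R) :
  (forall x, 0 <= f x) -> (forall A : {fset T}, \sum_(x <- A) f x <= M) ->
  exists s, hassum (fun x => (f x)%:C) s.
Proof.
move=> f0 hM; pose S := [set \sum_(x <- A) f x | A in [set: {fset T}]]%classic.
have supS : has_sup S.
  split; first by exists (\sum_(x <- fset0) f x), fset0.
  by exists M => _ [A _ <-].
exists (sup S)%:C => e e0.
have [_ [A _ <-] hA] := sup_adherent e0 supS.
exists A => B AB; rewrite -rmorph_sum -rmorphB normcR ltr_norml; apply/andP; split.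
  rewrite ltrBrDl; apply: lt_le_trans hA _.
  rewrite (big_fsetID _ (mem A) B) /=.
  have -> : [fset x in B | x \in A] = A.
    apply/fsetP => x; rewrite !inE /=; case: (boolP (x \in A)) => xA.
      by rewrite (fsubsetP AB).
    by rewrite andbF.
  by rewrite lerDl sumr_ge0.
rewrite (@le_lt_trans _ _ 0) // subr_le0; apply: ub_le_sup; first exact: supS.2.
by exists B.
Qed.

(** A real function g with |g| <= |f| is the difference of the nonnegative summable functions g +
    |f| and |f|; this applies to the real and imaginary parts. *)
Lemma abs_bounded_hassum (T : choiceType) (f : T -> C) M :
  abs_bounded f M -> exists2 s, hassum f s & normc s <= M.
Proof.
move=> hM; suff [s hs] : exists s, hassum f s.
  by exists s => //; exact: hassum_le hs hM.
have [n hn] := @hassum_ge0 T (fun x => normc (f x)) M (fun x => normc_ge0 _) hM.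
have part (g : T -> R) : (forall x, `|g x| <= normc (f x)) ->
    exists s, hassum (fun x => (g x)%:C) s.
  move=> gf; have [p hp] : exists s, hassum (fun x => (g x + normc (f x))%:C) s.
    apply: (@hassum_ge0 _ _ (M + M)) => [x|A].
      by rewrite addrC -[g x]opprK subr_ge0 (le_trans _ (gf x)) // -normrN ler_norm.
    rewrite big_split /= lerD ?hM // (le_trans _ (hM A)) // ler_sum // => x _.
    by rewrite (le_trans (ler_norm _)).
  exists (p - n); apply: hassum_ext (hassumB hp hn) => x /=.
  by rewrite -rmorphB /= addrK.
have [a ha] := part (fun x => complex.Re (f x)) (fun x => normc_Re _).
have [b hb] := part (fun x => complex.Im (f x)) (fun x => normc_Im _).
exists (a + 'i * b); apply: hassum_ext (hassumD ha (hassumZ 'i hb)) => x.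
by rewrite -complexE.
Qed.

Lemma abs_bounded_le (T : choiceType) (f : T -> C) (g : T -> R) M :
  (forall x, normc (f x) <= g x) ->
  (forall A : {fset T}, \sum_(x <- A) g x <= M) -> abs_bounded f M.
Proof. by move=> fg hM A; rewrite (le_trans _ (hM A)) // ler_sum. Qed.

End UnorderedSums.

(** * Sums over the integers *)

Section IntegerSums.
Variable R : realType.
Local Notation C := R[i].
Implicit Types (a r M : R).

Lemma ler_sum_subset (T : eqType) (s t : seq T) (f : T -> R) :
  uniq s -> uniq t -> {subset s <= t} -> (forall x, 0 <= f x) ->
  \sum_(x <- s) f x <= \sum_(x <- t) f x.
Proof.
move=> us ut st f0; rewrite [leRHS](bigID (mem s)) /= -[X in _ <= X + _]big_filter.
have pe : perm_eq [seq x <- t | x \in s] s.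
  apply: uniq_perm => //; first exact: filter_uniq.
  by move=> x; rewrite mem_filter andb_idr // => /st.
by rewrite [X in _ <= X + _](perm_big _ pe) /= lerDl sumr_ge0.
Qed.

Lemma geometric_sum_le r n : 0 <= r -> r < 1 -> \sum_(i < n) r ^+ i <= (1 - r)^-1.
Proof.
move=> r0 r1; have r1' : 0 < 1 - r by rewrite subr_gt0.
rewrite -(ler_pM2l r1') mulfV ?gt_eqF //.
have -> : (1 - r) * \sum_(i < n) r ^+ i = 1 - r ^+ n.
  by rewrite -opprB mulNr -subrX1 opprB.
by rewrite gerBl exprn_ge0.
Qed.

(** Two geometric series, one for each sign; each is at most 1 / (1 - exp (-a)) <= 1 + 1 / a because
    exp (-a) <= 1 / (1 + a). *)
Lemma exp_int_sum_le a (s : seq int) : 0 < a -> uniq s ->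
  \sum_(j <- s) expR (- (a * `|j%:~R|)) <= 2 + 2 / a.
Proof.
move=> a0 us; have [N hN] : exists N, forall j, j \in s -> (`|j| < N)%N.
  exists (\max_(j <- s) `|j|%N).+1 => j js.
  by rewrite ltnS; apply: (leq_bigmax_seq (F := fun j : int => `|j|%N)).
pose t := [seq Posz n | n <- iota 0 N] ++ [seq Negz n | n <- iota 0 N].
have ut : uniq t.
  rewrite cat_uniq !map_inj_uniq ?iota_uniq ?andbT; try by move=> ? ? [].
  by apply/hasPn => x /mapP[n _ ->]; apply/negP => /mapP[].
have st : {subset s <= t}.
  move=> j js; have jN := hN j js.
  rewrite mem_cat; apply/orP; case: j js jN => n js jN; [left|right];
    apply/map_f; rewrite mem_iota add0n //=.
  exact: ltn_trans jN.
apply: le_trans (ler_sum_subset us ut st _) _ => [x|]; first exact: expR_ge0.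
have r1 : expR (- a) < 1 by rewrite expR_lt1 oppr_lt0.
have e1 n : expR (- (a * `|n%:R|)) = expR (- a) ^+ n.
  by rewrite normr_nat -mulNr expRM_natr.
rewrite big_cat !big_map /=.
under eq_bigr do rewrite -pmulrn e1.
under [X in _ + X <= _]eq_bigr => n _.
  rewrite NegzE intrN normrN -pmulrn e1.
  over.
rewrite -{1 2}[N]subn0 -/(index_iota 0 N) !big_mkord.
have h : \sum_(i < N) expR (- a) ^+ i <= 1 + a^-1.
  apply: le_trans (geometric_sum_le _ (expR_ge0 _) r1) _.
  rewrite -[leRHS]invrK lef_pV2 ?posrE ?subr_gt0 ?invr_gt0 ?addr_gt0 ?invr_gt0 //.
  rewrite lerBrDl -lerBrDr.
  have : expR (- a) <= (1 + a)^-1.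
    by rewrite expRN lef_pV2 ?posrE ?expR_gt0 ?addr_gt0 // expR_ge1Dx.
  move=> /le_trans; apply; rewrite le_eqVlt; apply/orP; left; apply/eqP.
  by field; rewrite !gt_eqF ?addr_gt0.
have h' : \sum_(i < N) expR (- a) ^+ i.+1 <= 1 + a^-1.
  apply: le_trans h; apply: ler_sum => i _; rewrite exprS ler_piMl ?exprn_ge0 ?expR_ge0 //.
  exact: ltW.
by apply: le_trans (lerD h h') _; lra.
Qed.

Lemma abs_bounded_exp (f : int -> C) a M : 0 < a -> 0 <= M ->
  (forall j, normc (f j) <= M * expR (- (a * `|j%:~R|))) ->
  abs_bounded f (M * (2 + 2 / a)).
Proof.
move=> a0 M0 hf; apply: (abs_bounded_le hf) => A.
by rewrite -mulr_sumr ler_wpM2l // exp_int_sum_le ?fset_uniq.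
Qed.

(** The bound is independent of L: for a = 1 / L the sum is at most M (2 + 2 L), and (2 + 2 L) / L
    <= 4. *)
Lemma abs_bounded_mesh (f : int -> C) M (L : nat) : (0 < L)%N -> 0 <= M ->
  (forall j, normc (f j) <= M * expR (- `|j%:~R / L%:R|)) ->
  abs_bounded (fun j => L%:R^-1 * f j) (4 * M).
Proof.
move=> L0 M0 hf A; have L0' : 0 < L%:R :> R by rewrite ltr0n.
have iL : 0 < L%:R^-1 :> R by rewrite invr_gt0.
have e : normc (L%:R^-1 : C) = L%:R^-1 by rewrite normcV normc_nat.
under eq_bigr do rewrite normcM e.
rewrite -mulr_sumr ler_pdivrMl //.
have h := @abs_bounded_exp f L%:R^-1 M iL M0 _ A; apply: le_trans (h _) _ => [j|].
  by apply: le_trans (hf j) _; rewrite normrM (gtr0_norm iL) [X in - X]mulrC.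
rewrite invrK mulrA [leRHS]mulrC ler_wpM2l //.
have : 1 <= L%:R :> R by rewrite ler1n.
by nra.
Qed.

Definition usum (T : choiceType) (f : T -> C) : C := @summability.sum T C C^o f.

Lemma usumP (T : choiceType) (f : T -> C) M : abs_bounded f M -> hassum f (usum f).
Proof.
by case/abs_bounded_hassum => s hs _; rewrite (_ : usum f = s) //; exact: hassum_sum.
Qed.

Lemma hassum_usum (T : choiceType) (f : T -> C) s : hassum f s -> usum f = s.
Proof. exact: hassum_sum. Qed.

(** The window from -K to K is a complete system of residues modulo 2 K + 1, whence the indexing by
    shifted ordinals. *)
Definition ball_sum (f : int -> C) (K : nat) : C :=
  \sum_(r < (K + K).+1) f (Posz r - Posz K).

Lemma hassum_int (f : int -> C) s : hassum f s -> forall e : R, 0 < e ->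
  exists K0 : nat, forall K : nat, (K0 <= K)%N -> normc (ball_sum f K - s) < e.
Proof.
move=> hs e e0; have [A hA] := hs e e0.
exists (\max_(j <- A) `|j|%N) => K hK.
pose B := [fset (Posz (r : 'I_(K + K).+1) - Posz K : int) | r in 'I_(K + K).+1]%fset.
have -> : ball_sum f K = \sum_(x <- B) f x.
  rewrite big_imfset /=; last by move=> r1 r2 _ _ /addIr [] /ord_inj.
  by rewrite big_enum.
apply: hA; apply/fsubsetP => j jA.
have jK : (`|j| <= K)%N.
  by apply: leq_trans hK; apply: (leq_bigmax_seq (F := fun j : int => `|j|%N)).
have h : (`|(j + K%:Z)%R| < (K + K).+1)%N by lia.
by apply/imfsetP; exists (Ordinal h) => //=; lia.
Qed.

Lemma ball_sumE (f : int -> C) K :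
  ball_sum f K = f 0 + \sum_(1 <= n < K.+1) (f n%:Z + f (- n%:Z)).
Proof.
elim: K => [|K IH].
  by rewrite /ball_sum big_ord1 big_geq // [RHS]addr0 /=; congr f; lia.
rewrite big_nat_recr //= addrA -IH /ball_sum addnS addSn big_ord_recl big_ord_recr /=.
rewrite [LHS]addrC -[LHS]addrA; congr (_ + (_ + _)); last by congr f; lia.
  by apply: eq_bigr => i _; congr f; rewrite /bump /=; lia.
by congr f; rewrite /bump /=; lia.
Qed.

(** Telescoping, from 1 / n^2 <= 1 / (n - 1) - 1 / n. *)
Lemma inv_sq_sum_le (N K : nat) : (0 < N)%N ->
  \sum_(N.+1 <= n < K.+1) (n%:R ^+ 2)^-1 <= N%:R^-1 :> R.
Proof.
move=> N0; have [KN|NK] := ltnP K N.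
  by rewrite big_geq ?invr_ge0 ?ler0n // ltnW.
apply: (@le_trans _ _ (N%:R^-1 - K%:R^-1)); last by rewrite gerBl invr_ge0 ler0n.
elim: K NK => [|K IH]; first by rewrite leqn0 => /eqP N0'; rewrite N0' in N0.
rewrite leq_eqVlt => /predU1P[->|NK]; first by rewrite big_geq // subrr.
rewrite big_nat_recr //=; apply: le_trans (lerD (IH NK) (lexx _)) _.
have K0 : 0 < K%:R :> R by rewrite ltr0n (leq_trans N0).
rewrite -subr_ge0 (_ : _ - _ = (K%:R * K.+1%:R ^+ 2)^-1).
  by rewrite invr_ge0 mulr_ge0 ?sqr_ge0 // ltW.
by rewrite -natr1; field; rewrite !gt_eqF ?addr_gt0 ?(ltr0n _ N).
Qed.

(** Dominated convergence for sums whose range grows with K: the domination by B / n^2 is available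
    inside the window |n| <= K only, and the sum sees nothing else. *)
Lemma tannery (f : nat -> int -> C) (B : R) (K1 : nat) : 0 <= B ->
  (forall K (n : nat), (K1 <= K)%N -> (0 < n <= K)%N ->
    normc (f K n%:Z) <= B / n%:R ^+ 2 /\ normc (f K (- n%:Z)) <= B / n%:R ^+ 2) ->
  (forall k (e : R), 0 < e -> exists K0 : nat, forall K : nat, (K0 <= K)%N ->
    normc (f K k) <= e) ->
  forall e : R, 0 < e -> exists K0 : nat, forall K : nat, (K0 <= K)%N ->
    normc (ball_sum (f K) K) <= e.
Proof.
move=> B0 hB hc e e0.
have e2 : 0 < e / 2 by rewrite divr_gt0.
(* Beyond N the two tails together are at most 2 B / N, whatever K is. *)
have [N N0 hN] : exists2 N, (0 < N)%N & 2 * B / N%:R <= e / 2.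
  exists (Num.truncn (2 * B / (e / 2))).+1 => //.
  apply/ltW; rewrite ltr_pdivrMr ?ltr0n // [ltRHS]mulrC -ltr_pdivrMr //.
  exact: truncnS_gt.
have head (m : nat) (d : R) : 0 < d -> exists K0 : nat, forall K : nat, (K0 <= K)%N ->
    normc (f K 0) + \sum_(1 <= n < m.+1) (normc (f K n%:Z) + normc (f K (- n%:Z))) <= d.
  elim: m d => [|m IH] d d0.
    by have [K0 h] := hc 0 d d0; exists K0 => K /h; rewrite big_geq // addr0.
  have d3 : 0 < d / 3 by rewrite divr_gt0.
  have [K4 h1] := IH _ d3; have [K2 h2] := hc m.+1%:Z _ d3.
  have [K3 h3] := hc (- m.+1%:Z) _ d3.
  exists (maxn K4 (maxn K2 K3)) => K; rewrite !geq_max => /and3P[/h1 l1 /h2 l2 /h3 l3].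
  rewrite big_nat_recr //= addrA; lra.
have [K0 hK0] := head N _ e2.
exists (maxn K1 (maxn K0 N)) => K; rewrite !geq_max => /and3P[K1K /hK0 h1 NK].
rewrite ball_sumE (big_cat_nat (n := N.+1)) //= addrA.
rewrite (le_trans (normcD _ _)) // (splitr e) lerD //.
  apply: le_trans h1; rewrite (le_trans (normcD _ _)) // lerD2l.
  by rewrite (le_trans (normc_sum _ _ _)) // ler_sum // => n _; exact: normcD.
apply: le_trans hN; rewrite (le_trans (normc_sum _ _ _)) //.
apply: (@le_trans _ _ (\sum_(N.+1 <= n < K.+1) 2 * B * (n%:R ^+ 2)^-1)).
  rewrite big_nat [leRHS]big_nat; apply: ler_sum => n /andP[n1 n2].
  have [||l1 l2] := hB K n; first by [].
    by rewrite (leq_trans _ n1).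
  by rewrite (le_trans (normcD _ _)) //; lra.
by rewrite -mulr_sumr ler_wpM2l ?mulr_ge0 // inv_sq_sum_le.
Qed.

End IntegerSums.

(** * Gaussian Riemann sums *)

Section GaussianEstimates.
Variable R : realType.
Local Notation C := R[i].
Implicit Types (x t k P Q M e : R) (p z b c d : C).

Definition gauss z : C := cexp (- (pi%:C * z ^+ 2)).

Lemma gaussD p d : gauss (p + d) = gauss p * cexp (- (pi%:C * (2 * p * d + d ^+ 2))).
Proof. by rewrite /gauss -cexpD; congr cexp; ring. Qed.

Lemma pi_le4 : pi <= 4 :> R.
Proof. by have := @pihalf_lt2 R; lra. Qed.

Lemma normc_gauss p : normc (gauss p) = expR (- (pi * complex.Re (p ^+ 2))).
Proof. by rewrite normc_cexp Re_opp Re_realM. Qed.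

(** Factoring out gauss p leaves exp (-z) with z = pi (2 p d + d^2); the linear part of this
    contains pi d^2 besides the wanted 2 pi p d, hence the last term. *)
Lemma gauss_taylor p d :
  normc (gauss (p + d) - gauss p + 2 * pi%:C * p * d * gauss p) <=
  normc (gauss p) * (4 * normc (pi%:C * (2 * p * d + d ^+ 2)) ^+ 2 *
     expR (normc (pi%:C * (2 * p * d + d ^+ 2))) + pi * normc d ^+ 2).
Proof.
rewrite gaussD; set z := pi%:C * _.
have -> : gauss p * cexp (- z) - gauss p + 2 * pi%:C * p * d * gauss p =
  gauss p * ((cexp (- z) - 1 - (- z)) - pi%:C * d ^+ 2) by rewrite /z; ring.
rewrite normcM ler_wpM2l ?normc_ge0 // (le_trans (normcD _ _)) // lerD //.
  by have := cexp_taylor1_le (- z); rewrite normcNE.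
by rewrite normcNE normcM normcX normcR ger0_norm // pi_ge0.
Qed.

(** Completing the square: a Gaussian swallows any linear exponent and still leaves exp (- K
    |x|). *)
Lemma quadratic_le k P K x : 0 < k ->
  - k * x ^+ 2 + P * `|x| <= (P + K) ^+ 2 / (4 * k) - K * `|x|.
Proof.
move=> k0; rewrite -subr_ge0 -(real_normK (num_real x)).
rewrite (_ : _ - _ = (2 * k * `|x| - (P + K)) ^+ 2 / (4 * k)).
  by rewrite divr_ge0 ?sqr_ge0 // mulr_ge0 // ltW.
by field; rewrite gt_eqF.
Qed.

Lemma ler_sqr_ge0 (r s : R) : 0 <= r -> r <= s -> r ^+ 2 <= s ^+ 2.
Proof. by move=> r0 rs; rewrite ler_sqr ?nnegrE // (le_trans r0). Qed.

Lemma onePx_le_exp x : 1 + `|x| <= expR `|x|.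
Proof. exact: expR_ge1Dx. Qed.

(* The estimates below hold uniformly for points [p] that lie, at distance
   comparable to [|x|], in a closed sector around the real axis. *)
Definition in_sector k P Q x p :=
  normc p <= P * (1 + `|x|) /\
  k * x ^+ 2 - Q * `|x| - Q <= complex.Re (p ^+ 2).

(** As pi >= 2, the Gaussian supplies exp (- 2 k x^2): one half pays for exp (k x^2) on the left,
    the other for the linear terms. The spare factor later absorbs the exponential in Taylor
    remainders. *)
Lemma gauss_sector_le k P Q (K : R) : 0 < k -> 0 <= Q -> exists2 M, 0 <= M &
  forall x p, in_sector k P Q x p ->
  normc (gauss p) * expR (k * x ^+ 2) <= M * expR (- (K * `|x|)).
Proof.
move=> k0 Q0; exists (expR ((4 * Q + K) ^+ 2 / (4 * k) + 4 * Q)); first exact: expR_ge0.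
move=> x p [_ hp]; rewrite normc_gauss -!expRD ler_expR.
have := quadratic_le (4 * Q) K x k0.
have := pi_ge2 R; have := pi_le4; have := sqr_ge0 x; have := normr_ge0 x.
move: hp; move: (complex.Re _) (x ^+ 2) (`|x|) (pi : R) => r x2 ax q h1 h2 h3 h4 h5.
have A : q * (k * x2 - Q * ax - Q) <= q * r by rewrite ler_wpM2l //; lra.
have B : 2 * (k * x2) <= q * (k * x2) by rewrite ler_wpM2r ?mulr_ge0 // ltW.
have D : q * (Q * ax + Q) <= 4 * (Q * ax + Q).
  by rewrite ler_wpM2r ?addr_ge0 ?mulr_ge0.
lra.
Qed.

Lemma gauss_taylor_sector k P Q : 0 < k -> 1 <= P -> 0 <= Q ->
  exists2 e0, 0 < e0 & exists2 M, 0 <= M &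
  forall x p d e, in_sector k P Q x p -> normc d <= P * (1 + `|x|) ->
  0 <= e <= e0 ->
  normc (gauss (p + e%:C * d) - gauss p + 2 * pi%:C * p * (e%:C * d) * gauss p)
  <= e ^+ 2 * (M * expR (- (2 * `|x|))).
Proof.
move=> k0 P1 Q0; have P0 : 0 < P := lt_le_trans ltr01 P1.
(* Of the rate 6, four units are spent on (1 + |x|)^4 <= exp (4 |x|) and two remain. *)
have [M M0 hM] := gauss_sector_le P 6 k0 Q0.
(* Chosen so that |z| <= 12 e P^2 (1 + |x|)^2 <= k x^2 + k, and exp |z| is covered by the spare
   factor. *)
pose e0 := Num.min 1 (k / (24 * P ^+ 2)).
have P2 : 0 < 24 * P ^+ 2 by rewrite mulr_gt0 ?exprn_gt0.
have e00 : 0 < e0 by rewrite lt_min ltr01 divr_gt0.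
have P40 : 0 <= P ^+ 4 by rewrite exprn_ge0 // ltW.
have n580 : 0 <= 580 :> R by rewrite ler0n.
(* 580 is 4 times 144, from the square of the bound on |z|, plus 4, from pi <= 4. *)
exists e0 => //; exists (580 * P ^+ 4 * expR k * M).
  exact: mulr_ge0 (mulr_ge0 (mulr_ge0 n580 P40) (expR_ge0 k)) M0.
move=> x p d e sp hd /andP[e_ge0]; rewrite le_min => /andP[e1 ek].
have {}ek : 24 * P ^+ 2 * e <= k by rewrite mulrC -ler_pdivlMr.
apply: le_trans (gauss_taylor _ _) _.
set z := pi%:C * _; have [hp _] := sp.
pose y := 1 + `|x|; have y1 : 1 <= y by rewrite lerDl.
have y0 : 0 <= y by rewrite (le_trans _ y1).
have hed : normc (e%:C * d) <= e * (P * y) by rewrite normcM normcR ger0_norm // ler_wpM2l.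
have ed0 := normc_ge0 (e%:C * d); have p0 := normc_ge0 p.
have Py0 : 0 <= P * y by rewrite mulr_ge0 // ltW.
have hz : normc z <= 12 * e * (P * y) ^+ 2.
  rewrite /z normcM normcR (ger0_norm (pi_ge0 R)).
  have h : normc (2 * p * (e%:C * d) + (e%:C * d) ^+ 2) <= 3 * e * (P * y) ^+ 2.
    rewrite (le_trans (normcD _ _)) // normcX normcM [normc (2 * p)]normcM normc_nat.
    have A : normc p * normc (e%:C * d) <= (P * y) * (e * (P * y)) by apply: ler_pM.
    have B : normc (e%:C * d) ^+ 2 <= (e * (P * y)) ^+ 2 := ler_sqr_ge0 ed0 hed.
    have D : (e * (P * y)) ^+ 2 <= e * (P * y) ^+ 2.
      by rewrite exprMn ler_wpM2r ?sqr_ge0 // expr2 ler_piMr.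
    lra.
  apply: le_trans (ler_pM (pi_ge0 R) (normc_ge0 _) pi_le4 h) _; lra.
have z0 := normc_ge0 z.
have zx : normc z <= k * x ^+ 2 + k.
  apply: le_trans hz _.
  have : y ^+ 2 <= 2 * (1 + x ^+ 2).
    rewrite /y -(real_normK (num_real x)).
    by have := sqr_ge0 (1 - `|x|); rewrite !expr2; lra.
  move=> h; have : (24 * P ^+ 2 * e) * y ^+ 2 <= k * (2 * (1 + x ^+ 2)).
    by rewrite ler_pM ?mulr_ge0 ?sqr_ge0 // ltW.
  by rewrite exprMn; lra.
have ez : expR (normc z) <= expR (k * x ^+ 2) * expR k by rewrite -expRD ler_expR.
have ez1 : 1 <= expR (normc z) by rewrite -expR0 ler_expR.
have hsq : normc z ^+ 2 <= 144 * e ^+ 2 * (P ^+ 4 * y ^+ 4).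
  rewrite (_ : 144 * _ * _ = (12 * e * (P * y) ^+ 2) ^+ 2); last ring.
  exact: ler_sqr_ge0.
have hd2 : pi * normc (e%:C * d) ^+ 2 <= 4 * e ^+ 2 * (P ^+ 4 * y ^+ 4).
  have : normc (e%:C * d) ^+ 2 <= e ^+ 2 * (P * y) ^+ 2.
    by rewrite -exprMn; exact: ler_sqr_ge0.
  move=> h; apply: le_trans (ler_pM (pi_ge0 R) (sqr_ge0 _) pi_le4 h) _.
  have Py1 : 1 <= P * y by rewrite -[1]mulr1 ler_pM.
  have : (P * y) ^+ 2 <= P ^+ 4 * y ^+ 4 by rewrite -exprMn ler_weXn2l.
  by move=> /(ler_wpM2l (sqr_ge0 e)); lra.
have w0 : 0 <= e ^+ 2 * (P ^+ 4 * y ^+ 4).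
  exact: mulr_ge0 (sqr_ge0 e) (mulr_ge0 P40 (exprn_ge0 _ y0)).
have y4 : y ^+ 4 <= expR (4 * `|x|).
  by rewrite -[4]/(4%:R) expRM_natl lerXn2r ?nnegrE ?expR_ge0 ?onePx_le_exp.
have tot : 4 * normc z ^+ 2 * expR (normc z) + pi * normc (e%:C * d) ^+ 2 <=
   580 * (e ^+ 2 * (P ^+ 4 * expR (4 * `|x|))) * (expR (k * x ^+ 2) * expR k).
  apply: (@le_trans _ _ (580 * (e ^+ 2 * (P ^+ 4 * y ^+ 4)) * expR (normc z))).
    have := ler_wpM2r (expR_ge0 (normc z)) hsq.
    by have := ler_wpM2l w0 ez1; lra.
  apply: ler_pM; [exact: mulr_ge0|exact: expR_ge0| |exact: ez].
  by rewrite ler_wpM2l // ler_wpM2l ?sqr_ge0 // ler_wpM2l.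
apply: le_trans (ler_wpM2l (normc_ge0 _) tot) _.
have := hM x p sp; set G := normc (gauss p) => hG.
have E6 : expR (- (2 * `|x|)) = expR (- (6 * `|x|)) * expR (4 * `|x|).
  by rewrite -expRD; congr expR; ring.
rewrite {}E6; set E4 := expR (4 * _); set E6 := expR (- _) in hG *.
have W : 0 <= 580 * (e ^+ 2 * (P ^+ 4 * E4)) * expR k.
  exact: mulr_ge0 (mulr_ge0 n580 (mulr_ge0 (sqr_ge0 e) (mulr_ge0 P40 (expR_ge0 _)))) (expR_ge0 k).
by have := ler_wpM2l W hG; lra.
Qed.

End GaussianEstimates.

(** * Riemann sums along complex paths *)

Section GaussianRiemannSums.
Variable R : realType.
Local Notation C := R[i].
Implicit Types (x t k P Q M e : R) (p z b c d : C).

(** One estimate for two discrete derivatives. The first-order term is symmetric in [c] and [m], so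
    the two partial derivatives of the path may be put there in either order; [d] is the mixed
    derivative. *)
Lemma gauss_two_step k P Q : 0 < k -> 1 <= P -> 0 <= Q ->
  exists2 e0, 0 < e0 & exists2 M, 0 <= M &
  forall x p c d (m : C) e, in_sector k P Q x p ->
  normc c <= P * (1 + `|x|) -> normc m <= P * (1 + `|x|) -> normc d <= P ->
  0 <= e <= e0 ->
  normc ((c + e%:C * d) * gauss (p + e%:C * m) - c * gauss p
         - e%:C * (d * gauss p - 2 * pi%:C * p * m * c * gauss p))
  <= e ^+ 2 * (M * expR (- `|x|)).
Proof.
move=> k0 P1 Q0; have P0 : 0 <= P := le_trans ler01 P1.
have [e0 e00 [M1 M10 h1]] := gauss_taylor_sector k0 P1 Q0.
have [M2 M20 h2] := gauss_sector_le P 3 k0 Q0.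
exists (Num.min 1 e0); first by rewrite lt_min ltr01.
have P3 : 0 <= P ^+ 3 by rewrite exprn_ge0.
have P2 : 0 <= P * 2 by rewrite mulr_ge0.
exists (P * 2 * M1 + 8 * P ^+ 3 * M2).
  by apply: addr_ge0; apply: mulr_ge0 => //; apply: mulr_ge0.
move=> x p c d m e sp hc hm hd; rewrite le_min => /and3P[e_ge0 e1 ee0].
pose T := gauss (p + e%:C * m) - gauss p + 2 * pi%:C * p * (e%:C * m) * gauss p.
have hT : normc T <= e ^+ 2 * (M1 * expR (- (2 * `|x|))).
  by apply: h1 => //; rewrite e_ge0.
have -> : (c + e%:C * d) * gauss (p + e%:C * m) - c * gauss p
         - e%:C * (d * gauss p - 2 * pi%:C * p * m * c * gauss p) =
   (c + e%:C * d) * T - (e ^+ 2)%:C * (2 * pi%:C * p * m * d * gauss p).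
  by rewrite /T rmorphXn; ring.
pose y := 1 + `|x|; have y1 : 1 <= y by rewrite lerDl.
have y0 : 0 <= y := le_trans ler01 y1.
have E1 : y <= expR `|x| := onePx_le_exp x.
have [hp _] := sp.
have cd : normc (c + e%:C * d) <= P * 2 * expR `|x|.
  rewrite (le_trans (normcD _ _)) // normcM normcR ger0_norm //.
  have : e * normc d <= P.
    by rewrite -[P]mul1r; apply: ler_pM; rewrite ?normc_ge0.
  have := ler_wpM2l P0 E1; have := ler_wpM2l P0 y1; rewrite /y in hc *; lra.
rewrite (le_trans (normcD _ _)) // normcNE [X in _ <= X](_ : _ =
  (P * 2 * expR `|x|) * (e ^+ 2 * (M1 * expR (- (2 * `|x|)))) +
  e ^+ 2 * (8 * P ^+ 3 * (expR `|x| * expR `|x|) * (M2 * expR (- (3 * `|x|))))); last first.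
  have -> : expR (- (2 * `|x|)) = expR (- `|x|) * expR (- `|x|).
    by rewrite -expRD; congr expR; ring.
  have -> : expR (- (3 * `|x|)) = expR (- `|x|) * expR (- `|x|) * expR (- `|x|).
    by rewrite -!expRD; congr expR; ring.
  have E : expR `|x| * expR (- `|x|) = 1 by rewrite expRxMexpNx_1.
  set A := expR `|x| in E *; set B := expR (- _) in E *.
  transitivity (e ^+ 2 * (P * 2 * M1 * (A * B) * B + 8 * P ^+ 3 * M2 * (A * B) ^+ 2 * B)).
    by rewrite E; ring.
  by ring.
apply: lerD.
  by rewrite normcM ler_pM ?normc_ge0.
rewrite normcM normcR ger0_norm ?sqr_ge0 // ler_wpM2l ?sqr_ge0 //.
rewrite normcM; apply: ler_pM; rewrite ?normc_ge0 //; last first.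
  apply: le_trans (h2 x p sp); rewrite ler_peMr ?normc_ge0 //.
  by rewrite -expR0 ler_expR mulr_ge0 ?sqr_ge0 // ltW.
rewrite !normcM normc_nat normcR (ger0_norm (pi_ge0 R)).
have A1 : 2 * pi <= 8 :> R by have := pi_le4 R; lra.
have A2 : normc p * normc m <= (P * expR `|x|) * (P * expR `|x|).
  by apply: ler_pM; rewrite ?normc_ge0 // ?(le_trans hp) ?(le_trans hm) // ler_wpM2l.
have A3 : normc p * normc m * normc d <= (P * expR `|x|) * (P * expR `|x|) * P.
  by apply: ler_pM; rewrite ?mulr_ge0 ?normc_ge0.
have A4 : 2 * pi * (normc p * normc m * normc d) <= 8 * ((P * expR `|x|) * (P * expR `|x|) * P).
  by apply: ler_pM; rewrite ?mulr_ge0 ?normc_ge0 ?pi_ge0.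
by lra.
Qed.

(* [t -> path_pt b u t x] is the straight path from [x] to [b * x + u], and
   [path_slope b t] is the derivative of [path_pt b u t x] in [x]. *)
Definition path_slope b t : C := 1 + t%:C * (b - 1).
Definition path_pt b u t x : C := x%:C + t%:C * ((b - 1) * x%:C + u).

(** The hypotheses say that |Im b| < Re b. All slopes 1 + t (b - 1) inherit this by convexity, so
    the Gaussian decays uniformly along the deformation. *)
Lemma path_in_sector b (u : C) : 0 < complex.Re b -> 0 < complex.Re (b ^+ 2) ->
  exists k P Q, [/\ 0 < k, 1 <= P, 0 <= Q &
  [/\ normc (b - 1) <= P, forall x t, 0 <= t <= 1 -> in_sector k P Q x (path_pt b u t x),
   forall x t, 0 <= t <= 1 -> normc (path_slope b t) <= P * (1 + `|x|) &
   forall x, normc ((b - 1) * x%:C + u) <= P * (1 + `|x|)]].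
Proof.
move=> b0; rewrite Re_mul -!expr2 => bb0; pose P : R := 1 + normc (b - 1) + normc u.
have n1 := normc_ge0 (b - 1); have n2 := normc_ge0 u.
have P1 : 1 <= P by rewrite /P; lra.
pose al : R := complex.Re b; pose be : R := complex.Im b.
rewrite -/al -/be in b0 bb0.
have albe : `|be| < al.
  rewrite -ltr_sqr ?nnegrE ?normr_ge0 ?ltW //.
  by rewrite real_normK ?num_real //; lra.
(* A lower bound of Re - |Im| for every slope, hence of Re + |Im| too; their product Re^2 - Im^2 is
   at least mu^2. *)
pose mu := Num.min 1 (al - `|be|).
have mu0 : 0 < mu by rewrite lt_min ltr01 subr_gt0.
have mu1 : mu <= 1 by rewrite ge_min lexx.
have mu2 : mu <= al - `|be| by rewrite ge_min lexx orbT.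
pose U : R := `|complex.Re u| + `|complex.Im u|.
have U0 : 0 <= U by rewrite addr_ge0.
(* The last constant collects the cross terms, at most 2 (1 + Re b) U |x|, and the square of the
   shift. *)
exists (mu ^+ 2), P, (2 * (1 + al) * U + U ^+ 2); split.
- exact: exprn_gt0.
- exact: P1.
- by rewrite addr_ge0 ?sqr_ge0 // !mulr_ge0 // addr_ge0 // ltW.
have hm x : normc ((b - 1) * x%:C + u) <= P * (1 + `|x|).
  rewrite (le_trans (normcD _ _)) // normcM normcR.
  have := normr_ge0 x; have : 0 <= normc u * `|x| by rewrite mulr_ge0.
  by rewrite /P; lra.
split => // [|x t /andP[t0 t1]|x t /andP[t0 t1]].
- by rewrite /P; lra.
- split.
    rewrite (le_trans (normcD _ _)) // normcM !normcR (ger0_norm t0).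
    have h : t * normc ((b - 1) * x%:C + u) <= normc ((b - 1) * x%:C + u).
      by rewrite ler_piMl ?normc_ge0.
    have h2 : normc ((b - 1) * x%:C + u) <= normc (b - 1) * `|x| + normc u.
      by rewrite (le_trans (normcD _ _)) // normcM normcR.
    have : 0 <= normc u * `|x| by rewrite mulr_ge0.
    by rewrite /P; lra.
  pose u1 : R := complex.Re u; pose u2 : R := complex.Im u.
  pose A : R := 1 + t * (al - 1).
  have reE : complex.Re (path_pt b u t x) = A * x + t * u1.
    by rewrite /path_pt /A /al /u1; case: (b) (u) => ? ? [? ?] /=; ring.
  have imE : complex.Im (path_pt b u t x) = t * be * x + t * u2.
    by rewrite /path_pt /be /u2; case: (b) (u) => ? ? [? ?] /=; ring.
  rewrite expr2 Re_mul reE imE.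
  have Abe : mu <= A - t * `|be|.
    have := ler_wpM2l t0 mu2; have : (1 - t) * mu <= (1 - t) * 1.
      by rewrite ler_wpM2l // subr_ge0.
    by rewrite /A; lra.
  have tb0 : 0 <= t * `|be| by rewrite mulr_ge0.
  have A0 : 0 <= A by lra.
  have hA : A <= 1 + al by rewrite /A; nra.
  have tb1 : t * `|be| <= 1 + al by lra.
  have K : mu ^+ 2 <= A ^+ 2 - (t * be) ^+ 2.
    have -> : (t * be) ^+ 2 = (t * `|be|) ^+ 2.
      by rewrite !exprMn real_normK ?num_real.
    rewrite subr_sqr expr2; apply: ler_pM; rewrite ?(ltW mu0) //; lra.
  have tu1 : `|t * u1| <= `|u1| by rewrite normrM (ger0_norm t0) ler_piMl.
  have tu2 : `|t * u2| <= `|u2| by rewrite normrM (ger0_norm t0) ler_piMl.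
  have x1 : `|A * x * (t * u1)| <= (1 + al) * `|x| * `|u1|.
    rewrite (normrM (A * x)) (normrM A) (ger0_norm A0); apply: ler_pM; rewrite ?mulr_ge0 //.
    by rewrite ler_wpM2r.
  have x2 : `|t * be * x * (t * u2)| <= (1 + al) * `|x| * `|u2|.
    rewrite (normrM (t * be * x)) (normrM (t * be)) (normrM t be) (ger0_norm t0).
    by apply: ler_pM; rewrite ?mulr_ge0 // ler_wpM2r.
  have u2U : (t * u2) ^+ 2 <= U ^+ 2.
    rewrite -(real_normK (num_real (t * u2))); apply: ler_sqr_ge0 => //.
    by rewrite (le_trans tu2) // /U lerDr.
  have Kx := ler_wpM2r (sqr_ge0 x) K.
  move: x1 x2; rewrite !ler_norml => /andP[x1 _] /andP[_ x2].
  have q1 : 0 <= (1 + al) * U by rewrite mulr_ge0 // addr_ge0 // ltW.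
  have q2 : 0 <= U ^+ 2 * `|x| by rewrite mulr_ge0 ?sqr_ge0.
  have := sqr_ge0 (t * u1); rewrite /U -/u1 -/u2 in u2U q1 q2 *; lra.
- rewrite (le_trans (normcD _ _)) // normc1 normcM normcR (ger0_norm t0).
  have : t * normc (b - 1) <= normc (b - 1) by rewrite ler_piMl.
  have : 0 <= P * `|x| by rewrite mulr_ge0 // (le_trans ler01).
  by rewrite /P; lra.
Qed.

Definition mesh (L : nat) (f : R -> C) : C :=
  usum (fun j : int => L%:R^-1 * f (j%:~R / L%:R)).

Definition exp_dominated (f : R -> C) := exists2 M, 0 <= M &
  forall x, normc (f x) <= M * expR (- `|x|).

Lemma mesh_hassum L f : (0 < L)%N -> exp_dominated f ->
  hassum (fun j : int => L%:R^-1 * f (j%:~R / L%:R)) (mesh L f).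
Proof.
move=> L0 [M M0 hM]; apply: (@usumP _ _ _ (4 * M)).
by apply: (abs_bounded_mesh (f := fun j : int => f (j%:~R / L%:R))) => // j; exact: hM.
Qed.

Lemma normc_mesh_le L f M : (0 < L)%N -> 0 <= M ->
  (forall x, normc (f x) <= M * expR (- `|x|)) -> normc (mesh L f) <= 4 * M.
Proof.
move=> L0 M0 hM; have dom : exp_dominated f by exists M.
apply: hassum_le (mesh_hassum L0 dom) _.
by apply: (abs_bounded_mesh (f := fun j : int => f (j%:~R / L%:R))) => // j; exact: hM.
Qed.

Lemma succ_bij : bijective (fun j : int => j + 1).
Proof. by exists (fun j => j - 1) => j; rewrite ?addrK ?subrK. Qed.

Lemma hassum_diff0 (f : int -> C) s : hassum f s ->
  hassum (fun j => f (j + 1) - f j) 0.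
Proof.
move=> hs; rewrite -(subrr s); apply: (hassumB _ hs).
exact: (hassum_bij f s succ_bij).1.
Qed.

Lemma path_slopeD b t e : path_slope b (t + e) = path_slope b t + e%:C * (b - 1).
Proof. by rewrite /path_slope rmorphD; ring. Qed.

Lemma path_ptD b u t e x :
  path_pt b u (t + e) x = path_pt b u t x + e%:C * ((b - 1) * x%:C + u).
Proof. by rewrite /path_pt rmorphD; ring. Qed.

Lemma path_ptDx b u t e x :
  path_pt b u t (x + e) = path_pt b u t x + e%:C * path_slope b t.
Proof. by rewrite /path_pt /path_slope rmorphD; ring. Qed.

(* Riemann sums of [gauss] along [b * x + u] and along the real axis have the
   same limit: with [p] the point of the path, the [t]-derivative of
   [p_x * gauss p] is the [x]-derivative of [p_t * gauss p], which telescopes. *)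
Lemma gauss_mesh_path b u : 0 < complex.Re b -> 0 < complex.Re (b ^+ 2) ->
  exists (M : R) (L0 : nat), 0 <= M /\ forall L : nat, (L0 < L)%N ->
  normc (mesh L (fun x => b * gauss (b * x%:C + u)) - mesh L (fun x => gauss x%:C))
  <= M / L%:R.
Proof.
move=> b0 bb0; have [k [P [Q [k0 P1 Q0 [hd hsec hslope hm]]]]] := path_in_sector u b0 bb0.
have P0 : 0 <= P := le_trans ler01 P1.
have [e0 e00 [M M0 h]] := gauss_two_step k0 P1 Q0.
have [M2 M20 hg] := gauss_sector_le P 2 k0 Q0.
have dom (f : R -> C) t : 0 <= t <= 1 -> (forall x, normc (f x) <= P * (1 + `|x|)) ->
    exp_dominated (fun x => f x * gauss (path_pt b u t x)).
  move=> t01 hf; exists (P * M2) => [|x]; first exact: mulr_ge0.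
  have hx := onePx_le_exp x; have e2 : expR (- (2 * `|x|)) * expR `|x| = expR (- `|x|).
    by rewrite -expRD; congr expR; ring.
  have [g0 f0] := (normc_ge0 (gauss (path_pt b u t x)), normc_ge0 (f x)).
  have h1 : normc (gauss (path_pt b u t x)) <= M2 * expR (- (2 * `|x|)).
    apply: le_trans (hg _ _ (hsec x t t01)); rewrite ler_peMr //.
    by rewrite -expR0 ler_expR mulr_ge0 ?sqr_ge0 // ltW.
  have h2 : normc (f x) <= P * expR `|x|.
    by rewrite (le_trans (hf x)) // ler_wpM2l.
  rewrite normcM; apply: le_trans (ler_pM f0 g0 h2 h1) _.
  by rewrite -e2; lra.
pose H t x := path_slope b t * gauss (path_pt b u t x).
pose V t x := ((b - 1) * x%:C + u) * gauss (path_pt b u t x).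
have domH t : 0 <= t <= 1 -> exp_dominated (H t).
  by move=> t01; apply: dom => // x; exact: hslope.
have domV t : 0 <= t <= 1 -> exp_dominated (V t) by move=> t01; exact: dom.
pose L0 := Num.truncn e0^-1; exists (8 * M), L0; split; first exact: mulr_ge0.
move=> L L0L; have Lpos : (0 < L)%N by exact: leq_ltn_trans L0L.
have Lr : 0 < L%:R :> R by rewrite ltr0n.
have iL : 0 < L%:R^-1 :> R by rewrite invr_gt0.
have iLe0 : L%:R^-1 <= e0.
  rewrite -[e0]invrK lef_pV2 ?posrE ?invr_gt0 //; apply/ltW.
  by apply: lt_le_trans (truncnS_gt _) _; rewrite ler_nat.
have step t e : 0 <= t -> 0 <= e <= e0 -> t + e <= 1 ->
    normc (mesh L (H (t + e)) - mesh L (H t)) <= 4 * (M * (e ^+ 2 + e / L%:R)).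
  move=> t0 /andP[e_ge0 ee0] te1.
  have t01 : 0 <= t <= 1 by rewrite t0 (le_trans _ te1) // lerDl.
  have te01 : 0 <= t + e <= 1 by rewrite te1 addr_ge0.
  have s1 := mesh_hassum Lpos (domH _ te01).
  have s2 := mesh_hassum Lpos (domH _ t01).
  have s3 := hassum_diff0 (mesh_hassum Lpos (domV _ t01)).
  (* Subtracting e L times a telescoping sum of value 0 cancels the first-order part of the
     t-increment in each summand. What remains is of order e^2 from the step in t and e L / L^2 from
     the step in x. *)
  have := hassumB (hassumB s1 s2) (hassumZ (e%:C * L%:R) s3).
  rewrite mulr0 subr0 => s4; apply: hassum_le s4 _.
  have K0 : 0 <= M * (e ^+ 2 + e / L%:R).
    by rewrite mulr_ge0 // addr_ge0 ?sqr_ge0 // divr_ge0 // ltW.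
  pose F (j : int) := let x : R := j%:~R / L%:R in
    (H (t + e) x - H t x) - e%:C * L%:R * (V t (x + L%:R^-1) - V t x).
  rewrite (_ : (fun j => _) = (fun j => L%:R^-1 * F j)); last first.
    apply/funext => j; rewrite /F /= intrD mulrDl mul1r; ring.
  apply: abs_bounded_mesh => // j; rewrite /F /=; set x := j%:~R / L%:R.
  pose D := (b - 1) * gauss (path_pt b u t x) -
    2 * pi%:C * path_pt b u t x * ((b - 1) * x%:C + u) * path_slope b t * gauss (path_pt b u t x).
  have D' : D = (b - 1) * gauss (path_pt b u t x) -
    2 * pi%:C * path_pt b u t x * path_slope b t * ((b - 1) * x%:C + u) * gauss (path_pt b u t x).
    by rewrite /D; ring.
  have e01 : 0 <= e <= e0 by rewrite e_ge0.
  have iL01 : 0 <= (L%:R^-1 : R) <= e0. by rewrite ltW.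
  have R1 := h x _ _ _ _ e (hsec x t t01) (hslope x t t01) (hm x) hd e01.
  have R2 := h x _ _ _ _ L%:R^-1 (hsec x t t01) (hm x) (hslope x t t01) hd iL01.
  rewrite -/D -path_slopeD -path_ptD -/(H (t + e) x) -/(H t x) in R1.
  rewrite -D' -path_ptDx in R2.
  have vE : ((b - 1) * x%:C + u) + L%:R^-1%:C * (b - 1) = (b - 1) * (x + L%:R^-1)%:C + u.
    by rewrite rmorphD; ring.
  rewrite vE -/(V t _) -/(V t x) in R2.
  have eLL : e%:C * L%:R * L%:R^-1%:C = e%:C.
    rewrite -mulrA -(rmorph_nat (real_complex R)) -rmorphM mulfV ?rmorph1 ?mulr1 //.
    by rewrite gt_eqF.
  have -> : H (t + e) x - H t x - e%:C * L%:R * (V t (x + L%:R^-1) - V t x) =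
     (H (t + e) x - H t x - e%:C * D) -
     e%:C * L%:R * (V t (x + L%:R^-1) - V t x - L%:R^-1%:C * D).
    rewrite [RHS](_ : _ = H (t + e) x - H t x - e%:C * L%:R * (V t (x + L%:R^-1) - V t x)
      + (e%:C * L%:R * L%:R^-1%:C - e%:C) * D); last by ring.
    by rewrite eLL subrr mul0r addr0.
  rewrite (le_trans (normcD _ _)) // normcNE normcM.
  have -> : normc (e%:C * L%:R) = e * L%:R.
    by rewrite normcM normcR normc_nat ger0_norm.
  apply: le_trans (lerD R1 (ler_wpM2l _ R2)) _; first by rewrite mulr_ge0 // ltW.
  rewrite le_eqVlt; apply/orP; left; apply/eqP; field; rewrite gt_eqF //.
have H1 : H 1 = fun x => b * gauss (b * x%:C + u).
  by apply/funext => x; rewrite /H /path_slope /path_pt; congr (_ * gauss _); ring.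
have H0 : H 0 = fun x => gauss x%:C.
  by apply/funext => x; rewrite /H /path_slope /path_pt !mul0r !addr0 mul1r.
rewrite -H1 -H0.
pose n := L; have n0 := Lpos.
(* The path is covered by L steps of length 1 / L, each of cost 8 M / L^2, whence the total 8 M /
   L. *)
have steps (i : nat) : (i <= L)%N ->
    normc (mesh L (H (i%:R / L%:R)) - mesh L (H 0)) <=
    i%:R * (4 * (M * (L%:R^-1 ^+ 2 + L%:R^-1 / L%:R))).
  elim: i => [|i IH] iL'; first by rewrite !mul0r subrr normc0.
  have {}IH := IH (ltnW iL').
  have := @step (i%:R / L%:R) L%:R^-1 _ _ _.
  have -> : i%:R / L%:R + L%:R^-1 = i.+1%:R / L%:R :> R by rewrite -natr1; ring.
  move=> hs; rewrite -[mesh L _](subrK (mesh L (H (i%:R / L%:R)))) -addrA.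
  apply: le_trans (normcD _ _) _.
  rewrite -[in leRHS]natr1 mulrDl mul1r [leRHS]addrC lerD //.
  apply: hs; first by rewrite divr_ge0.
    by rewrite ltW.
  by rewrite ler_pdivrMr // mul1r ler_nat.
have := steps L (leqnn L); rewrite divff ?gt_eqF // => /le_trans; apply.
rewrite le_eqVlt; apply/orP; left; apply/eqP; field; rewrite gt_eqF //.
Qed.

End GaussianRiemannSums.

(** * Poisson summation and the one-variable theta inversion *)

Section ThetaInversion.
Variable R : realType.
Local Notation C := R[i].
Implicit Types (x t k P Q M e r : R) (p z b c d u : C).

Definition cis r : C := cos r +i* sin r.

Lemma cisE r : cis r = cexp ('i * r%:C).
Proof. by rewrite (_ : 'i * r%:C = 0 +i* r) ?cexpE ?expR0 ?mul1r //; simpc. Qed.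

Lemma cisD r s : cis (r + s) = cis r * cis s.
Proof. by rewrite !cisE -cexpD rmorphD mulrDr. Qed.

Lemma normc_cis r : normc (cis r) = 1.
Proof. by rewrite cisE normc_cexp Re_mul /= mul0r mulr0 subrr expR0. Qed.

Lemma cis_int (n : int) : cis (2 * pi * n%:~R) = 1.
Proof.
rewrite cisE -[RHS](cexp_2pii_int R n); congr cexp.
by rewrite rmorphM rmorph_int mulrA mulr_natl.
Qed.

Lemma cisMn r n : cis (r *+ n) = cis r ^+ n.
Proof. by rewrite !cisE rmorphMn mulrnAr cexpMn. Qed.

Lemma Re_inv z : complex.Re z^-1 = complex.Re z / normc z ^+ 2.
Proof. by rewrite normc_sq; case: z. Qed.

Lemma Re_inv_gt0 z : 0 < complex.Re z -> 0 < complex.Re z^-1.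
Proof.
move=> z0; rewrite Re_inv divr_gt0 // exprn_gt0 // normc_gt0.
by apply: contraTneq z0 => ->; rewrite ltxx.
Qed.

Lemma Re_sqrtc_gt0 z : 0 < complex.Re z -> 0 < complex.Re (sqrtc z).
Proof.
case: z => a b /= a0; rewrite sqrtr_gt0 divr_gt0 //.
by rewrite ltr_wpDl ?sqrtr_ge0.
Qed.

Lemma exp_dominated_gauss b u : 0 < complex.Re b -> 0 < complex.Re (b ^+ 2) ->
  exp_dominated (fun x => gauss (b * x%:C + u)).
Proof.
move=> b0 bb0; have [k [P [Q [k0 P1 Q0 [_ hsec _ _]]]]] := path_in_sector u b0 bb0.
have [M M0 hM] := gauss_sector_le P 1 k0 Q0; exists M => // x.
have s1 : 0 <= (1 : R) <= 1 by rewrite ler01 lexx.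
have pE : path_pt b u 1 x = b * x%:C + u by rewrite /path_pt; ring.
have := hM _ _ (hsec x 1 s1); rewrite pE mul1r; apply: le_trans.
rewrite ler_peMr ?normc_ge0 //.
by rewrite -expR0 ler_expR mulr_ge0 ?sqr_ge0 // ltW.
Qed.

Lemma exp_dominatedZ (f : R -> C) c : exp_dominated f -> exp_dominated (fun x => c * f x).
Proof.
case=> M M0 h; exists (normc c * M) => [|x]; first by rewrite mulr_ge0 ?normc_ge0.
by rewrite normcM -mulrA ler_wpM2l ?normc_ge0.
Qed.

Lemma exp_dominated_le (f g : R -> C) :
  (forall x, normc (f x) <= normc (g x)) -> exp_dominated g -> exp_dominated f.
Proof. by move=> fg [M M0 h]; exists M => // x; rewrite (le_trans (fg x)). Qed.

(** The Riemann sum of mesh 1 / L for the Fourier integral of [h] at the frequency k. *)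
Definition fourier_coef (h : R -> C) (L : nat) (k : int) : C :=
  mesh L (fun x => h x * cis (- (2 * pi * k%:~R * x))).

Lemma fourier_dominated h (k : int) : exp_dominated h ->
  exp_dominated (fun x => h x * cis (- (2 * pi * k%:~R * x))).
Proof. by apply: exp_dominated_le => x; rewrite normcM normc_cis mulr1. Qed.

Lemma cis_root_sum (K : nat) (j : int) : let L := (K + K).+1 in
  \sum_(r < L) cis (- (2 * pi * (Posz r - Posz K)%:~R * (j%:~R / L%:R))) =
  if (L %| j)%Z then L%:R else 0.
Proof.
move=> L; have L0 : L%:R != 0 :> R by rewrite pnatr_eq0.
pose a : R := - (2 * pi * (j%:~R / L%:R)).
have -> : \sum_(r < L) cis (- (2 * pi * (Posz r - Posz K)%:~R * (j%:~R / L%:R))) =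
   cis (- (a * K%:R)) * \sum_(r < L) cis a ^+ r.
  rewrite mulr_sumr; apply: eq_bigr => r _; rewrite -cisMn -cisD; congr cis.
  by rewrite /a rmorphB /= -mulr_natr; ring.
have aL : cis a ^+ L = 1.
  rewrite -cisMn -(cis_int (- j)); congr cis; rewrite /a -mulr_natr intrN; field.
  exact: L0.
case: ifP => [/dvdzP[q jq]|Lj].
  have a1 : cis a = 1.
    rewrite -(cis_int (- q)) /a jq intrM intrN; congr cis.
    by rewrite -pmulrn; field.
  have -> : cis (- (a * K%:R)) = 1.
    rewrite -(cis_int (q * K)) /a jq !intrM; congr cis.
    by rewrite -!pmulrn; field.
  by rewrite mul1r a1; under eq_bigr do rewrite expr1n; rewrite sumr_const card_ord.
(* Reduced modulo L the angle is - 2 y with 0 < y < pi, and cis a = 1 would force sin y = 0. *)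
have a1 : cis a != 1.
  pose m := (j %% L)%Z; pose q := (j %/ L)%Z.
  have jE : j = q * L + m := divz_eq j L.
  have m0 : 0 < m.
    by rewrite lt_neqAle modz_ge0 // andbT eq_sym; apply/negP => /eqP/dvdz_mod0P; rewrite Lj.
  have mL : m < L by rewrite ltz_pmod.
  have -> : cis a = cis (- (2 * pi * (m%:~R / L%:R))).
    rewrite -[RHS]mul1r -(cis_int (- q)) -cisD; congr cis; rewrite /a jE intrD intrM intrN.
    by rewrite -pmulrn; field.
  pose y : R := pi * (m%:~R / L%:R).
  have y0 : 0 < y < pi.
    have Lp : 0 < L%:R :> R by rewrite ltr0n.
    rewrite mulr_gt0 ?pi_gt0 ?divr_gt0 ?ltr0z //= gtr_pMr ?pi_gt0 // ltr_pdivrMr // mul1r.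
    by rewrite pmulrn ltr_int.
  have -> : - (2 * pi * (m%:~R / L%:R)) = - (y *+ 2) by rewrite /y -mulr_natr; ring.
  apply/eqP => /(congr1 (@complex.Re R)) /=; rewrite cosN cos_mulr2n => h.
  have : sin y ^+ 2 = 0 by rewrite sin2cos2; lra.
  by move/eqP; rewrite sqrf_eq0 gt_eqF // sin_gt0_pi.
have : (cis a - 1) * \sum_(r < L) cis a ^+ r = 0 by rewrite -subrX1 aL subrr.
by move/eqP; rewrite mulf_eq0 subr_eq0 (negPf a1) => /eqP ->; rewrite mulr0.
Qed.

(* By orthogonality of the [L]-th roots of unity, the [L] Fourier coefficients of
   the samples at the points [j / L] add up to the sum over the integers. *)
Lemma fourier_inversion h K s : exp_dominated h ->
  hassum (fun n : int => h n%:~R) s ->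
  ball_sum (fourier_coef h (K + K).+1) K = s.
Proof.
move=> hd hs; set L := (K + K).+1; have L0 : (0 < L)%N by [].
have Lr : L%:R != 0 :> R by rewrite pnatr_eq0.
have Lc : L%:R != 0 :> C by rewrite pnatr_eq0.
have h1 := @hassum_big R _ 'I_L (index_enum _) _ _
  (fun r : 'I_L => mesh_hassum L0 (fourier_dominated (Posz r - Posz K) hd)).
apply: hassum_unique h1 _.
pose f (j : int) : C := if (L %| j)%Z then h (j%:~R / L%:R) else 0.
apply: (@hassum_ext _ _ f) => [j|].
  rewrite -mulr_sumr -mulr_sumr cis_root_sum -/L /f; case: ifP => _; last by rewrite !mulr0.
  by rewrite mulrCA mulVf // mulr1.
apply/(@hassum_inj _ _ _ (fun n : int => n * Posz L)).
- by move=> m n /(mulIf (isT : Posz L != 0)).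
- move=> j hj; rewrite /f; case: ifP => // /dvdzP[q jq].
  by case: (hj q).
- apply: hassum_ext hs => n; rewrite /f /= dvdz_mull // intrM -pmulrn mulfK //.
Qed.

Lemma cis_second_difference a : 2 - cis a - cis (- a) = (4 * sin (a / 2) ^+ 2)%:C.
Proof.
rewrite /cis cosN sinN [in LHS](splitr a) -mulr2n cos_mulr2n sin_mulr2n cos2sin2.
by rewrite -(rmorph_nat (real_complex R)); simpc; congr (_ +i* _); ring.
Qed.

(* Summation by parts: the second difference of [h] at scale [1/L] is [O(1/L^2)],
   and it multiplies the [k]-th coefficient by [4 sin^2 (pi k / L) >= (k/L)^2]. *)
Lemma fourier_decay h (e0 M : R) : 0 < e0 -> 0 <= M -> exp_dominated h ->
  (forall x e, 0 <= e <= e0 ->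
     normc (2 * h x - h (x + e) - h (x - e)) <= e ^+ 2 * (M * expR (- `|x|))) ->
  exists K1 : nat, forall K (k : int), (K1 <= K)%N -> k != 0 -> (`|k| <= K)%N ->
    normc (fourier_coef h (K + K).+1 k) <= 4 * M / k%:~R ^+ 2.
Proof.
move=> e00 M0 hd hM; exists (Num.truncn e0^-1) => K k K1 k0 kK.
set L := (K + K).+1; have L0 : (0 < L)%N by [].
have Lr : 0 < L%:R :> R by rewrite ltr0n.
have iL0 : 0 < L%:R^-1 :> R by rewrite invr_gt0.
have iLe0 : 0 <= (L%:R^-1 : R) <= e0.
  rewrite ltW //= -[e0]invrK lef_pV2 ?posrE ?invr_gt0 //; apply/ltW.
  by apply: lt_le_trans (truncnS_gt _) _; rewrite ler_nat ltnS (leq_trans K1) // leq_addr.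
pose w (j : int) : C := cis (- (2 * pi * k%:~R * (j%:~R / L%:R))).
pose al : R := 2 * pi * k%:~R / L%:R.
pose H (j : int) : C := h (j%:~R / L%:R).
have s0 : hassum (fun j => L%:R^-1 * (H j * w j)) (fourier_coef h L k).
  exact: mesh_hassum (fourier_dominated k hd).
set s := fourier_coef h L k in s0 *.
have wS j : w (j + 1) * cis al = w j.
  by rewrite -cisD /w /al intrD; congr cis; ring.
have wP j : w (j - 1) * cis (- al) = w j.
  by rewrite -cisD /w /al intrB; congr cis; ring.
have s1 : hassum (fun j => L%:R^-1 * (H (j + 1) * w j)) (cis al * s).
  have := hassumZ (cis al) ((hassum_bij _ _ succ_bij).1 s0).
  by apply: hassum_ext => j /=; rewrite -(wS j); ring.
have s2 : hassum (fun j => L%:R^-1 * (H (j - 1) * w j)) (cis (- al) * s).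
  have pred_bij : bijective (fun j : int => j - 1).
    by exists (fun j => j + 1) => j; rewrite ?addrK ?subrK.
  have := hassumZ (cis (- al)) ((hassum_bij _ _ pred_bij).1 s0).
  by apply: hassum_ext => j /=; rewrite -(wP j); ring.
have := hassumB (hassumB (hassumZ 2 s0) s1) s2.
have -> : 2 * s - cis al * s - cis (- al) * s = (2 - cis al - cis (- al)) * s by ring.
rewrite cis_second_difference => s3.
pose G (j : int) := (2 * H j - H (j + 1) - H (j - 1)) * w j.
have bnd : abs_bounded (fun j => L%:R^-1 * G j) (4 * (L%:R^-1 ^+ 2 * M)).
  apply: abs_bounded_mesh => // [|j]; first by rewrite mulr_ge0 ?sqr_ge0.
  rewrite /G normcM normc_cis mulr1 -mulrA /H.
  have -> : (j + 1)%:~R / L%:R = j%:~R / L%:R + L%:R^-1 :> R.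
    by rewrite intrD mulrDl mul1r.
  have -> : (j - 1)%:~R / L%:R = j%:~R / L%:R - L%:R^-1 :> R.
    by rewrite intrB mulrBl mul1r.
  exact: hM.
have {}s3 : hassum (fun j => L%:R^-1 * G j) ((4 * sin (al / 2) ^+ 2)%:C * s).
  by apply: hassum_ext s3 => j; rewrite /G; ring.
have := hassum_le s3 bnd; rewrite normcM normcR ger0_norm; last first.
  by rewrite mulr_ge0 ?sqr_ge0.
have kr : 0 < `|k%:~R| :> R by rewrite normr_gt0 intr_eq0.
have ab : `|al / 2| = pi * (`|k%:~R| / L%:R).
  rewrite (_ : al / 2 = pi * (k%:~R / L%:R)); last by rewrite /al; field; rewrite gt_eqF.
  by rewrite !normrM (ger0_norm (pi_ge0 R)) (gtr0_norm iL0).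
have kL : 2 * `|k%:~R| <= L%:R :> R.
  have -> : `|k%:~R| = `|k|%N%:R :> R by rewrite natr_absz intr_norm.
  by rewrite -natrM ler_nat /L; lia.
(* Since 2 |k| <= L, the angle pi k / L has modulus at most 2, and its sine is at least a third of
   it; pi >= 2 gives the constant. *)
have sinb : (2 / 3 * (`|k%:~R| / L%:R)) <= `|sin (al / 2)|.
  have h2 : `|al / 2| <= 2.
    rewrite ab; have : `|k%:~R| / L%:R <= 2^-1 :> R by rewrite ler_pdivrMr //; lra.
    move=> hh; apply: le_trans (ler_pM (pi_ge0 R) _ (pi_le4 R) hh) _; last lra.
    by rewrite divr_ge0 // ltW.
  apply: le_trans (normr_sin_ge h2); rewrite ab.
  have : 2 * (`|k%:~R| / L%:R) <= pi * (`|k%:~R| / L%:R) :> R.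
    by apply: ler_wpM2r (pi_ge2 R); rewrite divr_ge0 // ltW.
  by lra.
have sq : (2 / 3 * (`|k%:~R| / L%:R)) ^+ 2 <= sin (al / 2) ^+ 2.
  rewrite -(real_normK (num_real (sin _))); apply: ler_sqr_ge0 => //.
move=> hs; rewrite ler_pdivlMr; last by rewrite -real_normK ?num_real // exprn_gt0.
have s_ge0 := normc_ge0 s.
have := ler_wpM2r s_ge0 sq; rewrite -(real_normK (num_real k%:~R)).
set X := `|k%:~R| in kr *.
have -> : (2 / 3 * (X / L%:R)) ^+ 2 = 4 / 9 * X ^+ 2 * L%:R^-1 ^+ 2.
  by rewrite !exprMn; field; rewrite gt_eqF.
move=> hs2; have i2 : 0 < L%:R^-1 ^+ 2 :> R by rewrite exprn_gt0.
rewrite -(ler_pM2r i2); have := mulr_ge0 M0 (ltW i2).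
lra.
Qed.

Lemma meshZ L c f : (0 < L)%N -> exp_dominated f ->
  mesh L (fun x => c * f x) = c * mesh L f.
Proof.
move=> L0 hf; apply: hassum_unique (mesh_hassum L0 (exp_dominatedZ c hf)) _.
by apply: hassum_ext (hassumZ c (mesh_hassum L0 hf)) => j; ring.
Qed.

Definition theta_term (tau w : C) (n : int) : C :=
  epii (tau * n%:~R ^+ 2 + 2 * n%:~R * w).

Lemma normc_epii z : normc (epii z) = expR (- (pi * complex.Im z)).
Proof.
by rewrite normc_cexp; congr expR; case: z => a b /=; ring.
Qed.

Lemma theta_term_le (tau w : C) (K : R) : 0 < complex.Im tau -> exists2 M, 0 <= M &
  forall n, normc (theta_term tau w n) <= M * expR (- (K * `|n%:~R|)).
Proof.
move=> t0; pose Q := 8 * `|complex.Im w|.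
exists (expR ((Q + K) ^+ 2 / (4 * complex.Im tau))) => [|n]; first exact: expR_ge0.
rewrite normc_epii -expRD ler_expR; apply: le_trans _ (quadratic_le Q K _ t0).
have -> : complex.Im (tau * n%:~R ^+ 2 + 2 * n%:~R * w) =
  complex.Im tau * n%:~R ^+ 2 + 2 * n%:~R * complex.Im w.
  rewrite Im_add -(rmorph_int (real_complex R)) -(rmorph_nat (real_complex R)) -rmorphXn.
  by rewrite mulrC Im_realM -rmorphM Im_realM; ring.
rewrite mulrDr opprD lerD //.
  have : 1 * (complex.Im tau * n%:~R ^+ 2) <= pi * (complex.Im tau * n%:~R ^+ 2).
    apply: ler_wpM2r; first by rewrite mulr_ge0 ?sqr_ge0 // ltW.
    by have := pi_ge2 R; lra.
  by lra.
apply: le_trans (ler_norm _) _; rewrite normrN !normrM normr_nat (ger0_norm (pi_ge0 R)) /Q.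
have : pi * (`|n%:~R| * `|complex.Im w|) <= 4 * (`|n%:~R| * `|complex.Im w|).
  by rewrite ler_wpM2r ?mulr_ge0 ?pi_le4.
lra.
Qed.

Lemma theta_term_abs_bounded (tau w : C) : 0 < complex.Im tau ->
  exists M, abs_bounded (theta_term tau w) M.
Proof.
move=> t0; have [M M0 h] := theta_term_le w 1 t0.
by exists (M * (2 + 2 / 1)); exact: abs_bounded_exp.
Qed.

Lemma gauss_shift_exponent (tau w b I p x k : C) : b ^+ 2 * tau = I ->
  - (p * (b * x + b * w) ^+ 2) + I * - (2 * p * k * x) =
  I * p * (tau * k ^+ 2 + 2 * k * w) + - (p * (b * x + b * (w + k * tau)) ^+ 2).
Proof. by move=> <-; ring. Qed.

(** Completing the square: the character moves the centre of the Gaussian from w to w + k tau at the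
    price of the k-th theta term. As the centres are complex, Riemann sums on different lines have
    to be compared. *)
Lemma gauss_shift (tau w b : C) k x : b ^+ 2 * tau = 'i ->
  gauss (b * x%:C + b * w) * cis (- (2 * pi * k * x)) =
  epii (tau * k%:C ^+ 2 + 2 * k%:C * w) * gauss (b * x%:C + b * (w + k%:C * tau)).
Proof.
move=> bt; rewrite cisE /gauss /epii -!cexpD; congr cexp.
have -> : (- (2 * pi * k * x))%:C = - (2 * pi%:C * k%:C * x%:C) :> C.
  by rewrite !(rmorphN, rmorphM) rmorph_nat.
exact: gauss_shift_exponent.
Qed.

(* The [k]-th Fourier coefficient of [x -> b * gauss (b * (x + w))] is the [k]-th
   theta term times a Gaussian Riemann sum whose limit does not depend on [k]. *)
Lemma theta_mesh_limit (tau w b s F : C) :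
  0 < complex.Re b -> 0 < complex.Re (b ^+ 2) -> 0 < complex.Im tau ->
  b ^+ 2 * tau = 'i ->
  hassum (theta_term tau w) s ->
  hassum (fun n : int => b * gauss (b * (n%:~R : R)%:C + b * w)) F ->
  forall e : R, 0 < e -> exists K0 : nat, forall K : nat, (K0 <= K)%N ->
  normc (F - mesh (K + K).+1 (fun x => gauss x%:C) * s) <= e.
Proof.
move=> b0 bb0 tau0 bt hs hF.
pose h x := b * gauss (b * x%:C + b * w).
have hd : exp_dominated h := exp_dominatedZ b (exp_dominated_gauss (b * w) b0 bb0).
have [M0 M00 hM0] : exp_dominated (fun x => gauss x%:C).
  have := @exp_dominated_gauss 1 0 _ _; rewrite expr1n /= => /(_ ltr01 ltr01).
  by apply: exp_dominated_le => x; rewrite mul1r addr0.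
pose g K := mesh (K + K).+1 (fun x => gauss x%:C).
have g_le K : normc (g K) <= 4 * M0 by exact: normc_mesh_le.
have fcE L (k : int) : (0 < L)%N -> fourier_coef h L k = theta_term tau w k *
    mesh L (fun x => b * gauss (b * x%:C + b * (w + k%:~R * tau))).
  move=> L0; rewrite -meshZ //; last first.
    exact: exp_dominatedZ (exp_dominated_gauss _ b0 bb0).
  congr (mesh L _); apply/funext => x; rewrite /h -mulrA.
  by rewrite (gauss_shift _ _ _ bt) rmorph_int /theta_term; ring.
have [k [P [Q [k0 P1 Q0 [_ hsec hslope _]]]]] := path_in_sector (b * w) b0 bb0.
have [e0 e00 [M1 M10 hM1]] := gauss_taylor_sector k0 P1 Q0.
have s1 : 0 <= (1 : R) <= 1 by rewrite ler01 lexx.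
have pE x : path_pt b (b * w) 1 x = b * x%:C + b * w by rewrite /path_pt; ring.
have bE : path_slope b 1 = b by rewrite /path_slope; ring.
(* In the second difference the Taylor expansions for the steps e and -e are added, so their linear
   terms cancel. *)
have [K1 hK1] : exists K1 : nat, forall K (k : int), (K1 <= K)%N -> k != 0 -> (`|k| <= K)%N ->
    normc (fourier_coef h (K + K).+1 k) <= 4 * (2 * normc b * M1) / k%:~R ^+ 2.
  apply: (fourier_decay e00) => // [|x e he]; first by rewrite !mulr_ge0 ?normc_ge0.
  have sp := hsec x 1 s1; have hb := hslope x 1 s1; rewrite pE bE in sp hb.
  have T1 := hM1 _ _ _ _ sp hb he.
  have hb' : normc (- b) <= P * (1 + `|x|) by rewrite normcNE.
  have T2 := hM1 _ _ _ _ sp hb' he.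
  set p := b * x%:C + b * w in T1 T2 *.
  have -> : 2 * h x - h (x + e) - h (x - e) =
    - (b * ((gauss (p + e%:C * b) - gauss p + 2 * pi%:C * p * (e%:C * b) * gauss p) +
       (gauss (p + e%:C * - b) - gauss p + 2 * pi%:C * p * (e%:C * - b) * gauss p))).
    rewrite /h (_ : b * (x + e)%:C + b * w = p + e%:C * b); last by rewrite /p rmorphD; ring.
    rewrite (_ : b * (x - e)%:C + b * w = p + e%:C * - b); last by rewrite /p rmorphB; ring.
    by rewrite -/p; ring.
  rewrite normcNE normcM.
  have E : expR (- (2 * `|x|)) <= expR (- `|x|) by rewrite ler_expR; have := normr_ge0 x; lra.
  have T3 := le_trans (normcD _ _) (lerD T1 T2).
  apply: le_trans (ler_wpM2l (normc_ge0 b) T3) _.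
  have w0 : 0 <= normc b * e ^+ 2 * M1 := mulr_ge0 (mulr_ge0 (normc_ge0 b) (sqr_ge0 e)) M10.
  by have := ler_wpM2l w0 E; lra.
have [M2 M20 hM2] := theta_term_le w 1 tau0.
(* From exponential to inverse-square decay by exp y >= 1 + y^2 / 2. *)
have theta_decay (n : int) : n != 0 -> normc (theta_term tau w n) <= 2 * M2 / n%:~R ^+ 2.
  move=> n0; apply: le_trans (hM2 n) _; rewrite mul1r.
  have n_gt0 : 0 < n%:~R ^+ 2 :> R by rewrite -real_normK ?num_real // exprn_gt0 ?normr_gt0 ?intr_eq0.
  rewrite ler_pdivlMr // mulrAC [leRHS]mulrC -mulrA ler_wpM2l //.
  have e1 := expR_gt0 (- `|n%:~R : R|); rewrite mulrC.
  have := @expR_ge1Dxn R `|n%:~R| 1 (normr_ge0 _).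
  rewrite real_normK ?num_real // => e2.
  rewrite expRN ler_pdivrMl ?expR_gt0 //.
  have : 2`!%:R = 2 :> R by [].
  by move=> f2; rewrite f2 in e2; lra.
(* The comparison is with the Riemann sum g K of the real Gaussian itself, whose limit is still
   unknown. *)
pose D K n := fourier_coef h (K + K).+1 n - g K * theta_term tau w n.
pose B := 4 * (2 * normc b * M1) + 4 * M0 * (2 * M2).
have tann := @tannery R D B K1 _ _ _.
have {}tann : forall e : R, 0 < e -> exists K0 : nat, forall K : nat, (K0 <= K)%N ->
    normc (ball_sum (D K) K) <= e.
  apply: tann.
  - by rewrite /B addr_ge0 // !mulr_ge0 ?normc_ge0.
  - have Dle K (n : int) : (K1 <= K)%N -> n != 0 -> (`|n| <= K)%N ->
        normc (D K n) <= B / n%:~R ^+ 2.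
      move=> KK n0 nK; rewrite (le_trans (normcD _ _)) // normcNE normcM mulrDl lerD ?hK1 //.
      by rewrite -(mulrA (4 * M0)) ler_pM ?normc_ge0 ?theta_decay.
    move=> K n KK /andP[n0 nK]; have nz : n%:Z != 0 by rewrite eqz_nat -lt0n.
    have e1 : n%:R ^+ 2 = n%:Z%:~R ^+ 2 :> R by [].
    have e2 : n%:R ^+ 2 = (- n%:Z)%:~R ^+ 2 :> R by rewrite intrN sqrrN.
    split; first by rewrite e1; exact: Dle.
    by rewrite e2; apply: Dle; rewrite ?oppr_eq0 ?abszN.
  - move=> n e e0'.
    have [M3 [L0 [M30 hL0]]] := gauss_mesh_path (b * (w + n%:~R * tau)) b0 bb0.
    pose T := normc (theta_term tau w n) * M3; have T0 : 0 <= T by rewrite mulr_ge0 ?normc_ge0.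
    exists (maxn L0 (Num.truncn (T / e)).+1) => K; rewrite geq_max => /andP[KL KT].
    rewrite /D fcE // [g K * _]mulrC -mulrBr normcM.
    have KL' : (L0 < (K + K).+1)%N by rewrite ltnS (leq_trans KL) // leq_addr.
    apply: le_trans (ler_wpM2l (normc_ge0 _) (hL0 _ KL')) _.
    rewrite mulrA -/T ler_pdivrMr ?ltr0n // mulrC -ler_pdivrMr //; apply/ltW.
    by apply: lt_le_trans (truncnS_gt _) _; rewrite ler_nat (leq_trans KT) // leqW // leq_addr.
move=> e e_gt0.
have [K2 hK2] := tann (e / 2) (divr2_gt0 e_gt0).
pose G : R := 4 * M0 + 1; have G0 : 0 < G by rewrite ltr_wpDl // mulr_ge0.
have [K3 hK3] := hassum_int hs (divr_gt0 (divr2_gt0 e_gt0) G0).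
exists (maxn K2 K3) => K; rewrite geq_max => /andP[/hK2 l2 /hK3 l3].
have bF : ball_sum (fourier_coef h (K + K).+1) K = F by exact: fourier_inversion.
have -> : F - mesh (K + K).+1 (fun x => gauss x%:C) * s =
    ball_sum (D K) K + g K * (ball_sum (theta_term tau w) K - s).
  rewrite mulrBr -bF /ball_sum mulr_sumr addrA -big_split /=; congr (_ - _).
  by apply: eq_bigr => i _; rewrite /D subrK.
rewrite (le_trans (normcD _ _)) // (splitr e) lerD // normcM.
apply: le_trans (ler_pM (normc_ge0 _) (normc_ge0 _) (g_le K) (ltW l3)) _.
rewrite mulrC mulrAC ler_pdivrMr // ler_wpM2l ?ltW ?divr2_gt0 //.
by rewrite /G; lra.
Qed.

End ThetaInversion.

(** * Poisson summation for Gaussians and Jacobi's identity *)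

Section ThetaInversionFormula.
Variable R : realType.
Local Notation C := R[i].
Implicit Types (tau w b s t : C).

Lemma epiiD (x y : C) : epii (x + y) = epii x * epii y.
Proof. by rewrite /epii mulrDr cexpD. Qed.

Lemma epii0 : epii (0 : C) = 1.
Proof. by rewrite /epii mulr0 cexp0. Qed.

Lemma epiiN (x : C) : epii (- x) = (epii x)^-1.
Proof. by rewrite /epii mulrN cexpN. Qed.

Lemma epii_neq0 (x : C) : epii x != 0.
Proof. exact: cexp_neq0. Qed.

Lemma epii_even (n : int) : epii ((2 * n)%:~R : C) = 1.
Proof.
rewrite /epii -[RHS](cexp_2pii_int R n); congr cexp.
have -> : (pi *+ 2)%:C = pi%:C * 2 :> C by rewrite rmorphMn mulr_natr.
by rewrite intrM !mulrA.
Qed.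

Lemma theta_hassum tau w : 0 < complex.Im tau ->
  hassum (theta_term tau w) (usum (theta_term tau w)).
Proof. by move=> /(theta_term_abs_bounded w)[M]; exact: usumP. Qed.

(* At [tau = i] and [w = 0] both sides of the Poisson formula are the same nonzero
   sum, so that the Gaussian integral must be 1. *)
Lemma mesh_gauss_limit (e : R) : 0 < e -> exists K0 : nat, forall K : nat, (K0 <= K)%N ->
  normc (1 - mesh (K + K).+1 (fun x : R => gauss x%:C)) <= e.
Proof.
move=> e0; have t0 : 0 < complex.Im ('i : C) by rewrite /= ltr01.
have [s hs] : exists s, hassum (theta_term ('i : C) 0) s.
  by exists (usum (theta_term ('i : C) 0)); exact: theta_hassum.
have termE n : theta_term ('i : C) 0 n = (expR (- (pi * n%:~R ^+ 2)))%:C.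
  rewrite /theta_term /epii mulr0 addr0.
  have -> : 'i%C * pi%:C * ('i * n%:~R ^+ 2) = ((- (pi * n%:~R ^+ 2)) +i* 0 : C).
    by rewrite -(rmorph_int (real_complex R)) -rmorphXn; simpc; congr (_ +i* _); ring.
  by rewrite cexpE cos0 sin0 mulr1 mulr0.
(* All terms are positive and the one at 0 is 1, so the finite sums containing it stay above 1/2. *)
have s0 : s != 0.
  apply/eqP => sE; have [A hA] := hs (1 / 2) (divr_gt0 ltr01 (ltr0Sn _ 1)).
  have := hA (0%Z |` A)%fset (fsubsetUr _ _).
  rewrite sE subr0; under eq_bigr do rewrite termE.
  rewrite -rmorph_sum normcR ger0_norm; last by apply: sumr_ge0 => *; exact: expR_ge0.
  rewrite (big_fsetD1 0%Z) ?fset1U1 //= expr0n mulr0 oppr0 expR0.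
  have : 0 <= \sum_(i <- ((0%Z |` A) `\ 0%Z)%fset) expR (- (pi * i%:~R ^+ 2) : R).
    by apply: sumr_ge0 => *; exact: expR_ge0.
  by move=> h1 h2; lra.
have hF : hassum (fun n : int => 1 * gauss (1 * (n%:~R : R)%:C + 1 * 0 : C)) s.
  apply: hassum_ext hs => n; rewrite termE !mul1r addr0 /gauss.
  have -> : - (pi%:C * (n%:~R : R)%:C ^+ 2) = ((- (pi * n%:~R ^+ 2)) +i* 0 : C).
    by simpc; congr (_ +i* _); ring.
  by rewrite cexpE cos0 sin0 mulr1 mulr0.
have ns0 : 0 < normc s by rewrite normc_gt0.
have := @theta_mesh_limit R 'i 0 1 s s _ _ t0 _ hs hF (e * normc s) _.
rewrite expr1n mul1r /= => /(_ ltr01 ltr01 erefl (mulr_gt0 e0 ns0)) [K0 h].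
exists K0 => K /h; rewrite -[X in X - _]mul1r -mulrBl normcM ler_pM2r //.
Qed.

Lemma poisson_gauss tau w b s F :
  0 < complex.Re b -> 0 < complex.Re (b ^+ 2) -> 0 < complex.Im tau ->
  b ^+ 2 * tau = 'i ->
  hassum (theta_term tau w) s ->
  hassum (fun n : int => b * gauss (b * (n%:~R : R)%:C + b * w)) F ->
  F = s.
Proof.
move=> b0 bb0 tau0 bt hs hF.
apply/eqP; rewrite -subr_eq0 -normc_eq0 eq_le normc_ge0 andbT.
apply/ler_addgt0Pr => e e0; rewrite add0r.
have S0 : 0 < normc s + 1 by rewrite ltr_wpDl // normc_ge0.
have [K1 h1] := theta_mesh_limit b0 bb0 tau0 bt hs hF (divr2_gt0 e0).
have [K2 h2] := mesh_gauss_limit (divr_gt0 (divr2_gt0 e0) S0).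
have {}h1 := h1 (maxn K1 K2) (leq_maxl _ _).
have {}h2 := h2 (maxn K1 K2) (leq_maxr _ _).
set g := mesh _ _ in h1 h2.
have -> : F - s = (F - g * s) - (1 - g) * s by ring.
rewrite (le_trans (normcD _ _)) // normcNE (splitr e) lerD // normcM.
apply: le_trans (ler_wpM2r (normc_ge0 _) h2) _.
rewrite mulrAC ler_pdivrMr // ler_wpM2l ?(ltW (divr2_gt0 e0)) //.
by rewrite lerDl.
Qed.

Lemma theta_inversion_exponent (I p tau w n : C) : tau != 0 ->
  I * p * - (w ^+ 2 / tau) + I * p * (- tau^-1 * (- n) ^+ 2 + 2 * - n * (w / tau)) =
  - (p * (I / tau * (n + w) ^+ 2)).
Proof. by move=> tn0; field. Qed.

(** Poisson summation for b = 1 / sqrt (- i tau). Both Re b > 0 and Re (b^2) > 0 follow from Re (- i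
    tau) = Im tau > 0; this selects the principal root. *)
Lemma theta_inversion tau w s t : 0 < complex.Im tau ->
  hassum (theta_term tau w) s ->
  hassum (theta_term (- tau^-1) (w / tau)) t ->
  t = sqrtc (- 'i * tau) * epii (w ^+ 2 / tau) * s.
Proof.
move=> tau0 hs ht; set c := sqrtc _.
have tn0 : tau != 0 by apply: contraTneq tau0 => ->; rewrite ltxx.
have re0 : 0 < complex.Re (- 'i * tau : C).
  by rewrite mulNr Re_opp Re_mul /= mul0r sub0r mul1r opprK.
have c0 : 0 < complex.Re c := Re_sqrtc_gt0 re0.
have cn0 : c != 0 by apply: contraTneq c0 => ->; rewrite ltxx.
have c2 : c ^+ 2 = - 'i * tau := sqr_sqrtc _.
have i0 : - 'i != 0 :> C by rewrite oppr_eq0 eq_complex /= oner_eq0 andbF.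
have iinv : (- 'i)^-1 = 'i :> C.
  apply: (mulfI i0); rewrite divff //; apply/eqP.
  by rewrite eq_complex /= !(mul0r, mulr0, oppr0, sub0r, addr0, mulN1r, opprK) !eqxx.
have b2 : c^-1 ^+ 2 = 'i / tau by rewrite exprVn c2 invfM iinv.
have bt : c^-1 ^+ 2 * tau = 'i by rewrite b2 mulfVK.
have hF : hassum (fun n : int => c^-1 * gauss (c^-1 * (n%:~R : R)%:C + c^-1 * w))
    (c^-1 * (epii (- (w ^+ 2 / tau)) * t)).
  (* The index is reflected so that the exponent becomes - (n + w)^2 / tau instead of - (n - w)^2 /
     tau. *)
  have neg_bij : bijective (fun n : int => - n) by exists (fun n : int => - n); exact: opprK.
  have := hassumZ c^-1 (hassumZ (epii (- (w ^+ 2 / tau))) ((hassum_bij _ _ neg_bij).1 ht)).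
  apply: hassum_ext => n /=; congr (_ * _); rewrite /theta_term -epiiD /gauss.
  rewrite -mulrDr exprMn b2 rmorph_int intrN /epii mulrDr; congr cexp.
  exact: theta_inversion_exponent.
have <- := poisson_gauss _ _ tau0 bt hs hF.
- rewrite epiiN; field; rewrite cn0 epii_neq0 //.
- exact: Re_inv_gt0.
- by rewrite exprVn c2 Re_inv_gt0.
Qed.

End ThetaInversionFormula.

(** * Generators of the theta group *)

Section ThetaGroup.
Variable g : nat.
Local Notation G := 'M[int]_(g + g).
Implicit Types (M N : G).

Lemma subr_swap (V : zmodType) (a b c d : V) : a - b = c - d <-> c - a = d - b.
Proof.
split=> e.
  by have -> : a = c - d + b; [rewrite -e subrK|rewrite opprD opprB addrA [c + _]addrC subrK].
by have -> : c = d - b + a; [rewrite -e subrK|rewrite addrAC [d - b]addrC addrK addrC].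
Qed.

(* The theta group is the stabilizer of the quadratic form [half_form] modulo
   matrices that are symmetric with even diagonal. *)
Definition half_form : G := block_mx 0 1%:M 0 0.

Lemma symplectic_formE : symplectic_form g = half_form - half_form^T.
Proof.
rewrite /symplectic_form /half_form tr_block_mx !trmx0 trmx1.
rewrite opp_block_mx add_block_mx !oppr0 ?subr0 ?addr0 ?add0r //.
Qed.

Definition even_sym n (S : 'M[int]_n) := S^T = S /\ forall i, (2 %| S i i)%Z.

Lemma even_sym_conj n m (S : 'M[int]_n) (N : 'M[int]_(n, m)) :
  even_sym S -> even_sym (N^T *m S *m N).
Proof.
case=> Ssym Sdiag; split; first by rewrite !trmx_mul trmxK Ssym mulmxA.
(* [S] is [T + T^T] plus twice [D], where [T] is strictly upper triangular. *)
move=> i; pose T : 'M[int]_n := \matrix_(a, b) if (a < b)%N then S a b else 0.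
pose D : 'M[int]_n := \matrix_(a, b) if a == b then (S a a %/ 2)%Z else 0.
have -> : S = T + T^T + (D + D).
  apply/matrixP => a b; rewrite !mxE -val_eqE eq_sym /=.
  case: ltngtP => [ab|ab|/val_inj ->]; rewrite ?addr0 ?add0r //.
    by rewrite -[in LHS]Ssym mxE.
  by have := Sdiag b; rewrite dvdz_eq => /eqP {1}<-; ring.
rewrite mulmxDr mulmxDl mulmxDr mulmxDl mulmxDr mulmxDl.
have -> : N^T *m T^T *m N = (N^T *m T *m N)^T by rewrite !trmx_mul trmxK mulmxA.
rewrite !mxE; apply: rpredD; apply/dvdzP.
  by exists ((N^T *m T *m N) i i); rewrite mxE; ring.
by exists ((N^T *m D *m N) i i); rewrite mxE; ring.
Qed.

Lemma even_symD n (S T : 'M[int]_n) : even_sym S -> even_sym T -> even_sym (S + T).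
Proof.
move=> [s1 s2] [t1 t2]; split; first by rewrite linearD /= s1 t1.
by move=> i; rewrite mxE; apply: rpredD.
Qed.

(** As the symplectic form is [half_form] minus its transpose, its invariance is the symmetry of the
    difference on the right. The diagonal blocks of that difference are A^T C and B^T D. *)
Lemma theta_groupP M :
  theta_group M <-> even_sym (M^T *m half_form *m M - half_form).
Proof.
have diag : forall i : 'I_g,
   (M^T *m half_form *m M - half_form) (lshift g i) (lshift g i) =
   ((ulsubmx M)^T *m dlsubmx M) i i /\
   (M^T *m half_form *m M - half_form) (rshift g i) (rshift g i) =
   ((ursubmx M)^T *m drsubmx M) i i.
  move=> i; rewrite -{1 2 5 6}[M]submxK tr_block_mx /half_form !mulmx_block.
  rewrite !(mulmx0, mul0mx, mulmx1, mul1mx, addr0, add0r) opp_block_mx add_block_mx.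
  by rewrite block_mxEul block_mxEdr !oppr0 !addr0.
have symE : (M^T *m half_form *m M - half_form)^T = M^T *m half_form *m M - half_form
   <-> M^T *m symplectic_form g *m M = symplectic_form g.
  rewrite symplectic_formE mulmxBr mulmxBl linearB /= !trmx_mul trmxK mulmxA.
  exact: subr_swap.
split=> [[s1 d1 d2]|[s1 d]].
  split; first exact/symE.
  by move=> i; case: (split_ordP i) => j ->; [rewrite (diag j).1|rewrite (diag j).2].
split; first exact/symE.
  by move=> i; rewrite -(diag i).1.
by move=> i; rewrite -(diag i).2.
Qed.

(** For H = [half_form], the defect M^T H M - H is a cocycle: that of a product is the defect of M
    conjugated by N plus the defect of N. *)
Lemma theta_groupM M N : theta_group M -> theta_group N -> theta_group (M *m N).
Proof.
move=> /theta_groupP hM /theta_groupP hN; apply/theta_groupP.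
have := even_symD (even_sym_conj N hM) hN.
rewrite mulmxBr mulmxBl trmx_mul !mulmxA addrA subrK //.
Qed.

Definition inversion_at (i : 'I_g) : G :=
  let E : 'M[int]_g := delta_mx i i in block_mx (1%:M - E) (- E) E (1%:M - E).

(** Closed under products only: inverses of the generators turn out to be products of generators. *)
Inductive theta_gen : G -> Prop :=
| gen_translation S : even_sym S -> theta_gen (block_mx 1%:M S 0 1%:M)
| gen_levi (A D : 'M[int]_g) : A^T *m D = 1%:M -> theta_gen (block_mx A 0 0 D)
| gen_inversion i : theta_gen (inversion_at i)
| gen_mul M N : theta_gen M -> theta_gen N -> theta_gen (M *m N).

Lemma theta_gen_group M : theta_gen M -> theta_group M.
Proof.
elim=> {M} [S [Ss Sd]|A D AD|i|M N _ hM _ hN].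
- apply/theta_groupP; rewrite tr_block_mx /half_form !mulmx_block.
  rewrite !(trmx0, trmx1, mulmx0, mul0mx, mulmx1, mul1mx, addr0, add0r) opp_block_mx add_block_mx.
  rewrite !oppr0 !addr0 subrr Ss; split.
    by rewrite tr_block_mx !trmx0 Ss.
  by move=> i; case: (split_ordP i) => j ->; rewrite ?block_mxEul ?block_mxEdr ?mxE.
- apply/theta_groupP; rewrite tr_block_mx /half_form !mulmx_block.
  rewrite !(trmx0, trmx1, mulmx0, mul0mx, mulmx1, mul1mx, addr0, add0r) opp_block_mx add_block_mx.
  rewrite !oppr0 !addr0 AD subrr; split.
    by rewrite tr_block_mx !trmx0.
  by move=> i; case: (split_ordP i) => j ->; rewrite ?block_mxEul ?block_mxEdr ?mxE.
- apply/theta_groupP; rewrite /inversion_at tr_block_mx /half_form !mulmx_block.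
  rewrite !linearB /= trmx1 !linearN /= !trmx_delta.
  have EE : delta_mx i i *m delta_mx i i = delta_mx i i :> 'M[int]_g by rewrite mul_delta_mx.
  rewrite !(mulmx0, mul0mx, mulmx1, mul1mx, addr0, add0r).
  rewrite !(mulmxBr, mulmxBl, mulNmx, mulmxN, mulmx1, mul1mx) EE.
  rewrite !(subrr, subr0, oppr0, addr0) opp_block_mx add_block_mx.
  rewrite !subrr sub0r subr0 add0r addrAC subrr sub0r; split.
    by rewrite tr_block_mx !trmx0 linearN /= trmx_delta.
  by move=> a; case: (split_ordP a) => j ->; rewrite ?block_mxEul ?block_mxEdr ?mxE.
- exact: theta_groupM.
Qed.

End ThetaGroup.

(** * Row operations by generators and the reduced columns *)

Section Reduction.
Variable g : nat.
Local Notation G := 'M[int]_(g + g).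
Implicit Types (M N gam : G) (i j k : 'I_g) (t : int).

Lemma addmxE (V : nmodType) m n (A B : 'M[V]_(m, n)) a b :
  (A + B) a b = A a b + B a b.
Proof. by rewrite mxE. Qed.

Lemma oppmxE (V : zmodType) m n (A : 'M[V]_(m, n)) a b : (- A) a b = - A a b.
Proof. by rewrite mxE. Qed.

Lemma scalemxE (K : pzRingType) m n (x : K) (A : 'M[K]_(m, n)) a b :
  (x *: A) a b = x * A a b.
Proof. by rewrite mxE. Qed.

Lemma trmulmxE (K : pzRingType) m n p (A : 'M[K]_(n, m)) (B : 'M[K]_(n, p)) a c :
  (A^T *m B) a c = \sum_l A l a * B l c.
Proof. by rewrite mxE; apply: eq_bigr => l _; rewrite mxE. Qed.

(** Only columns of the left half are tested. Once all g of them are those of the identity, the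
    group condition leaves just a translation. *)
Definition fixes (n : nat) gam := forall j, (j < n)%N ->
  col (lshift g j) gam = delta_mx (lshift g j) 0.

Definition gen_fixing n M := theta_gen M /\ fixes n M.

Lemma fixesM n M gam : fixes n M -> fixes n gam -> fixes n (M *m gam).
Proof.
by move=> hM hg j jn; rewrite !colE -mulmxA -colE hg // -colE hM.
Qed.

Lemma gen_fixingM n M N : gen_fixing n M -> gen_fixing n N -> gen_fixing n (M *m N).
Proof. by case=> m1 m2 [n1 n2]; split; [exact: gen_mul|exact: fixesM]. Qed.

Lemma delta_mulE (m n p : nat) (i : 'I_m) (j : 'I_n) (U : 'M[int]_(n, p)) a c :
  (delta_mx i j *m U) a c = if a == i then U j c else 0.
Proof.
rewrite mxE (bigD1 j) //= mxE eqxx andbT big1 ?addr0 => [|b bj].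
  by case: eqP; rewrite ?mul1r ?mul0r.
by rewrite mxE (negPf bj) andbF mul0r.
Qed.

Lemma delta_lshift j : delta_mx (lshift g j) 0 = col_mx (delta_mx j 0) 0 :> 'cV[int]_(g + g).
Proof.
apply/matrixP => a b; rewrite ord1; case: (split_ordP a) => c ->.
  by rewrite col_mxEu !mxE eq_lshift.
by rewrite col_mxEd !mxE eq_rlshift.
Qed.

Lemma usub_block (a b c d : 'M[int]_g) gam :
  usubmx (block_mx a b c d *m gam) = a *m usubmx gam + b *m dsubmx gam.
Proof. by rewrite -{1}[gam]vsubmxK mul_block_col col_mxKu. Qed.

Lemma dsub_block (a b c d : 'M[int]_g) gam :
  dsubmx (block_mx a b c d *m gam) = c *m usubmx gam + d *m dsubmx gam.
Proof. by rewrite -{1}[gam]vsubmxK mul_block_col col_mxKd. Qed.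

Definition levi_add i j t : G :=
  block_mx (1%:M + t *: delta_mx i j) 0 0 (1%:M - t *: delta_mx j i).

Lemma levi_add_fixing n i j t : i != j -> (n <= j)%N -> gen_fixing n (levi_add i j t).
Proof.
move=> ij nj; split.
  have trE : (1%:M + t *: delta_mx i j)^T = 1%:M + t *: delta_mx j i :> 'M[int]_g.
    by rewrite linearD linearZ /= trmx1 trmx_delta.
  apply: gen_levi; rewrite trE.
  rewrite mulmxDl mul1mx mulmxBr mulmx1 -scalemxAl -scalemxAr mul_delta_mx_cond.
  by rewrite (negPf ij) mulr0n !scaler0 subr0 subrK.
move=> l ln; rewrite colE delta_lshift mul_block_col !mul0mx !mulmx0 !addr0.
rewrite mulmxDl mul1mx -scalemxAl mul_delta_mx_cond (_ : j == l = false) ?mulr0n ?scaler0 ?addr0 //.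
by apply/negP => /eqP jl; move: ln; rewrite -jl ltnNge nj.
Qed.

Lemma usub_levi_add i j t gam a c : usubmx (levi_add i j t *m gam) a c =
  usubmx gam a c + if a == i then t * usubmx gam j c else 0.
Proof.
rewrite usub_block mul0mx addr0 mulmxDl mul1mx -scalemxAl addmxE scalemxE delta_mulE.
by case: eqP; rewrite ?mulr0.
Qed.

Lemma dsub_levi_add i j t gam a c : dsubmx (levi_add i j t *m gam) a c =
  dsubmx gam a c - if a == j then t * dsubmx gam i c else 0.
Proof.
rewrite dsub_block mul0mx add0r mulmxBl mul1mx -scalemxAl.
rewrite addmxE oppmxE scalemxE delta_mulE.
by case: eqP; rewrite ?mulr0.
Qed.

Definition trans (S : 'M[int]_g) : G := block_mx 1%:M S 0 1%:M.

Lemma trans_fixing n S : even_sym S -> gen_fixing n (trans S).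
Proof.
move=> hS; split; first exact: gen_translation.
by move=> l ln; rewrite colE delta_lshift mul_block_col !mul0mx !mulmx0 !addr0 mul1mx.
Qed.

(** Adds multiples of lower rows to upper rows, crosswise; for i = j the multiple is 2 t, the parity
    allowed by even translations. *)
Definition trans2 i j t : G := trans (t *: (delta_mx i j + delta_mx j i)).

Lemma trans2_fixing n i j t : gen_fixing n (trans2 i j t).
Proof.
apply: trans_fixing; split.
  by rewrite linearZ linearD /= !trmx_delta addrC.
move=> a; rewrite !mxE.
have -> : (a == j) && (a == i) = (a == i) && (a == j) by rewrite andbC.
by apply/dvdzP; exists (t * ((a == i) && (a == j))%:R); ring.
Qed.

Lemma usub_trans2 i j t gam a c : usubmx (trans2 i j t *m gam) a c =
  usubmx gam a c + t * ((if a == i then dsubmx gam j c else 0)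
                      + (if a == j then dsubmx gam i c else 0)).
Proof.
rewrite usub_block mul1mx -scalemxAl mulmxDl addmxE scalemxE addmxE.
by rewrite !delta_mulE.
Qed.

Lemma dsub_trans2 i j t gam : dsubmx (trans2 i j t *m gam) = dsubmx gam.
Proof. by rewrite dsub_block mul0mx add0r mul1mx. Qed.

Lemma inversion_fixing n i : (n <= i)%N -> gen_fixing n (inversion_at i).
Proof.
move=> ni; split; first exact: gen_inversion.
move=> l ln; rewrite colE delta_lshift mul_block_col !mulmx0 !addr0.
have il : (i == l) = false.
  by apply/negP => /eqP il; move: ln; rewrite -il ltnNge ni.
by rewrite mulmxBl mul1mx mul_delta_mx_cond il mulr0n subr0.
Qed.

Lemma usub_inversion i gam a c : usubmx (inversion_at i *m gam) a c =
  if a == i then - dsubmx gam i c else usubmx gam a c.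
Proof.
rewrite usub_block mulmxBl mul1mx mulNmx !(addmxE, oppmxE) !delta_mulE.
by case: eqP => [->|]; rewrite ?subr0 ?subrr ?add0r.
Qed.

Lemma dsub_inversion i gam a c : dsubmx (inversion_at i *m gam) a c =
  if a == i then usubmx gam i c else dsubmx gam a c.
Proof.
rewrite dsub_block mulmxBl mul1mx !(addmxE, oppmxE) !delta_mulE.
by case: eqP => [->|]; rewrite ?subr0 ?subrr ?addr0 ?add0r.
Qed.

Lemma symplectic_cols gam : theta_group gam ->
  (usubmx gam)^T *m dsubmx gam - (dsubmx gam)^T *m usubmx gam = symplectic_form g.
Proof.
case=> <- _ _; rewrite symplectic_formE mulmxBr mulmxBl.
rewrite -{5 6 7 8}[gam]vsubmxK tr_col_mx /half_form tr_block_mx !mul_row_block !mul_row_col.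
by rewrite !trmx0 trmx1 !mulmx0 !mulmx1 !(addr0, add0r, mul0mx).
Qed.

Lemma even_cols gam c : theta_group gam ->
  (2 %| ((usubmx gam)^T *m dsubmx gam) (lshift g c) (lshift g c))%Z.
Proof.
move=> /theta_groupP[_ /(_ (lshift g c))]; rewrite -{1 2}[gam]vsubmxK tr_col_mx /half_form.
rewrite mul_row_block mul_row_col !(mulmx0, mulmx1, addr0, add0r, mul0mx).
rewrite addmxE oppmxE block_mxEul (_ : (0 : 'M[int]_g) c c = 0) ?subr0 //.
by rewrite mxE.
Qed.

(** Column j is a unit vector, and its pairing with column c is the lower entry of column c in row
    j. *)
Lemma fixes_dsub n gam j c : theta_group gam -> fixes n gam -> (j < n)%N ->
  dsubmx gam j c = symplectic_form g (lshift g j) c.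
Proof.
move=> /symplectic_cols hg hf jn.
have hj a : gam a (lshift g j) = (a == lshift g j)%:R.
  by have /matrixP/(_ a 0) := hf j jn; rewrite !mxE andbT.
rewrite -hg addmxE oppmxE !trmulmxE.
have hu a : usubmx gam a (lshift g j) = (a == j)%:R by rewrite mxE hj eq_lshift.
have hd a : dsubmx gam a (lshift g j) = 0 by rewrite mxE hj eq_rlshift.
rewrite (bigD1 j) //= hu eqxx mul1r !big1 ?subr0 ?addr0 // => [a _|a aj].
  by rewrite hd mul0r.
by rewrite hu (negPf aj) mul0r.
Qed.

(** Columns k and g + k have pairing 1. The upper entries of column k above row k do not contribute,
    since there the lower entries of column g + k vanish by [fixes_dsub]. *)
Lemma column_coprime gam k (d : int) : theta_group gam -> fixes k gam ->
  (forall i, (k <= i)%N -> (d %| usubmx gam i (lshift g k))%Z) ->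
  (forall i, (d %| dsubmx gam i (lshift g k))%Z) -> (d %| 1)%Z.
Proof.
move=> hg hf hU hD.
have <- : symplectic_form g (lshift g k) (rshift g k) = 1%Z.
  by rewrite /symplectic_form block_mxEur mxE eqxx.
rewrite -(symplectic_cols hg).
rewrite addmxE oppmxE !trmulmxE.
apply: rpredB; apply: rpred_sum => i _.
  have [ki|ik] := leqP k i; first by rewrite dvdz_mulr // hU.
  have e : symplectic_form g (lshift g i) (rshift g k) = 0.
    rewrite /symplectic_form block_mxEur mxE (_ : i == k = false) //.
    by apply/negP => /eqP e; rewrite e ltnn in ik.
  by rewrite (fixes_dsub _ hg hf ik) e mulr0 dvdz0.
by rewrite dvdz_mulr // hD.
Qed.

End Reduction.

(** * Euclidean descent on the columns *)

Section Descent.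
Variable g : nat.
Local Notation G := 'M[int]_(g + g).
Implicit Types (M N gam : G) (i j k : 'I_g) (t : int).

Lemma centered_remainder (x d : int) : d != 0 -> exists t, (2 * `|(x + t * d)%R| <= `|d|)%N.
Proof.
move=> d0; have := divz_eq x d; have r0 := modz_ge0 x d0; have rd := ltz_mod x d0.
move: (x %/ d)%Z (x %% d)%Z r0 rd => q r r0 rd ->.
have [h|h] := leP (2 * r) `|d|; first by exists (- q); nia.
by have [d1|d1] := ltP 0 d; [exists (- q - 1)|exists (- q + 1)]; nia.
Qed.

Lemma sum_absz_lt (f f' : 'I_g -> int) i : (forall a, a != i -> f' a = f a) ->
  (`|f' i| < `|f i|)%N -> (\sum_a `|f' a| < \sum_a `|f a|)%N.
Proof.
move=> h hi; rewrite (bigD1 i) //= [X in (_ < X)%N](bigD1 i) //=.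
by rewrite -addSn leq_add // leq_sum // => a ai; rewrite h.
Qed.

Lemma gen_fixing1 n : gen_fixing n (1%:M : G).
Proof.
rewrite (_ : 1%:M = trans (0 : 'M[int]_g)); last by rewrite /trans -scalar_mx_block.
by apply: trans_fixing; split=> [|i]; rewrite ?trmx0 // mxE.
Qed.

Lemma absz_modz_lt (x d : int) : d != 0 -> (`|(x %% d)%Z| < `|d|)%N.
Proof. by move=> d0; have := modz_ge0 x d0; have := ltz_mod x d0; lia. Qed.

(** The potential is the sum of the absolute values of the lower entries. These are reduced against
    each other; a single survivor d, in row i, is then reduced against the upper entries, which can
    be changed by multiples of d off row i and of 2 d in row i. *)
Lemma reduce_lower k (n : nat) gam : theta_group gam -> fixes k gam ->
  (\sum_i `|dsubmx gam i (lshift g k)| < n)%N ->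
  exists2 M, gen_fixing k M & forall i, dsubmx (M *m gam) i (lshift g k) = 0.
Proof.
elim: n gam => // n IH gam hg hf hn.
set c := lshift g k in hn *.
have step M0 : gen_fixing k M0 ->
    (\sum_i `|dsubmx (M0 *m gam) i c| < \sum_i `|dsubmx gam i c|)%N ->
    exists2 M, gen_fixing k M & forall i, dsubmx (M *m gam) i c = 0.
  move=> h0 lt; have [|M hM h] := IH (M0 *m gam) (theta_groupM (theta_gen_group h0.1) hg) (fixesM h0.2 hf).
    exact: leq_trans lt _.
  by exists (M *m M0) => [|i]; [exact: gen_fixingM|rewrite -mulmxA h].
have y_ge i : dsubmx gam i c != 0 -> (k <= i)%N.
  apply: contraNT; rewrite -ltnNge => ik; rewrite (fixes_dsub _ hg hf ik).
  by rewrite /symplectic_form block_mxEul mxE.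
have two i j : i != j -> dsubmx gam i c != 0 -> dsubmx gam j c != 0 ->
    (`|dsubmx gam j c| <= `|dsubmx gam i c|)%N ->
    exists2 M, gen_fixing k M & forall i, dsubmx (M *m gam) i c = 0.
  move=> ij yi yj yij; pose t := (dsubmx gam i c %/ dsubmx gam j c)%Z.
  apply: (step (levi_add j i t)); first by apply: levi_add_fixing (y_ge i yi); rewrite eq_sym.
  apply: (@sum_absz_lt _ _ i) => [a ai|]; rewrite dsub_levi_add; first by rewrite (negPf ai) subr0.
  rewrite eqxx; apply: leq_trans yij.
  by have := absz_modz_lt (dsubmx gam i c) yj; rewrite /modz.
case: (pickP (fun i => dsubmx gam i c != 0)) => [i yi|y0]; last first.
  by exists 1%:M => [|i]; [exact: gen_fixing1|rewrite mul1mx; apply/eqP; rewrite -[_ == _]negbK y0].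
set d := dsubmx gam i c in yi.
have [/existsP[j /andP[ij yj]]|no] := boolP [exists j, (i != j) && (dsubmx gam j c != 0)].
  have [h|/ltnW h] := leqP `|dsubmx gam j c| `|dsubmx gam i c|; first exact: two ij yi yj h.
  by apply: two yj yi h; rewrite eq_sym.
have y0 a : a != i -> dsubmx gam a c = 0.
  move=> ai; apply/eqP; apply: contraNT no => ya; apply/existsP; exists a.
  by rewrite eq_sym ai.
have ki := y_ge i yi.
have sumE : (\sum_a `|dsubmx gam a c| = `|d|)%N.
  by rewrite (bigD1 i) //= big1 ?addn0 // => a ai; rewrite y0.
(* If d does not divide the upper entry in row j, its centred remainder r, with 0 < 2 |r| <= |d|, is
   exchanged into the lower half and d is reduced modulo r. The new potential is |r| + |d mod r| < 2
   |r| <= |d|. *)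
have [/existsP[j /and3P[kj ji xj]]|allx] :=
  boolP [exists j : 'I_g, [&& (k <= j)%N, j != i & ~~ (d %| usubmx gam j c)%Z]].
  have [t ht] := centered_remainder (usubmx gam j c) yi.
  set r := usubmx gam j c + t * d in ht.
  have r0 : r != 0.
    apply: contraNneq xj => r0; apply/dvdzP; exists (- t).
    by rewrite mulNr; apply/eqP; rewrite -addr_eq0 -/r r0.
  pose M1 := trans2 j i t; pose M2 := @inversion_at g j; pose M3 := levi_add j i (d %/ r)%Z.
  have f1 : gen_fixing k M1 := trans2_fixing _ _ _ _.
  have f2 : gen_fixing k M2 := inversion_fixing kj.
  have f3 : gen_fixing k M3 := levi_add_fixing _ ji ki.
  apply: (step (M3 *m (M2 *m M1))); first by do 2?apply: gen_fixingM.
  have y2 a : dsubmx (M2 *m M1 *m gam) a c = if a == j then r else dsubmx gam a c.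
    rewrite -mulmxA dsub_inversion dsub_trans2 usub_trans2 eqxx (negPf ji) addr0 -/d -/r //.
  have y3 a : dsubmx (M3 *m (M2 *m M1) *m gam) a c =
      if a == i then (d %% r)%Z else if a == j then r else 0.
    rewrite -mulmxA dsub_levi_add !y2 eqxx.
    case: (eqVneq a i) => [->|ai]; first by rewrite eq_sym (negPf ji).
    by rewrite subr0; case: eqP => // _; rewrite y0.
  rewrite sumE (bigD1 i) //= (bigD1 j) //= big1 => [|a /andP[ai aj]]; last first.
    by rewrite y3 (negPf ai) (negPf aj).
  rewrite !y3 !eqxx (negPf ji) addn0; apply: leq_trans ht.
  by rewrite mul2n -addnn -addSn leq_add2r absz_modz_lt.
have dx j : (k <= j)%N -> j != i -> (d %| usubmx gam j c)%Z.
  move=> kj ji; apply: contraNT allx => h; apply/existsP; exists j.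
  by rewrite kj ji h.
(* In row i the centred remainder modulo 2 d is at most |d|; if it is strictly smaller, an inversion
   exchanges it with d. *)
have d2 : d + d != 0 by move: yi; lia.
have [t ht] := centered_remainder (usubmx gam i c) d2.
have {}ht : (`|(usubmx gam i c + t * (d + d))%R| <= `|d|)%N.
  by move: ht; move: (usubmx gam i c + t * (d + d)) => z; lia.
pose M1 := trans2 i i t; have f1 : gen_fixing k M1 := trans2_fixing _ _ _ _.
have x1 : usubmx (M1 *m gam) i c = usubmx gam i c + t * (d + d).
  by rewrite usub_trans2 eqxx.
have xd : (`|d| <= `|(usubmx gam i c + t * (d + d))%R|)%N ->
    `|(usubmx gam i c + t * (d + d))%R|%N = `|d|%N.
  by move=> ge; apply/eqP; rewrite eqn_leq ht ge.
have [lt|/xd {xd}xd] := ltnP `|(usubmx gam i c + t * (d + d))%R| `|d|.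
  apply: (step (inversion_at i *m M1)).
    by apply: gen_fixingM => //; exact: inversion_fixing.
  apply: (@sum_absz_lt _ _ i) => [a ai|]; rewrite -mulmxA dsub_inversion.
    by rewrite (negPf ai) dsub_trans2.
  by rewrite eqxx x1.
have d_x : (d %| usubmx gam i c)%Z.
  have : (d %| usubmx gam i c + t * (d + d))%Z by rewrite dvdzE xd.
  by rewrite rpredDr // dvdz_mull // rpredD.
have d1 : (d %| 1)%Z.
  apply: (column_coprime hg hf) => j.
    by move=> kj; have [->|ji] := eqVneq j i; [exact: d_x|exact: dx].
  by have [->|ji] := eqVneq j i; [exact: dvdzz|rewrite y0 // dvdz0].
(* Now the column has the entries [d = 1] and [x = 1] up to sign, in rows [i] of
   both blocks, which contradicts the parity of their product. *)
have := even_cols k (theta_groupM (theta_gen_group f1.1) hg).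
rewrite trmulmxE (bigD1 i) //= big1 => [|a ai]; last first.
  by rewrite [dsubmx _ _ _](_ : _ = 0) ?mulr0 // dsub_trans2 y0.
rewrite addr0 -/c x1 dsub_trans2 -/d.
move: d1; rewrite !dvdzE => /=; rewrite dvdn1 => /eqP d1.
by rewrite abszM xd d1.
Qed.

(** The matrix 1 - N clears column k off the pivot in one stroke, also above row k. As N lives in
    column k and vanishes in row k, N^2 = 0, and the inverse is 1 + N. *)
Lemma reduce_upper_pivot k gam : fixes k gam ->
  (forall i, dsubmx gam i (lshift g k) = 0) -> usubmx gam k (lshift g k) = 1 ->
  exists2 M, gen_fixing k M & fixes k.+1 (M *m gam).
Proof.
set c := lshift g k => hf y0 xk.
pose N : 'M[int]_g := \matrix_(a, b) if (b == k) && (a != k) then usubmx gam a c else 0.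
have NN : N *m N = 0.
  apply/matrixP => a b; rewrite !mxE big1 // => l _; rewrite !mxE.
  by case: (l == k); rewrite ?andbF ?mulr0 ?mul0r.
pose M : G := block_mx (1%:M - N) 0 0 (1%:M + N)^T.
have hM : gen_fixing k M.
  split.
    apply: gen_levi; rewrite -trmx_mul mulmxDl mulmxBr !mulmxBr !mul1mx !mulmx1 NN.
    by rewrite subr0 subrK trmx1.
  move=> l lk; rewrite colE delta_lshift mul_block_col !mulmx0 mul0mx !addr0.
  rewrite mulmxBl mul1mx (_ : N *m _ = 0) ?subr0 //.
  apply/matrixP => a b; rewrite !mxE big1 // => j _; rewrite !mxE.
  case: (eqVneq j k) => [->|_]; last by rewrite mul0r.
  by rewrite (_ : k == l = false) ?mulr0 //; apply/negP => /eqP e; rewrite e ltnn in lk.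
exists M => // l; rewrite ltnS leq_eqVlt => /predU1P[lk|lk]; last exact: (fixesM hM.2 hf).
have {lk} -> : l = k by exact: val_inj.
rewrite delta_lshift -[M *m gam]vsubmxK; apply/matrixP => a b; rewrite ord1 mxE -/c.
case: (split_ordP a) => a' ->.
  rewrite !col_mxEu usub_block mul0mx addr0 mulmxBl mul1mx addmxE oppmxE mxE.
  rewrite [X in _ - X]mxE (bigD1 k) //= big1 ?addr0 => [|j jk]; last first.
    by rewrite mxE (negPf jk) mul0r.
  rewrite mxE eqxx xk mulr1 [RHS]mxE andbT -[gam _ _]/(gam _ _).
  case: (eqVneq a' k) => [->|ak] /=; last by rewrite mxE subrr.
  by move: xk; rewrite mxE subr0.
rewrite !col_mxEd dsub_block mul0mx add0r mxE big1 ?mxE // => j _.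
by rewrite y0 mulr0.
Qed.

(** With a zero lower half, the upper entries from row k on are coprime by [column_coprime], so
    Euclid's algorithm ends with a single entry 1 or -1 among them. The rows above k are left to the
    pivot step. *)
Lemma reduce_upper k (n : nat) gam : theta_group gam -> fixes k gam ->
  (forall i, dsubmx gam i (lshift g k) = 0) ->
  (\sum_(i : 'I_g | (k <= i)%N) `|usubmx gam i (lshift g k)| < n)%N ->
  exists2 M, gen_fixing k M & fixes k.+1 (M *m gam).
Proof.
elim: n gam => // n IH gam hg hf y0 hn.
set c := lshift g k in hn y0 *.
have step M0 : gen_fixing k M0 -> (forall i, dsubmx (M0 *m gam) i c = 0) ->
    (\sum_(i : 'I_g | (k <= i)%N) `|usubmx (M0 *m gam) i c| <
     \sum_(i : 'I_g | (k <= i)%N) `|usubmx gam i c|)%N ->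
    exists2 M, gen_fixing k M & fixes k.+1 (M *m gam).
  move=> h0 z0 lt.
  have [|M hM h] := IH (M0 *m gam) (theta_groupM (theta_gen_group h0.1) hg) (fixesM h0.2 hf) z0.
    exact: leq_trans lt _.
  by exists (M *m M0); [exact: gen_fixingM|rewrite -mulmxA].
have pivot M0 : gen_fixing k M0 -> (forall i, dsubmx (M0 *m gam) i c = 0) ->
    usubmx (M0 *m gam) k c = 1 -> exists2 M, gen_fixing k M & fixes k.+1 (M *m gam).
  move=> h0 z0 x1; have [M hM h] := reduce_upper_pivot (fixesM h0.2 hf) z0 x1.
  by exists (M *m M0); [exact: gen_fixingM|rewrite -mulmxA].
have levi0 i j t a : dsubmx (levi_add i j t *m gam) a c = 0.
  by rewrite dsub_levi_add !y0 mulr0 sub0r; case: ifP; rewrite ?oppr0.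
have two i j : (k <= i)%N -> (k <= j)%N -> i != j -> usubmx gam j c != 0 ->
    (`|usubmx gam j c| <= `|usubmx gam i c|)%N ->
    exists2 M, gen_fixing k M & fixes k.+1 (M *m gam).
  move=> ki kj ij xj xij; pose t := (usubmx gam i c %/ usubmx gam j c)%Z.
  apply: (step (levi_add i j (- t))) => //; first exact: levi_add_fixing.
  rewrite (bigD1 i) //= [X in (_ < X)%N](bigD1 i) //= -addSn leq_add //.
    rewrite usub_levi_add eqxx; apply: leq_trans xij.
    by have := absz_modz_lt (usubmx gam i c) xj; rewrite /modz mulNr.
  by apply: leq_sum => a /andP[_ ai]; rewrite usub_levi_add (negPf ai) addr0.
have cop d : (forall i, (k <= i)%N -> (d %| usubmx gam i c)%Z) -> `|d|%N = 1%N.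
  move=> hd; apply/eqP; rewrite -dvdn1 -[1%N]/(`|1%Z|%N) -dvdzE.
  by apply: (column_coprime hg hf) => // i; rewrite y0 dvdz0.
have [i /andP[ki xi]|x0] := pickP (fun i : 'I_g => (k <= i)%N && (usubmx gam i c != 0)); last first.
  have := cop 0; rewrite absz0 => h; suff: 0%N = 1%N by [].
  apply: h => i ki; have := x0 i; rewrite ki /= => /negbFE/eqP ->; exact: dvdz0.
have [/existsP[j /and3P[kj ij xj]]|no] :=
  boolP [exists j : 'I_g, [&& (k <= j)%N, i != j & usubmx gam j c != 0]].
  have [h|/ltnW h] := leqP `|usubmx gam j c| `|usubmx gam i c|; first exact: two ki kj ij xj h.
  by apply: two kj ki _ xi h; rewrite eq_sym.
have x0 (a : 'I_g) : (k <= a)%N -> a != i -> usubmx gam a c = 0.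
  move=> ka ai; apply/eqP; apply: contraNT no => xa; apply/existsP; exists a.
  by rewrite ka eq_sym ai xa.
have x1 : `|usubmx gam i c|%N = 1%N.
  apply: cop => a ka; have [->|ai] := eqVneq a i; first exact: dvdzz.
  by rewrite x0 // dvdz0.
have [ik|ik] := eqVneq i k; last first.
  (* Adding x times row i, where x = 1 or -1 is its entry, puts x^2 = 1 at the pivot. *)
  apply: (pivot (levi_add k i (usubmx gam i c))) => //.
    by apply: levi_add_fixing => //; rewrite eq_sym.
  rewrite usub_levi_add eqxx (x0 k) // 1?eq_sym // add0r.
  by move: x1; move: (usubmx gam i c) => z; nia.
rewrite {i ki xi no x0}ik in x1 *.
have [xk|xk] : usubmx gam k c = 1 \/ usubmx gam k c = -1 by lia.
  by apply: reduce_upper_pivot.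
(* The square of the inversion is -1 in coordinate k of both halves and corrects the sign of the
   pivot. *)
apply: (pivot (inversion_at k *m inversion_at k)).
- by apply: gen_fixingM; exact: inversion_fixing.
- move=> i; rewrite -mulmxA dsub_inversion usub_inversion dsub_inversion eqxx y0 oppr0.
  by case: (i == k).
- by rewrite -mulmxA usub_inversion eqxx dsub_inversion eqxx xk.
Qed.

Lemma reduce_columns n gam : (n <= g)%N -> theta_group gam ->
  exists2 M, theta_gen M & fixes n (M *m gam).
Proof.
elim: n => [|n IH] ng hg.
  by exists 1%:M; [exact: (gen_fixing1 0).1|].
have [M hM hf] := IH (ltnW ng) hg.
have hMg := theta_groupM (theta_gen_group hM) hg.
pose k : 'I_g := Ordinal ng.
have [M1 [h1 f1] y0] := @reduce_lower k _ _ hMg hf (ltnSn _).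
have hM1 := theta_groupM (theta_gen_group h1) hMg.
have [M2 [h2 f2] h] := @reduce_upper k _ _ hM1 (fixesM f1 hf) y0 (ltnSn _).
exists (M2 *m (M1 *m M)); first by do 2?apply: gen_mul.
by rewrite -!mulmxA.
Qed.

(** An inversion in one coordinate has order four, so its inverse is its cube. *)
Lemma theta_gen_inv M : theta_gen M -> exists2 M', theta_gen M' & M' *m M = 1%:M.
Proof.
elim=> {M} [S [Ss Sd]|A D AD|i|M N _ [M' hM' e1] _ [N' hN' e2]].
- exists (block_mx 1%:M (- S) 0 1%:M).
    apply: gen_translation; split=> [|i]; first by rewrite linearN /= Ss.
    by rewrite mxE rpredN.
  rewrite mulmx_block !(mulmx1, mul1mx, mulmx0, mul0mx, addr0, add0r) subrr.
  by rewrite -scalar_mx_block.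
- have DA : D^T *m A = 1%:M by rewrite -[LHS]trmxK trmx_mul trmxK AD trmx1.
  exists (block_mx D^T 0 0 A^T).
    by apply: gen_levi; rewrite trmxK; exact: mulmx1C.
  rewrite mulmx_block !(mulmx1, mul1mx, mulmx0, mul0mx, addr0, add0r) DA AD.
  by rewrite -scalar_mx_block.
- exists (inversion_at i *m inversion_at i *m inversion_at i).
    by do 2?apply: gen_mul; exact: gen_inversion.
  have EE : delta_mx i i *m delta_mx i i = delta_mx i i :> 'M[int]_g by rewrite mul_delta_mx.
  have sq : inversion_at i *m inversion_at i =
     block_mx (1%:M - delta_mx i i *+ 2) 0 0 (1%:M - delta_mx i i *+ 2).
    have EF : delta_mx i i *m (1%:M - delta_mx i i) = 0 :> 'M[int]_g.
      by rewrite mulmxBr mulmx1 EE subrr.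
    have FE : (1%:M - delta_mx i i) *m delta_mx i i = 0 :> 'M[int]_g.
      by rewrite mulmxBl mul1mx EE subrr.
    have FF : (1%:M - delta_mx i i) *m (1%:M - delta_mx i i) = 1%:M - delta_mx i i :> 'M[int]_g.
      by rewrite mulmxBl mul1mx EF subr0.
    rewrite /inversion_at mulmx_block !(mulmxN, mulNmx) EF FE FF EE !oppr0 !addr0.
    by rewrite [- _ + _]addrC mulr2n opprD addrA.
  rewrite -mulmxA sq mulmx_block !(mulmx0, mul0mx, addr0, add0r).
  rewrite (_ : _ *m _ = 1%:M) -?scalar_mx_block //.
  have E2 : (delta_mx i i *+ 2) *m (delta_mx i i *+ 2) =
      delta_mx i i *+ 2 + delta_mx i i *+ 2 :> 'M[int]_g.
    by rewrite !mulr2n mulmxDl !mulmxDr EE.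
  rewrite mulmxBl mul1mx mulmxBr mulmx1 E2 opprB [_ + _ - _]addrK.
  by rewrite subrK.
- by exists (N' *m M'); [exact: gen_mul|rewrite mulmxA -[_ *m M]mulmxA e1 mulmx1].
Qed.

(** When the left half is that of the identity, symmetry of the defect of [half_form] forces the
    lower right block to be 1, and then the upper right one to be symmetric with even diagonal. *)
Lemma theta_group_gen gam : theta_group gam -> theta_gen gam.
Proof.
move=> hg; have [M hM hf] := reduce_columns (leqnn g) hg.
have [M' hM' e] := theta_gen_inv hM.
suff h : theta_gen (M *m gam).
  by rewrite -[gam]mul1mx -e -mulmxA; exact: gen_mul.
move: (theta_groupM (theta_gen_group hM) hg) hf; move: (M *m gam) => N hN hf.
have e1 : ulsubmx N = 1%:M.
  apply/matrixP => a j; have /matrixP/(_ (lshift g a) 0) := hf j (ltn_ord j).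
  by rewrite delta_lshift col_mxEu !mxE andbT => ->.
have e2 : dlsubmx N = 0.
  apply/matrixP => a j; have /matrixP/(_ (rshift g a) 0) := hf j (ltn_ord j).
  by rewrite delta_lshift col_mxEd !mxE => ->.
have NE : N = block_mx 1%:M (ursubmx N) 0 (drsubmx N).
  by rewrite -e1 -e2 submxK.
move: (ursubmx N) (drsubmx N) NE hN => B D -> /theta_groupP.
rewrite tr_block_mx /half_form !mulmx_block.
rewrite !(trmx0, trmx1, mulmx0, mul0mx, mulmx1, mul1mx, addr0, add0r) opp_block_mx add_block_mx.
rewrite !oppr0 !addr0 => -[].
rewrite tr_block_mx !trmx0 => /eq_block_mx[_ _ + h3] h4.
move/(congr1 trmx); rewrite trmxK trmx0 => /eqP; rewrite subr_eq0 => /eqP DE.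
rewrite DE mulmx1 trmxK in h3 h4 *; apply: gen_translation; split=> // i.
by have := h4 (rshift g i); rewrite block_mxEdr mxE.
Qed.

End Descent.

(** * The action on the Siegel space *)

Section InverseMatrices.
Variables (K : fieldType) (n : nat).
Implicit Types (J P D A B : 'M[K]_n).

Lemma invmx_mul A B : A \in unitmx -> B \in unitmx ->
  invmx (A *m B) = invmx B *m invmx A.
Proof.
move=> uA uB; have uAB : A *m B \in unitmx by rewrite unitmx_mul uA.
by rewrite -[RHS](mulmxK uAB) mulmxA mulmxKV // mulVmx // mul1mx.
Qed.

Lemma mul_inv_cancel P J D : J \in unitmx -> D \in unitmx ->
  (P *m D) *m invmx (J *m D) = P *m invmx J.
Proof. by move=> uJ uD; rewrite invmx_mul // mulmxA mulmxK. Qed.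

Lemma sym_quotient P J : J \in unitmx -> P^T *m J = J^T *m P ->
  (P *m invmx J)^T = P *m invmx J.
Proof.
move=> uJ e; have uJT : J^T \in unitmx by rewrite unitmx_tr.
by rewrite trmx_mul trmx_inv -[P^T](mulmxK uJ) e -!mulmxA mulKmx.
Qed.

Lemma lower_solve J P A B : J \in unitmx ->
  (P *m invmx J)^T = P *m invmx J -> J^T *m A = 1%:M + P^T *m B ->
  A = invmx J^T + P *m invmx J *m B.
Proof.
move=> uJ e h; have uJT : J^T \in unitmx by rewrite unitmx_tr.
by rewrite -e trmx_mul trmx_inv -mulmxA -{1}[A](mulKmx uJT) h mulmxDr mulmx1.
Qed.

(** Additivity of the exponent in abstract form: D is the lower left block of a product, B1 and B2
    those of the factors, J1 and J2 the denominators. *)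
Lemma conj_exponent m (Z : 'M[K]_(m, n)) J1 J2 B1 B2 D : J1 \in unitmx -> J2 \in unitmx ->
  D = B1 *m invmx J2^T + J1 *m B2 ->
  Z *m invmx (J1 *m J2) *m D *m Z^T =
  (Z *m invmx J2) *m invmx J1 *m B1 *m (Z *m invmx J2)^T + Z *m invmx J2 *m B2 *m Z^T.
Proof.
move=> u1 u2 ->; rewrite invmx_mul // trmx_mul trmx_inv mulmxDr mulmxDl !mulmxA.
by rewrite (mulmxKV u1).
Qed.

End InverseMatrices.

Section SiegelAction.
Variables (R : realType) (g : nat).
Local Notation C := R[i].
Implicit Types (gam : 'M[int]_(g + g)) (Om : 'M[C]_g).

Definition act gam Om := auto_num gam Om *m invmx (auto_den gam Om).

Definition conjmx m n (A : 'M[C]_(m, n)) : 'M[C]_(m, n) := map_mx (@conjc R) A.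

Definition realmx m n (A : 'M[R]_(m, n)) : 'M[C]_(m, n) := map_mx (real_complex R) A.

Lemma toC_mul m n p (A : 'M[int]_(m, n)) (B : 'M[int]_(n, p)) :
  toC (A *m B) = toC A *m toC B :> 'M[C]_(m, p).
Proof. exact: map_mxM. Qed.

Lemma toC_tr m n (A : 'M[int]_(m, n)) : toC A^T = (toC A)^T :> 'M[C]_(n, m).
Proof. by apply/matrixP => i j; rewrite !mxE. Qed.

Lemma conj_toC m n (A : 'M[int]_(m, n)) : conjmx (toC A) = toC A.
Proof. by apply/matrixP => i j; rewrite !mxE -(rmorph_int (real_complex R)) conjc_real. Qed.

Lemma conjmxM m n p (A : 'M[C]_(m, n)) (B : 'M[C]_(n, p)) :
  conjmx (A *m B) = conjmx A *m conjmx B.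
Proof. exact: map_mxM. Qed.

Lemma conjmx_tr m n (A : 'M[C]_(m, n)) : conjmx A^T = (conjmx A)^T.
Proof. by apply/matrixP => i j; rewrite !mxE. Qed.

Lemma toC_symplectic_form :
  toC (symplectic_form g) = block_mx 0 1%:M (- 1%:M) 0 :> 'M[C]_(g + g).
Proof.
by rewrite /toC /symplectic_form map_block_mx !map_mx0 map_mxN map_mx1.
Qed.

Lemma form_col n p (u1 u2 : 'M[C]_(g, n)) (v1 v2 : 'M[C]_(g, p)) :
  (col_mx u1 u2)^T *m toC (symplectic_form g) *m col_mx v1 v2 = u1^T *m v2 - u2^T *m v1.
Proof.
rewrite toC_symplectic_form tr_col_mx mul_row_block mul_row_col.
by rewrite !mulmx0 !mulmx1 add0r addr0 mulmxN mulmx1 mulNmx addrC.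
Qed.

Lemma toC_form gam : siegel_modular_group gam ->
  (toC gam)^T *m toC (symplectic_form g) *m toC gam = toC (symplectic_form g) :> 'M[C]_(g + g).
Proof. by move=> h; rewrite -toC_tr -!toC_mul h. Qed.

Lemma toC_col gam Om : toC gam *m col_mx Om 1%:M = col_mx (auto_num gam Om) (auto_den gam Om).
Proof.
rewrite -[toC gam]submxK mul_block_col !mulmx1 /auto_num /auto_den /toC.
by rewrite !map_ulsubmx !map_ursubmx !map_dlsubmx !map_drsubmx.
Qed.

(** Invariance of the form, paired between the columns (Om, 1) and (u1, u2). Taking (Om, 1), taking
    (1, 0), or pairing with the conjugate point gives the relations used below. *)
Lemma form_num_den gam Om n (u1 u2 : 'M[C]_(g, n)) : siegel_modular_group gam ->
  let V := toC gam *m col_mx u1 u2 in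
  (auto_num gam Om)^T *m dsubmx V - (auto_den gam Om)^T *m usubmx V = Om^T *m u2 - u1.
Proof.
move=> hg V; rewrite -form_col vsubmxK -toC_col /V trmx_mul.
rewrite -!mulmxA (mulmxA (toC gam)^T) (mulmxA (_ *m _) (toC gam)) (toC_form hg) mulmxA.
by rewrite form_col trmx1 mul1mx.
Qed.

Lemma num_den_sym gam Om : siegel_modular_group gam -> Om^T = Om ->
  (auto_num gam Om)^T *m auto_den gam Om = (auto_den gam Om)^T *m auto_num gam Om.
Proof.
move=> hg hs; have := form_num_den Om Om 1%:M hg.
rewrite /= toC_col col_mxKu col_mxKd mulmx1 hs subrr => /eqP.
by rewrite subr_eq0 => /eqP.
Qed.

Lemma auto_den_lower gam Om : siegel_modular_group gam ->
  (auto_den gam Om)^T *m toC (ulsubmx gam) =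
  1%:M + (auto_num gam Om)^T *m toC (dlsubmx gam).
Proof.
move=> hg; have := form_num_den Om 1%:M 0 hg.
rewrite /= -{1 2}[toC gam]submxK mul_block_col !mulmx0 !mulmx1 !addr0 col_mxKu col_mxKd.
rewrite /toC map_ulsubmx map_dlsubmx sub0r => /eqP; rewrite subr_eq => /eqP ->.
by rewrite addrA subrr add0r.
Qed.

Lemma auto_conj gam Om : conjmx (auto_num gam Om) = auto_num gam (conjmx Om) /\
  conjmx (auto_den gam Om) = auto_den gam (conjmx Om).
Proof.
by rewrite /auto_num /auto_den; split; rewrite /conjmx map_mxD -/conjmx;
  rewrite -!/(conjmx _) conjmxM !conj_toC.
Qed.

Lemma num_den_conj gam Om : siegel_modular_group gam -> Om^T = Om ->
  (conjmx (auto_num gam Om))^T *m auto_den gam Om -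
  (conjmx (auto_den gam Om))^T *m auto_num gam Om = conjmx Om - Om.
Proof.
move=> hg hs; have [-> ->] := auto_conj gam Om.
have := form_num_den (conjmx Om) Om 1%:M hg.
by rewrite /= toC_col col_mxKu col_mxKd mulmx1 -conjmx_tr hs.
Qed.

Lemma conj_sub_im Om :
  conjmx Om - Om = (- (2 * 'i)) *: realmx (map_mx (@complex.Im R) Om).
Proof.
apply/matrixP => i j; rewrite !mxE; case: (Om i j) => a b.
by apply: ReImP => /=; ring.
Qed.

(* For [v = a + i b] the hermitian form [v^* Y v] equals [a Y a + b Y b]. *)
Lemma hermitian_gt0 (Y : 'M[R]_g) (v : 'cV[C]_g) : posdef Y -> v != 0 ->
  exists2 r : R, 0 < r & ((conjmx v)^T *m realmx Y *m v) 0 0 = r%:C.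
Proof.
move=> [Ys Yp] v0; pose a := map_mx (@complex.Re R) v; pose b := map_mx (@complex.Im R) v.
have vE : v = realmx a + 'i *: realmx b.
  apply/matrixP => i j; rewrite !mxE; exact: complexE.
have cvE : conjmx v = realmx a - 'i *: realmx b.
  by apply/matrixP => i j; rewrite !mxE; case: (v i j) => x y; simpc.
have pos (w : 'cV[R]_g) : 0 <= (w^T *m Y *m w) 0 0.
  have [->|w0] := eqVneq w 0; first by rewrite mulmx0 mxE.
  by have := Yp w^T; rewrite trmxK trmx_eq0 w0 => /(_ isT)/ltW.
have pos' (w : 'cV[R]_g) : w != 0 -> 0 < (w^T *m Y *m w) 0 0.
  by move=> w0; have := Yp w^T; rewrite trmxK trmx_eq0 w0 => /(_ isT).
exists ((a^T *m Y *m a) 0 0 + (b^T *m Y *m b) 0 0).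
  have [a0|a0] := eqVneq a 0; last by rewrite ltr_pwDl ?pos' ?pos.
  have [b0|b0] := eqVneq b 0; last by rewrite ltr_wpDl ?pos' ?pos.
  by move: v0; rewrite vE a0 b0 /realmx !map_mx0 scaler0 addr0 eqxx.
have cross : (b^T *m Y *m a) = (a^T *m Y *m b).
  apply/matrixP => i j; rewrite !ord1 -[in LHS](trmxK (b^T *m Y *m a)) mxE.
  by rewrite !trmx_mul trmxK Ys mulmxA.
have rM m n p (A : 'M[R]_(m, n)) (B : 'M[R]_(n, p)) :
  realmx A *m realmx B = realmx (A *m B) by rewrite /realmx map_mxM.
have rT m n (A : 'M[R]_(m, n)) : (realmx A)^T = realmx A^T by apply/matrixP => i j; rewrite !mxE.
rewrite cvE vE linearB /= linearZ /= !rT mulmxBl mulmxBl !mulmxDr.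
rewrite -!(scalemxAr, scalemxAl) !rM cross.
rewrite opprD scalerA -expr2 sqr_i scaleN1r opprK addrA addrK.
by rewrite mxE [X in X + _]mxE [X in _ + X]mxE rmorphD.
Qed.

Lemma tr_im n (A : 'M[C]_n) : A^T = A ->
  (map_mx (@complex.Im R) A)^T = map_mx (@complex.Im R) A.
Proof. by move=> h; rewrite -[in RHS]h; apply/matrixP => i j; rewrite !mxE. Qed.

Variable gam : 'M[int]_(g + g).
Hypothesis hg : siegel_modular_group gam.

(** At a kernel vector the hermitian form of Im Om would vanish, by [num_den_conj]. *)
Lemma auto_den_unit Om : siegel_space Om -> auto_den gam Om \in unitmx.
Proof.
move=> [Os Op]; rewrite unitmxE unitfE -det_tr; apply/negP => /det0P[v v0 hv].
have hv' : auto_den gam Om *m v^T = 0 by rewrite -[LHS]trmxK trmx_mul trmxK hv trmx0.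
have vt0 : v^T != 0 by rewrite trmx_eq0.
have [r r0] := hermitian_gt0 Op vt0.
have := num_den_conj hg Os; rewrite conj_sub_im => e.
have : (conjmx v^T)^T *m (- (2 * 'i) *: realmx (map_mx (@complex.Im R) Om)) *m v^T = 0.
  rewrite -e mulmxBr mulmxBl -!mulmxA hv' !mulmx0 sub0r mulmxA.
  by rewrite -trmx_mul -conjmxM hv' /conjmx map_mx0 trmx0 mul0mx oppr0.
move=> /matrixP/(_ 0 0); rewrite -scalemxAr -scalemxAl mxE => + er.
rewrite er [RHS]mxE => /eqP; rewrite mulf_eq0 oppr_eq0 mulf_eq0 pnatr_eq0 /=.
by rewrite eq_complex /= oner_eq0 andbF /= eq_complex /= gt_eqF.
Qed.

(** By [key], conjugating the imaginary part of the image by the denominator gives back Im Om;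
    positivity is transported along this change of variables. *)
Lemma act_siegel Om : siegel_space Om -> siegel_space (act gam Om).
Proof.
move=> hO; have [Os Op] := hO; have ud := auto_den_unit hO.
have udT : (auto_den gam Om)^T \in unitmx by rewrite unitmx_tr.
have asym : (act gam Om)^T = act gam Om.
  by apply: sym_quotient => //; exact: num_den_sym.
split=> //; split; first exact: tr_im.
move=> u u0; set D := auto_den gam Om in ud *.
pose v := invmx D *m realmx u^T.
have uE : realmx u^T = D *m v by rewrite mulmxA mulmxV // mul1mx.
have v0 : v != 0.
  apply: contraNneq u0 => v0; apply/eqP; move: uE; rewrite v0 mulmx0 => h.
  apply/matrixP => i j; have /matrixP/(_ j i) := h; rewrite !mxE.
  by move=> /complexI.
have [r r0] := hermitian_gt0 Op v0.
have key : (conjmx D)^T *m (conjmx (act gam Om) - act gam Om) *m D = conjmx Om - Om.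
  rewrite -(num_den_conj hg Os) -/D mulmxBr mulmxBl; congr (_ - _); last first.
    by rewrite -!mulmxA mulVmx // mulmx1.
  by rewrite -{1}asym conjmx_tr -trmx_mul -conjmxM -mulmxA mulVmx ?mulmx1.
move: key; rewrite !conj_sub_im -scalemxAr -scalemxAl => /(scalerI _) key er.
have i0 : - (2 * 'i) != 0 :> C.
  by rewrite oppr_eq0 mulf_neq0 ?pnatr_eq0 // eq_complex /= oner_eq0 andbF.
have {}key := key i0.
suff -> : (u *m map_mx (@complex.Im R) (act gam Om) *m u^T) 0 0 = r by [].
apply: complexI; rewrite -er -key.
rewrite -!mulmxA -uE !mulmxA -trmx_mul -conjmxM -uE.
have -> : (conjmx (realmx u^T))^T = realmx u.
  by apply/matrixP => i j; rewrite !mxE conjc_real.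
by rewrite /realmx -!map_mxM [RHS]mxE.
Qed.

End SiegelAction.

(** * Cocycle relations *)

Section Cocycle.
Variables (R : realType) (g : nat).
Local Notation C := R[i].
Implicit Types (gam : 'M[int]_(g + g)) (Om : 'M[C]_g).

(** The two halves of one identity: [gam2] sends the column (Om, 1) to (act gam2 Om, 1) times its
    denominator. *)
Lemma auto_mul (gam1 gam2 : 'M[int]_(g + g)) Om : auto_den gam2 Om \in unitmx ->
  auto_num (gam1 *m gam2) Om = auto_num gam1 (act gam2 Om) *m auto_den gam2 Om /\
  auto_den (gam1 *m gam2) Om = auto_den gam1 (act gam2 Om) *m auto_den gam2 Om.
Proof.
move=> ud; apply: eq_col_mx; rewrite -toC_col toC_mul -mulmxA toC_col.
have -> : col_mx (auto_num gam2 Om) (auto_den gam2 Om) =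
    col_mx (act gam2 Om) 1%:M *m auto_den gam2 Om.
  by rewrite mul_col_mx mul1mx /act -mulmxA mulVmx // mulmx1.
by rewrite mulmxA toC_col mul_col_mx.
Qed.

Lemma act_mul (gam1 gam2 : 'M[int]_(g + g)) Om :
  auto_den gam2 Om \in unitmx -> auto_den gam1 (act gam2 Om) \in unitmx ->
  act (gam1 *m gam2) Om = act gam1 (act gam2 Om).
Proof.
move=> u2 u1; have [en ed] := auto_mul gam1 u2.
by rewrite /act en ed mul_inv_cancel.
Qed.

(** The lower left block of the product is C1 A2 + D1 C2; eliminating A2 by [auto_den_lower] splits
    the exponent. *)
Lemma auto_exponent (gam1 gam2 : 'M[int]_(g + g)) Om m (Z : 'M[C]_(m, g)) :
  siegel_modular_group gam1 -> siegel_modular_group gam2 -> siegel_space Om ->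
  Z *m invmx (auto_den (gam1 *m gam2) Om) *m toC (dlsubmx (gam1 *m gam2)) *m Z^T =
  (Z *m invmx (auto_den gam2 Om)) *m invmx (auto_den gam1 (act gam2 Om))
     *m toC (dlsubmx gam1) *m (Z *m invmx (auto_den gam2 Om))^T
  + Z *m invmx (auto_den gam2 Om) *m toC (dlsubmx gam2) *m Z^T.
Proof.
move=> h1 h2 hO; have [Os _] := hO.
have u2 := auto_den_unit h2 hO; have hO' := act_siegel h2 hO.
have u1 := auto_den_unit h1 hO'; have [as' _] := hO'.
have [_ ->] := auto_mul gam1 u2.
apply: conj_exponent => //.
have -> : dlsubmx (gam1 *m gam2) =
    dlsubmx gam1 *m ulsubmx gam2 + drsubmx gam1 *m dlsubmx gam2.
  by rewrite -{1}[gam1]submxK -{1}[gam2]submxK mulmx_block block_mxKdl.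
have e := lower_solve u2 as' (auto_den_lower Om h2).
rewrite /toC map_mxD !map_mxM -!/(toC _) e.
rewrite -/(act gam2 Om) {2}/auto_den; move: (act gam2 Om) (invmx _) => X Y.
by rewrite mulmxDr mulmxDl mulmxA addrA.
Qed.

End Cocycle.

(** * Convergence and factorization of the theta series *)

Section PositiveForms.
Variables (R : realType) (n : nat) (Y : 'M[R]_n).
Hypothesis Yp : posdef Y.

Lemma posdef_unit : Y \in unitmx.
Proof.
rewrite unitmxE unitfE; apply/negP => /det0P[v v0 hv].
by have := Yp.2 v v0; rewrite hv mul0mx mxE ltxx.
Qed.

Definition qform (u v : 'rV[R]_n) : R := (u *m Y *m v^T) 0 0.

Lemma qformC u v : qform u v = qform v u.
Proof.
rewrite /qform -[in LHS](trmxK (u *m Y *m v^T)) mxE !trmx_mul trmxK Yp.1 mulmxA //.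
Qed.

Lemma qform_ge0 u : 0 <= qform u u.
Proof.
have [->|u0] := eqVneq u 0; first by rewrite /qform !mul0mx mxE.
exact: ltW (Yp.2 u u0).
Qed.

Lemma qform_cauchy u v : qform u v ^+ 2 <= qform u u * qform v v.
Proof.
have [->|v0] := eqVneq v 0.
  by rewrite /qform trmx0 !mulmx0 mxE mulr0 expr0n.
have vv : 0 < qform v v := Yp.2 v v0.
have e (t : R) : qform (u - t *: v) (u - t *: v) =
    qform u u - t * qform u v *+ 2 + t ^+ 2 * qform v v.
  have trE : (u - t *: v)^T = u^T - t *: v^T by rewrite linearB linearZ.
  rewrite {1}/qform trE !mulmxBl !mulmxBr -!(scalemxAl, scalemxAr).
  rewrite !(addmxE, oppmxE, scalemxE) -!/(qform _ _).
  by rewrite (qformC v u); ring.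
have := qform_ge0 (u - (qform u v / qform v v) *: v).
rewrite e -(pmulr_lge0 _ vv) => h.
rewrite -subr_ge0; apply: le_trans h _; rewrite le_eqVlt; apply/orP; left; apply/eqP.
by field; rewrite gt_eqF.
Qed.

(** The rows e_j satisfy q (u, e_j) = u_j, so Cauchy-Schwarz bounds u_j^2 by q (e_j, e_j) q (u, u);
    no compactness is involved. *)
Lemma posdef_lower_bound : exists2 c : R, 0 < c &
  forall u : 'rV[R]_n, c * \sum_j u 0 j ^+ 2 <= qform u u.
Proof.
pose e j : 'rV[R]_n := delta_mx 0 j *m invmx Y.
pose Q := 1 + \sum_j qform (e j) (e j).
have Q0 : 0 < Q by rewrite ltr_pwDl // sumr_ge0 // => j _; exact: qform_ge0.
exists Q^-1; first by rewrite invr_gt0.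
move=> u; rewrite ler_pdivrMl //.
have ue j : qform u (e j) = u 0 j.
  rewrite qformC /qform mulmxKV ?posdef_unit //.
  by rewrite -rowE !mxE.
apply: (@le_trans _ _ ((\sum_j qform (e j) (e j)) * qform u u)).
  rewrite mulr_suml; apply: ler_sum => j _.
  by rewrite -ue mulrC qform_cauchy.
by rewrite ler_wpM2r ?qform_ge0 // lerDr.
Qed.

End PositiveForms.

Section MatrixTheta.
Variable (R : realType).
Local Notation C := R[i].

Definition theta_summand m g (Om : 'M[C]_g) (Z : 'M[C]_(m, g)) (N : 'M[int]_(m, g)) : C :=
  epii (\tr (toC N *m Om *m (toC N)^T + (toC N *m Z^T) *+ 2)).

(** The set is enlarged to all matrices with entries in one finite set of integers, where the sum of
    products factors. *)
Lemma matrix_prod_sum_le m g (r : int -> R) (B : R) (A : {fset 'M[int]_(m, g)}) :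
  (forall j, 0 <= r j) -> (forall s : seq int, uniq s -> \sum_(j <- s) r j <= B) ->
  \sum_(N <- A) \prod_i \prod_j r (N i j) <= B ^+ (m * g).
Proof.
move=> r0 hB.
pose ents (N : 'M[int]_(m, g)) := [seq N p.1 p.2 | p <- enum {: 'I_m * 'I_g}].
pose E : {fset int} := seq_fset tt (flatten [seq ents N | N <- A]).
have EN (N : 'M[int]_(m, g)) i j : N \in A -> N i j \in E.
  move=> NA; rewrite seq_fsetE; apply/flattenP.
  exists (ents N); first exact: map_f.
  by apply/mapP; exists (i, j); rewrite ?mem_enum.
pose mat (f : {ffun 'I_m * 'I_g -> E}) : 'M[int]_(m, g) := \matrix_(i, j) val (f (i, j)).
have mat_inj : injective mat.
  move=> f1 f2 /matrixP e; apply/ffunP => -[i j]; apply/val_inj.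
  by have := e i j; rewrite !mxE.
pose t := [seq mat f | f <- enum {: {ffun 'I_m * 'I_g -> E}}].
apply: (@le_trans _ _ (\sum_(N <- t) \prod_i \prod_j r (N i j))).
  apply: ler_sum_subset => [|||N]; first exact: fset_uniq.
  - by rewrite map_inj_uniq // enum_uniq.
  - move=> N NA; apply/mapP; exists [ffun p => [` EN N p.1 p.2 NA]%fset]; rewrite ?mem_enum //.
    by apply/matrixP => i j; rewrite !mxE ffunE.
  - by apply: prodr_ge0 => i _; apply: prodr_ge0.
rewrite big_map big_enum /=.
have -> : \sum_(f : {ffun 'I_m * 'I_g -> E}) \prod_i \prod_j r (mat f i j) =
          \sum_(f : {ffun 'I_m * 'I_g -> E}) \prod_p r (val (f p)).
  apply: eq_bigr => f _; rewrite pair_bigA /=; apply: eq_bigr => -[i j] _.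
  by rewrite mxE.
rewrite -(bigA_distr_bigA (fun p (e : E) => r (val e))) /= prodr_const card_prod !card_ord.
have B0 : 0 <= B by have := hB [::] isT; rewrite big_nil.
apply: lerXn2r; rewrite ?nnegrE ?sumr_ge0 //.
by have := hB E (fset_uniq E); rewrite (big_seq_fsetE _ E xpredT r).
Qed.

Lemma im_trace_conj m g (Om : 'M[C]_g) (N : 'M[int]_(m, g)) :
  complex.Im (\tr (toC N *m Om *m (toC N)^T)) =
  \sum_i qform (map_mx (@complex.Im R) Om) (map_mx intr (row i N)) (map_mx intr (row i N)).
Proof.
rewrite /mxtrace (big_morph _ (@Im_add R) (erefl : complex.Im (0 : C) = 0)).
apply: eq_bigr => i _; rewrite /qform.
rewrite [in LHS]mxE [in RHS]mxE (big_morph _ (@Im_add R) (erefl : complex.Im (0 : C) = 0)).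
apply: eq_bigr => j _; rewrite [in LHS]mxE [in RHS]mxE.
rewrite [(toC N)^T _ _]mxE [toC N _ _]mxE [_^T _ _]mxE [map_mx _ _ _ _]mxE [row _ _ _ _]mxE.
rewrite mulrC -(rmorph_int (real_complex R)) Im_realM mulrC; congr (_ * _).
rewrite (big_morph _ (@Im_add R) (erefl : complex.Im (0 : C) = 0)).
apply: eq_bigr => l _; rewrite !mxE -(rmorph_int (real_complex R)) Im_realM //.
Qed.

(** A product over the entries reduces the sum over matrices to sums over integers. Im Om
    contributes - c N_ij^2 in each entry, by [posdef_lower_bound] on the rows, and Z a linear
    term. *)
Lemma theta_summand_le m g (Om : 'M[C]_g) (Z : 'M[C]_(m, g)) : siegel_space Om ->
  exists2 M : R, 0 <= M & forall N,
  normc (theta_summand Om Z N) <= \prod_i \prod_j (M * expR (- `|(N i j)%:~R|)).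
Proof.
move=> [_ Op]; have [c c0 hc] := posdef_lower_bound Op.
pose B : R := \sum_i \sum_j `|complex.Im (Z i j)|.
have BZ i j : `|complex.Im (Z i j)| <= B.
  rewrite /B (bigD1 i) //= (bigD1 j) //= -addrA lerDl addr_ge0 ?sumr_ge0 //.
  by move=> a _; rewrite sumr_ge0.
move: B BZ => B BZ; exists (expR ((8 * B + 1) ^+ 2 / (4 * c))) => [|N]; first exact: expR_ge0.
rewrite normc_epii.
have -> : \prod_i \prod_j (expR ((8 * B + 1) ^+ 2 / (4 * c)) * expR (- `|(N i j)%:~R|)) =
   expR (\sum_i \sum_j ((8 * B + 1) ^+ 2 / (4 * c) - 1 * `|(N i j)%:~R|)).
  rewrite expR_sum; apply: eq_bigr => i _; rewrite expR_sum; apply: eq_bigr => j _.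
  by rewrite mul1r -expRD.
rewrite ler_expR.
apply: (@le_trans _ _ (\sum_i \sum_j (- c * (N i j)%:~R ^+ 2 + 8 * B * `|(N i j)%:~R|))); last first.
  by apply: ler_sum => i _; apply: ler_sum => j _; exact: quadratic_le.
rewrite mxtraceD Im_add mulrDr opprD.
under eq_bigr do rewrite big_split /=.
rewrite big_split /=; apply: lerD.
  rewrite im_trace_conj.
  apply: (@le_trans _ _ (- (1 * \sum_i c * \sum_j ((N i j)%:~R : R) ^+ 2))).
    rewrite lerN2; apply: ler_pM; rewrite ?sumr_ge0 //.
    - by move=> i _; rewrite mulr_ge0 ?(ltW c0) // sumr_ge0 // => j _; rewrite sqr_ge0.
    - by have := pi_ge2 R; lra.
    - apply: ler_sum => i _; apply: le_trans (hc _); rewrite ler_wpM2l ?(ltW c0) //.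
      by rewrite le_eqVlt; apply/orP; left; apply/eqP/eq_bigr => j _; rewrite !mxE.
  rewrite mul1r -sumrN; apply: ler_sum => i _; rewrite -mulNr mulr_sumr //.
apply: le_trans (ler_norm _) _; rewrite normrN normrM (ger0_norm (pi_ge0 R)).
apply: le_trans (ler_wpM2r (normr_ge0 _) (pi_le4 R)) _.
have -> : complex.Im (\tr ((toC N *m Z^T) *+ 2)) =
   2 * \sum_i \sum_j (N i j)%:~R * complex.Im (Z i j).
  rewrite mulr2n mxtraceD Im_add -[LHS]mulr2n -[LHS]mulr_natl; congr (_ * _).
  rewrite /mxtrace (big_morph _ (@Im_add R) (erefl : complex.Im (0 : C) = 0)).
  apply: eq_bigr => i _; rewrite mxE (big_morph _ (@Im_add R) (erefl : complex.Im (0 : C) = 0)).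
  by apply: eq_bigr => j _; rewrite !mxE -(rmorph_int (real_complex R)) Im_realM.
rewrite normrM normr_nat mulrA.
apply: le_trans (ler_wpM2l _ (ler_norm_sum _ _ _)) _ => //.
rewrite mulr_sumr; apply: ler_sum => i _.
apply: le_trans (ler_wpM2l _ (ler_norm_sum _ _ _)) _ => //.
rewrite mulr_sumr; apply: ler_sum => j _.
rewrite normrM; have := ler_wpM2l (normr_ge0 ((N i j)%:~R : R)) (BZ i j); lra.
Qed.

Lemma theta_abs_bounded m g (Om : 'M[C]_g) (Z : 'M[C]_(m, g)) : siegel_space Om ->
  exists M, abs_bounded (theta_summand Om Z) M.
Proof.
move=> hO; have [M M0 hM] := theta_summand_le Z hO.
exists ((M * (2 + 2 / 1)) ^+ (m * g)); apply: (abs_bounded_le hM) => A.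
apply: (matrix_prod_sum_le (r := fun j => M * expR (- `|j%:~R|))) => [j|s us].
  by rewrite mulr_ge0 ?expR_ge0.
rewrite -mulr_sumr ler_wpM2l //.
have := exp_int_sum_le (@ltr01 R) us; apply: le_trans.
by under [leRHS]eq_bigr do rewrite mul1r.
Qed.

Lemma Theta_hassum m g (Om : 'M[C]_g) (Z : 'M[C]_(m, g)) : siegel_space Om ->
  hassum (theta_summand Om Z) (Theta Om Z).
Proof. by move=> /(theta_abs_bounded Z)[M]; exact: usumP. Qed.

Lemma Theta_eq m g (Om : 'M[C]_g) (Z : 'M[C]_(m, g)) s :
  hassum (theta_summand Om Z) s -> Theta Om Z = s.
Proof. exact: hassum_usum. Qed.

End MatrixTheta.

(** * Factorization over the rows *)

Section ThetaRows.
Variables (R : realType) (g : nat).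
Local Notation C := R[i].
Implicit Types (Om : 'M[C]_g).

Lemma theta_summand_col m1 m2 Om (Z1 : 'M[C]_(m1, g)) (Z2 : 'M[C]_(m2, g))
    (N1 : 'M[int]_(m1, g)) (N2 : 'M[int]_(m2, g)) :
  theta_summand Om (col_mx Z1 Z2) (col_mx N1 N2) =
  theta_summand Om Z1 N1 * theta_summand Om Z2 N2.
Proof.
rewrite /theta_summand -epiiD /toC map_col_mx !tr_col_mx mul_col_mx !mul_col_row.
have tr2 k (A B : 'M[C]_k) : \tr (A + B *+ 2) = \tr A + \tr B *+ 2.
  by rewrite mxtraceD !mulr2n mxtraceD.
by rewrite !tr2 !mxtrace_block; congr epii; ring.
Qed.

Lemma col_mx_bij m1 m2 : bijective (fun p : 'M[int]_(m1, g) * 'M[int]_(m2, g) => col_mx p.1 p.2).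
Proof.
exists (fun N => (usubmx N, dsubmx N)) => [[a b]|N] /=; last exact: vsubmxK.
by rewrite col_mxKu col_mxKd.
Qed.

Lemma Theta_col m1 m2 Om (Z1 : 'M[C]_(m1, g)) (Z2 : 'M[C]_(m2, g)) : siegel_space Om ->
  Theta Om (col_mx Z1 Z2) = Theta Om Z1 * Theta Om Z2.
Proof.
move=> hO; have h := (hassum_bij _ _ (col_mx_bij m1 m2)).1 (Theta_hassum (col_mx Z1 Z2) hO).
have h1 : hassum (fun N1 => theta_summand Om Z1 N1 * Theta Om Z2) (Theta Om (col_mx Z1 Z2)).
  apply: hassum_fubini h _ => N1.
  apply: hassum_ext (hassumZ (theta_summand Om Z1 N1) (Theta_hassum Z2 hO)) => N2 /=.
  by rewrite theta_summand_col.
apply: hassum_unique h1 _; rewrite mulrC.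
by apply: hassum_ext (hassumZ (Theta Om Z2) (Theta_hassum Z1 hO)) => N; rewrite mulrC.
Qed.

Lemma Theta_rows m Om (Z : 'M[C]_(m, g)) : siegel_space Om ->
  Theta Om Z = \prod_i Theta Om (row i Z).
Proof.
move=> hO; elim: m Z => [|m IH] Z.
  (* There is exactly one matrix without rows, and its term is 1. *)
  rewrite big_ord0; apply: Theta_eq => e e0; exists [fset (0 : 'M[int]_(0, g))]%fset => B hB.
  have -> : B = [fset (0 : 'M[int]_(0, g))]%fset.
    apply/fsetP => N; rewrite inE [N]flatmx0 eqxx; apply: (fsubsetP hB).
    by rewrite inE eqxx.
  rewrite big_seq_fset1 /theta_summand /mxtrace big_ord0 epii0 subrr normc0 //.
have e1 : @usubmx _ 1 m g Z = row ord0 Z.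
  by apply/matrixP => i j; rewrite mxE [RHS]mxE; congr (Z _ _); apply: val_inj; rewrite ord1.
have e2 i : row i (@dsubmx _ 1 m g Z) = row (lift ord0 i) Z.
  by apply/matrixP => a j; rewrite mxE mxE [RHS]mxE; congr (Z _ _); apply: val_inj.
have t := @Theta_col 1 m Om (@usubmx C 1 m g Z) (@dsubmx C 1 m g Z) hO.
rewrite (@vsubmxK C 1 m g Z) in t.
rewrite big_ord_recl -e1; apply: etrans t _; congr (_ * _).
by rewrite IH; apply: eq_bigr => i _; rewrite e2.
Qed.

End ThetaRows.

(** * Continuity on the Siegel space *)

Section SiegelContinuity.
Variables (R : realType) (g : nat).
Local Notation C := R[i].
Implicit Types (F G : 'M[C]_g -> C) (Om : 'M[C]_g).

(** Continuity relative to the Siegel space, with the entrywise distance and the real-valued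
    modulus; it is translated into topology once, in [scont_continuous]. *)
Definition scont F := forall Om, siegel_space Om -> forall e : R, 0 < e ->
  exists2 d : R, 0 < d & forall Om', siegel_space Om' ->
  (forall i j, normc (Om' i j - Om i j) < d) -> normc (F Om' - F Om) < e.

Lemma scont_eq F G : (forall Om, siegel_space Om -> F Om = G Om) -> scont F -> scont G.
Proof.
move=> FG hF Om hO e e0; have [d d0 h] := hF Om hO e e0.
by exists d => // Om' hO' hd; rewrite -!FG // h.
Qed.

Lemma scont_const c : scont (fun=> c).
Proof. by move=> Om _ e e0; exists 1 => // Om' _ _; rewrite subrr normc0. Qed.

Lemma scont_entry i j : scont (fun Om => Om i j).
Proof. by move=> Om _ e e0; exists e => // Om' _; apply. Qed.

Lemma scontD F G : scont F -> scont G -> scont (fun Om => F Om + G Om).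
Proof.
move=> hF hG Om hO e e0.
have [d1 d10 h1] := hF Om hO _ (divr2_gt0 e0).
have [d2 d20 h2] := hG Om hO _ (divr2_gt0 e0).
exists (Num.min d1 d2) => [|Om' hO' hd]; first by rewrite lt_min d10.
rewrite opprD addrACA (le_lt_trans (normcD _ _)) // (splitr e).
apply: ltrD; [apply: h1|apply: h2] => // i j; apply: lt_le_trans (hd i j) _.
  by rewrite ge_min lexx.
by rewrite ge_min lexx orbT.
Qed.

Lemma scontM F G : scont F -> scont G -> scont (fun Om => F Om * G Om).
Proof.
move=> hF hG Om hO e e0.
pose B := 1 + normc (F Om) + normc (G Om).
have [F0 G0] := (normc_ge0 (F Om), normc_ge0 (G Om)).
have B0 : 0 < B by rewrite /B; lra.
have eB : 0 < Num.min 1 (e / 2 / B) by rewrite lt_min ltr01 divr_gt0 // divr2_gt0.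
have [d1 d10 h1] := hF Om hO _ eB.
have [d2 d20 h2] := hG Om hO _ eB.
exists (Num.min d1 d2) => [|Om' hO' hd]; first by rewrite lt_min d10.
have l1 : normc (F Om' - F Om) < Num.min 1 (e / 2 / B).
  by apply: h1 => // i j; apply: lt_le_trans (hd i j) _; rewrite ge_min lexx.
have l2 : normc (G Om' - G Om) < Num.min 1 (e / 2 / B).
  by apply: h2 => // i j; apply: lt_le_trans (hd i j) _; rewrite ge_min lexx orbT.
move: l1 l2; rewrite !lt_min => /andP[a1 a2] /andP[b1 b2].
have -> : F Om' * G Om' - F Om * G Om =
  (F Om' - F Om) * G Om + F Om' * (G Om' - G Om) by ring.
have F' : normc (F Om') <= 1 + normc (F Om).
  rewrite -[F Om'](subrK (F Om)) (le_trans (normcD _ _)) // lerD2r ltW //.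
rewrite (le_lt_trans (normcD _ _)) // !normcM (splitr e).
apply: ler_ltD.
  apply: le_trans (ler_wpM2r G0 (ltW a2)) _; rewrite mulrAC ler_pdivrMr //.
  by rewrite ler_wpM2l ?(ltW (divr2_gt0 e0)) // /B; lra.
apply: le_lt_trans (ler_wpM2r (normc_ge0 _) F') _.
rewrite mulrC -ltr_pdivlMr; last lra.
apply: lt_le_trans b2 _; rewrite ler_wpM2l ?(ltW (divr2_gt0 e0)) //.
by rewrite lef_pV2 ?posrE //; rewrite /B; lra.
Qed.

Lemma scont_sum (I : Type) (r : seq I) (P : pred I) (F : I -> 'M[C]_g -> C) :
  (forall i, scont (F i)) -> scont (fun Om => \sum_(i <- r | P i) F i Om).
Proof.
move=> h; elim: r => [|i r IH].
  by apply: scont_eq (scont_const 0) => Om _; rewrite big_nil.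
apply: (@scont_eq (fun Om => (if P i then F i Om else 0) + \sum_(j <- r | P j) F j Om)).
  by move=> Om _; rewrite big_cons; case: ifP => // _; rewrite add0r.
by apply: scontD => //; case: (P i) => //; exact: scont_const.
Qed.

Lemma scont_prod (I : Type) (r : seq I) (P : pred I) (F : I -> 'M[C]_g -> C) :
  (forall i, scont (F i)) -> scont (fun Om => \prod_(i <- r | P i) F i Om).
Proof.
move=> h; elim: r => [|i r IH].
  by apply: scont_eq (scont_const 1) => Om _; rewrite big_nil.
apply: (@scont_eq (fun Om => (if P i then F i Om else 1) * \prod_(j <- r | P j) F j Om)).
  by move=> Om _; rewrite big_cons; case: ifP => // _; rewrite mul1r.
by apply: scontM => //; case: (P i) => //; exact: scont_const.
Qed.

Lemma scontV F : (forall Om, siegel_space Om -> F Om != 0) -> scont F ->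
  scont (fun Om => (F Om)^-1).
Proof.
move=> F0 hF Om hO e e0; have n0 : 0 < normc (F Om) by rewrite normc_gt0 F0.
(* The first bound keeps |F Om'| above |F Om| / 2; the second then makes the difference of the
   inverses smaller than e. *)
pose d0 := Num.min (normc (F Om) / 2) (e * (normc (F Om) ^+ 2 / 2)).
have d00 : 0 < d0.
  by rewrite lt_min divr2_gt0 // mulr_gt0 // divr2_gt0 // exprn_gt0.
have [d dp h] := hF Om hO _ d00; exists d => // Om' hO' /(h _ hO').
rewrite lt_min => /andP[l1 l2].
have F'0 := F0 _ hO'.
have n' : normc (F Om) / 2 < normc (F Om').
  have : normc (F Om) <= normc (F Om - F Om') + normc (F Om').
    by rewrite -{1}[F Om](subrK (F Om')) normcD.
  by rewrite normcBC; lra.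
have -> : (F Om')^-1 - (F Om)^-1 = (F Om - F Om') / (F Om * F Om').
  by field; rewrite F'0 F0.
rewrite normcM normcV normcM normcBC ltr_pdivrMr ?mulr_gt0 //; last first.
  exact: lt_trans (divr2_gt0 n0) n'.
apply: lt_le_trans l2 _; rewrite ler_wpM2l ?(ltW e0) // expr2 -mulrA.
by rewrite ler_wpM2l ?(ltW n0) // ltW.
Qed.

Lemma scont_comp F (A : 'M[C]_g -> 'M[C]_g) :
  (forall Om, siegel_space Om -> siegel_space (A Om)) ->
  (forall i j, scont (fun Om => A Om i j)) -> scont F -> scont (fun Om => F (A Om)).
Proof.
move=> AS hA hF Om hO e e0; have [d d0 h] := hF _ (AS _ hO) e e0.
have [D hD] := choice (fun p : 'I_g * 'I_g => let: ex_intro2 x a b := hA p.1 p.2 Om hO d d0 in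
   ex_intro (fun x : R => 0 < x /\ forall Om', siegel_space Om' ->
  (forall i j, normc (Om' i j - Om i j) < x) -> normc (A Om' p.1 p.2 - A Om p.1 p.2) < d) x (conj a b)).
pose m := \big[Num.min/1]_p D p.
have m0 : 0 < m by apply: lt_bigmin => // p _; exact: (hD p).1.
exists m => // Om' hO' hm; apply: h; first exact: AS.
move=> i j; apply: (hD (i, j)).2 => // a b; apply: lt_le_trans (hm a b) _.
exact: bigmin_le_cond.
Qed.

Lemma scont_det n (A : 'M[C]_g -> 'M[C]_n) :
  (forall i j, scont (fun Om => A Om i j)) -> scont (fun Om => \det (A Om)).
Proof.
move=> hA; apply: scont_sum => s; apply: scontM; first exact: scont_const.
by apply: scont_prod => i.
Qed.

Lemma scont_mulmx m n p (A : 'M[C]_g -> 'M[C]_(m, n)) (B : 'M[C]_g -> 'M[C]_(n, p)) i j :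
  (forall i j, scont (fun Om => A Om i j)) -> (forall i j, scont (fun Om => B Om i j)) ->
  scont (fun Om => (A Om *m B Om) i j).
Proof.
move=> hA hB; apply: (@scont_eq (fun Om => \sum_k A Om i k * B Om k j)).
  by move=> Om _; rewrite mxE.
by apply: scont_sum => k; exact: scontM.
Qed.

Lemma scont_invmx n (A : 'M[C]_g -> 'M[C]_n) i j :
  (forall Om, siegel_space Om -> A Om \in unitmx) ->
  (forall i j, scont (fun Om => A Om i j)) -> scont (fun Om => invmx (A Om) i j).
Proof.
move=> uA hA.
apply: (@scont_eq (fun Om => (\det (A Om))^-1 * cofactor (A Om) j i)).
  by move=> Om hO; rewrite /invmx uA // !mxE.
apply: scontM; first apply: scontV; rewrite /cofactor.
- by move=> Om hO; have := uA _ hO; rewrite unitmxE unitfE.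
- exact: scont_det.
- apply: scontM; first exact: scont_const.
  apply: scont_det => a b; apply: scont_eq (hA (lift j a) (lift i b)) => Om _.
  by rewrite !mxE.
Qed.

Lemma scont_auto_den gam i j : scont (fun Om => auto_den gam Om i j).
Proof.
apply: (@scont_eq (fun Om => (toC (dlsubmx gam) *m Om) i j + toC (drsubmx gam) i j)).
  by move=> Om _; rewrite [RHS]mxE.
apply: scontD; last exact: scont_const.
by apply: scont_mulmx => *; [exact: scont_const|exact: scont_entry].
Qed.

Lemma scont_auto_num gam i j : scont (fun Om => auto_num gam Om i j).
Proof.
apply: (@scont_eq (fun Om => (toC (ulsubmx gam) *m Om) i j + toC (ursubmx gam) i j)).
  by move=> Om _; rewrite [RHS]mxE.
apply: scontD; last exact: scont_const.
by apply: scont_mulmx => *; [exact: scont_const|exact: scont_entry].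
Qed.

Lemma scont_act gam i j : siegel_modular_group gam -> scont (fun Om => act gam Om i j).
Proof.
move=> hg; apply: scont_mulmx => a b; first exact: scont_auto_num.
apply: scont_invmx => [Om hO|c d]; [exact: auto_den_unit|exact: scont_auto_den].
Qed.

Lemma im_diag_gt0 Om i : siegel_space Om -> 0 < complex.Im (Om i i).
Proof.
move=> [_ [_ Op]]; have := Op (delta_mx 0 i).
rewrite -rowE trmx_delta -colE !mxE; apply.
by apply/eqP => /matrixP/(_ 0 i)/eqP; rewrite !mxE !eqxx oner_eq0.
Qed.

(** The principal root does not jump because - i Om_ii has positive real part: (s' - s) (s' + s) = -
    i (Om'_ii - Om_ii), and |s' + s| > Re s. *)
Lemma scont_sqrtc i : scont (fun Om => sqrtc (- 'i * Om i i)).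
Proof.
have re (Om : 'M[C]_g) : siegel_space Om -> 0 < complex.Re (sqrtc (- 'i * Om i i)).
  move=> hO; apply: Re_sqrtc_gt0.
  by rewrite mulNr Re_opp Re_mul /= mul0r sub0r mul1r opprK im_diag_gt0.
move=> Om hO e e0; set s := sqrtc (- 'i * Om i i).
have s0 : 0 < complex.Re s := re _ hO.
exists (e * complex.Re s); first exact: mulr_gt0.
move=> Om' hO' /(_ i i); set s' := sqrtc (- 'i * Om' i i) => h.
have s'0 : 0 < complex.Re s' := re _ hO'.
have ss : (s' - s) * (s' + s) = - 'i * (Om' i i - Om i i).
  by rewrite -subr_sqr !sqr_sqrtc mulrBr.
have n1 : complex.Re s < normc (s' + s).
  apply: lt_le_trans (normc_Re _); apply: lt_le_trans (ler_norm _).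
  by rewrite Re_add ltrDr.
have n0 : 0 < normc (s' + s) := lt_trans s0 n1.
rewrite -(ltr_pM2r n0) -normcM ss normcM normcNE.
have -> : normc ('i : C) = 1 by rewrite /= expr0n expr1n add0r sqrtr1.
rewrite mul1r; apply: lt_trans h _; by rewrite ltr_pM2l.
Qed.

Lemma scont_continuous F : scont F ->
  {within (@siegel_space R g : set 'M[C^o]_g), continuous (F : 'M[C^o]_g -> C^o)}%classic.
Proof.
move=> hF; apply/subspace_continuousP => Om hO.
apply/(@cvgrPdist_lt C C^o) => -[e e']; rewrite ltcE /= => /andP[/eqP -> e0].
have [d d0 h] := hF Om hO e e0.
have hb : \forall Om' \near nbhs (Om : 'M[C^o]_g),
    forall i j, normc ((Om' : 'M[C]_g) i j - Om i j) < d.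
  apply/nbhs_ballP; exists d%:C => [|Om' [_ hb] i j]; first by rewrite /= ltcR.
  have := hb i j; rewrite -ball_normE /= normcBC => hij.
  by rewrite -ltcR -norm_normc.
rewrite near_withinE; apply: filterS hb => Om' hd hO'.
have := h _ hO' hd; rewrite normcBC -ltcR -norm_normc; apply.
Qed.

End SiegelContinuity.

(** * The transformation formula for the generators *)

Section TransformationFormula.
Variables (R : realType) (g : nat).
Local Notation C := R[i].
Implicit Types (gam : 'M[int]_(g + g)) (Om : 'M[C]_g) (z : 'rV[C]_g).

(* The transformation formula in one row, with an unspecified automorphy factor
   [chi] of which only continuity and [chi^8 = det^4] are recorded. *)
Definition theta_transforms gam := exists chi : 'M[C]_g -> C, [/\ scont chi,
  forall Om, siegel_space Om -> chi Om ^+ 8 = \det (auto_den gam Om) ^+ 4 &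
  forall Om z, siegel_space Om ->
    Theta (act gam Om) (z *m invmx (auto_den gam Om)) =
    chi Om * epii ((z *m invmx (auto_den gam Om) *m toC (dlsubmx gam) *m z^T) 0 0)
    * Theta Om z].

Lemma theta_transformsM gam1 gam2 :
  siegel_modular_group gam1 -> siegel_modular_group gam2 ->
  theta_transforms gam1 -> theta_transforms gam2 -> theta_transforms (gam1 *m gam2).
Proof.
move=> h1 h2 [c1 [s1 d1 t1]] [c2 [s2 d2 t2]].
exists (fun Om => c1 (act gam2 Om) * c2 Om); split.
- apply: scontM s2; apply: scont_comp s1; first by move=> Om; exact: act_siegel.
  by move=> i j; exact: scont_act.
- move=> Om hO; have u2 := auto_den_unit h2 hO; have [_ ->] := auto_mul gam1 u2.
  by rewrite exprMn d2 // (d1 _ (act_siegel h2 hO)) det_mulmx exprMn.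
- move=> Om z hO; have u2 := auto_den_unit h2 hO; have hO2 := act_siegel h2 hO.
  have u1 := auto_den_unit h1 hO2.
  rewrite auto_exponent // act_mul // addmxE epiiD.
  have [_ ed] := auto_mul gam1 u2.
  have t1' := t1 (act gam2 Om) (z *m invmx (auto_den gam2 Om)) hO2.
  rewrite ed (invmx_mul u1 u2) (mulmxA z) t1' (t2 Om z hO).
  have aux (a b x y t : C) : a * x * (b * y * t) = a * b * (x * y) * t by ring.
  exact: aux.
Qed.

Lemma auto_den_trans (S : 'M[int]_g) Om : auto_den (block_mx 1%:M S 0 1%:M) Om = 1%:M.
Proof.
by rewrite /auto_den block_mxKdl block_mxKdr /toC map_mx0 map_mx1 mul0mx add0r.
Qed.

Lemma toC_even_diag (S : 'M[int]_g) (n : 'rV[int]_g) : even_sym S ->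
  exists k : int, \tr (toC n *m toC S *m (toC n)^T) = (2 * k)%:~R :> C.
Proof.
move=> hS; have [_ /(_ 0)] := even_sym_conj n^T hS; rewrite trmxK => /dvdzP[k hk].
exists k; rewrite trace_mx11 -toC_tr -!toC_mul mxE hk mulrC //.
Qed.

(** Every term is unchanged, because N S N^T is an even integer. *)
Lemma trans_transforms (S : 'M[int]_g) : even_sym S ->
  theta_transforms (block_mx 1%:M S 0 1%:M).
Proof.
move=> hS; exists (fun=> 1); split.
- exact: scont_const.
- by move=> Om _; rewrite auto_den_trans det1 !expr1n.
- move=> Om z hO; rewrite auto_den_trans block_mxKdl /toC map_mx0 !mulmx0 mul0mx mxE epii0 !mul1r.
  have hg : siegel_modular_group (block_mx 1%:M S 0 1%:M).
    by case: (theta_gen_group (gen_translation hS)).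
  apply: Theta_eq; apply: hassum_ext (Theta_hassum z hO) => N.
  rewrite /act auto_den_trans /auto_num block_mxKul block_mxKur invmx1 !mulmx1.
  rewrite /theta_summand [toC 1%:M]map_mx1 mul1mx mulmxDr mulmxDl.
  rewrite -[in RHS]addrA [in RHS]addrCA [in RHS]mxtraceD [RHS]epiiD.
  by have [k ->] := toC_even_diag N hS; rewrite epii_even mul1r.
Qed.

(** Reindexing by N -> N A, with [chi] equal to 1; this fits det^4 because det D = 1 or -1. *)
Lemma levi_transforms (A D : 'M[int]_g) : A^T *m D = 1%:M ->
  theta_transforms (block_mx A 0 0 D).
Proof.
move=> AD; have DA : D *m A^T = 1%:M by exact: mulmx1C.
have AD' : A *m D^T = 1%:M by rewrite -[LHS]trmxK trmx_mul trmxK DA trmx1.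
have DA' : D^T *m A = 1%:M by exact: mulmx1C.
have denE Om : auto_den (block_mx A 0 0 D) Om = toC D.
  by rewrite /auto_den block_mxKdl block_mxKdr /toC map_mx0 mul0mx add0r.
have hDA : toC D *m (toC A)^T = 1%:M :> 'M[C]_g.
  by rewrite -toC_tr -toC_mul DA /toC map_mx1.
have uD : toC D \in unitmx := (mulmx1_unit hDA).1.
have iD : invmx (toC D) = (toC A)^T :> 'M[C]_g.
  by rewrite -[LHS]mulmx1 -hDA mulKmx.
exists (fun=> 1); split.
- exact: scont_const.
- move=> Om _; rewrite denE expr1n /toC det_map_mx.
  have /(congr1 absz) : (\det D * \det A) = 1 by rewrite -(det_tr A) -det_mulmx DA det1.
  rewrite abszM => /eqP; rewrite muln_eq1 => /andP[/eqP hd1 _].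
  have [->|->] : \det D = 1 \/ \det D = -1 by lia.
    by rewrite expr1n.
  by rewrite rmorphN1 -signr_odd.
- move=> Om z hO; rewrite denE block_mxKdl /toC map_mx0 !mulmx0 mul0mx mxE epii0 !mul1r.
  rewrite -!/(toC _) iD.
  have bij : bijective (fun N : 'rV[int]_g => N *m A).
    by exists (fun N => N *m D^T) => N; rewrite -mulmxA ?AD' ?DA' mulmx1.
  apply: Theta_eq; apply: hassum_ext ((hassum_bij _ _ bij).1 (Theta_hassum z hO)) => N /=.
  rewrite /theta_summand /act denE iD /auto_num block_mxKul block_mxKur.
  rewrite [toC 0]map_mx0 addr0 toC_mul !trmx_mul trmxK !mulmxA //.
Qed.

End TransformationFormula.

(** * Perturbations of rank one *)

Section RankOne.
Variables (K : fieldType) (n : nat).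
Implicit Types (u : 'cV[K]_n) (r : 'rV[K]_n).

Lemma mx11M (A B : 'M[K]_1) : (A *m B) 0 0 = A 0 0 * B 0 0.
Proof. by rewrite mxE big_ord1. Qed.

(* Sylvester's identity, read off from the two factorizations of
   [block_mx 1 u (- r) 1]. *)
Lemma det_rank_one u r : \det (1%:M + u *m r) = 1 + (r *m u) 0 0.
Proof.
pose M := block_mx 1%:M u (- r) 1%:M.
have e1 : M *m block_mx 1%:M 0 r 1%:M = block_mx (1%:M + u *m r) u 0 1%:M.
  rewrite mulmx_block !(mulmx0, mulmx1, mul1mx, add0r) addNr //.
have e2 : block_mx 1%:M 0 r 1%:M *m M = block_mx 1%:M u 0 (1%:M + r *m u).
  rewrite mulmx_block !(mul0mx, mulmx1, mul1mx, addr0) subrr addrC //.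
have d1 : \det M = \det (1%:M + u *m r).
  have := congr1 determinant e1; rewrite det_mulmx det_lblock det_ublock !det1.
  by rewrite !mulr1.
have d2 : \det M = \det (1%:M + r *m u).
  have := congr1 determinant e2; rewrite det_mulmx det_lblock det_ublock !det1.
  by rewrite !mul1r.
rewrite -d1 d2 [1%:M + _]mx11_scalar det_scalar1 mxE [in X in X + _]mxE eqxx.
by rewrite mulr1n.
Qed.

(** The Sherman-Morrison formula, from (u r)^2 = (t - 1) u r. *)
Lemma inv_rank_one u r (t : K) : t != 0 -> (r *m u) 0 0 = t - 1 ->
  (1%:M + u *m r) \in unitmx /\
  invmx (1%:M + u *m r) = 1%:M - t^-1 *: (u *m r).
Proof.
move=> t0 ru.
have uE : (1%:M + u *m r) \in unitmx.
  by rewrite unitmxE det_rank_one ru addrC subrK unitfE.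
have vv : (u *m r) *m (u *m r) = (t - 1) *: (u *m r).
  by rewrite mulmxA -(mulmxA u) [r *m u]mx11_scalar ru mul_mx_scalar -scalemxAl.
have tt : t^-1 * (t - 1) = 1 - t^-1 by rewrite mulrBr mulVf // mulr1.
split=> //; rewrite -[RHS](mulKmx uE) mulmxDl mul1mx mulmxBr mulmx1.
rewrite -scalemxAr vv scalerA tt scalerBl scale1r opprB.
by rewrite (addrC (u *m r)) subrK subrK mulmx1.
Qed.

End RankOne.

(** * Summation along lines parallel to an axis *)

Section FiberSums.
Variables (R : realType) (g : nat) (i : 'I_g).
Local Notation C := R[i].

(** A line is represented by its point with i-th coordinate 0. The index still runs over all
    vectors, with value 0 off that hyperplane, to avoid a subtype. *)
Lemma hassum_fiber (f : 'rV[int]_g -> C) (G : 'rV[int]_g -> C) s :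
  hassum f s ->
  (forall N : 'rV[int]_g, N 0 i = 0 -> hassum (fun k : int => f (N + k *: delta_mx 0 i)) (G N)) ->
  hassum (fun N : 'rV[int]_g => if N 0 i == 0 then G N else 0) s.
Proof.
move=> hs hG.
pose F (p : 'rV[int]_g * int) : C :=
  if p.1 0 i == 0 then f (p.1 + p.2 *: delta_mx 0 i) else 0.
pose io (N : 'rV[int]_g) := (N - N 0 i *: delta_mx 0 i, N 0 i).
have io0 (N : 'rV[int]_g) : (N - N 0 i *: delta_mx 0 i) 0 i = 0.
  by rewrite !mxE !eqxx mulr1 subrr.
have hF : hassum F s.
  apply/(@hassum_inj _ _ _ io) => [N1 N2 [e1 e2]|[N k] h|].
  - by rewrite -(subrK (N1 0 i *: delta_mx 0 i) N1) e1 e2 subrK.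
  - rewrite /F /=; case: eqP => // N0; case: (h (N + k *: delta_mx 0 i)).
    by rewrite /io !mxE N0 !eqxx mulr1 add0r addrK.
  - by apply: hassum_ext hs => N; rewrite /F /= io0 eqxx subrK.
apply: hassum_fubini hF _ => N; rewrite /F /=.
by case: eqP => [N0|_]; [exact: hG|exact: hassum0].
Qed.

End FiberSums.

(** * Inversion in one coordinate *)

Section InversionTransforms.
Variables (R : realType) (g : nat) (i : 'I_g).
Local Notation C := R[i].
Implicit Types (Om : 'M[C]_g) (z x y : 'rV[C]_g).

Let e : 'rV[C]_g := delta_mx 0 i.

(** The row r for which the denominator of the inversion is 1 + e^T r, a perturbation of rank one of
    the identity. *)
Definition inv_row Om : 'rV[C]_g := row i Om - delta_mx 0 i.

Lemma toC_delta m n (a : 'I_m) (b : 'I_n) : toC (delta_mx a b) = delta_mx a b :> 'M[C]_(m, n).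
Proof. by rewrite /toC map_delta_mx. Qed.

Lemma delta_outer : delta_mx i i = e^T *m e.
Proof. by rewrite /e trmx_delta mul_delta_mx. Qed.

Lemma inversion_den Om : auto_den (inversion_at i) Om = 1%:M + e^T *m inv_row Om.
Proof.
rewrite /auto_den /inversion_at block_mxKdl block_mxKdr.
rewrite [toC (_ - _)]map_mxB -!/(toC _) [toC 1%:M]map_mx1 toC_delta.
rewrite /inv_row mulmxBr -delta_outer addrCA; congr (_ + (_ - _)).
by rewrite delta_outer -mulmxA -rowE.
Qed.

Lemma inversion_num Om : auto_num (inversion_at i) Om = Om - e^T *m row i Om - e^T *m e.
Proof.
rewrite /auto_num /inversion_at block_mxKul block_mxKur.
rewrite [toC (_ - _)]map_mxB [toC (- _)]map_mxN -!/(toC _) [toC 1%:M]map_mx1 toC_delta.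
by rewrite mulmxBl mul1mx delta_outer -mulmxA -rowE.
Qed.

Lemma inv_row_e Om : (inv_row Om *m e^T) 0 0 = Om i i - 1.
Proof.
by rewrite /inv_row mulmxBl addmxE oppmxE /e trmx_delta -!colE !mxE !eqxx.
Qed.

Lemma form_rank_two (M : 'M[C]_g) (v a b : 'rV[C]_g) (t : C) :
  (v *m (M - t *: (a^T *m a) - (b^T *m b) *+ 2) *m v^T) 0 0 =
  (v *m M *m v^T) 0 0 - t * (v *m a^T) 0 0 ^+ 2 - 2 * (v *m b^T) 0 0 ^+ 2.
Proof.
have tr11 (c d : 'rV[C]_g) : (c *m d^T) 0 0 = (d *m c^T) 0 0.
  by rewrite -[LHS]trace_mx11 -mxtrace_tr trace_mx11 trmx_mul trmxK.
rewrite !mulmxBr !mulmxBl mulr2n mulmxDr mulmxDl -scalemxAr -scalemxAl !mulmxA.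
rewrite -(mulmxA (v *m a^T)) -(mulmxA (v *m b^T)) !(addmxE, oppmxE, scalemxE) !mx11M.
by rewrite (tr11 a) (tr11 b); ring.
Qed.

Section AtPoint.
Variables (Om : 'M[C]_g).
Hypothesis hO : siegel_space Om.
Let tau := Om i i.
Let r := inv_row Om.

Lemma inv_tau_neq0 : tau != 0.
Proof.
by have := im_diag_gt0 i hO; apply: contraTneq; rewrite -/tau => ->; rewrite ltxx.
Qed.

Lemma inversion_det : \det (auto_den (inversion_at i) Om) = tau.
Proof. by rewrite inversion_den det_rank_one inv_row_e addrC subrK. Qed.

Lemma inversion_inv : invmx (auto_den (inversion_at i) Om) = 1%:M - tau^-1 *: (e^T *m r).
Proof. by rewrite inversion_den; case: (inv_rank_one inv_tau_neq0 (inv_row_e Om)). Qed.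

Lemma inversion_den_unit : auto_den (inversion_at i) Om \in unitmx.
Proof. by rewrite inversion_den; case: (inv_rank_one inv_tau_neq0 (inv_row_e Om)). Qed.

Lemma inversion_act : act (inversion_at i) Om =
  Om - tau^-1 *: (r^T *m r) - (e^T *m e) *+ 2.
Proof.
have [Os _] := hO.
rewrite /act -[RHS](mulmxK inversion_den_unit); congr (_ *m _).
have re : r *m e^T = (tau - 1)%:M by rewrite [LHS]mx11_scalar inv_row_e.
have ee : e *m e^T = 1%:M.
  by rewrite /e trmx_delta mul_delta_mx; apply/matrixP => a b; rewrite !ord1 !mxE.
have Oe : Om *m e^T = r^T + e^T.
  by rewrite -[RHS]linearD /= /r /inv_row subrK rowE trmx_mul Os.
have rowr : row i Om = r + e by rewrite /r /inv_row subrK.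
rewrite inversion_num inversion_den -/r mulmxDr mulmx1 mulmxA.
rewrite !mulmxBl -scalemxAl -(mulmxA r^T) re mulr2n mulmxDl -(mulmxA e^T) ee mulmx1 Oe.
rewrite rowr mulmxDr mul_mx_scalar scalerA mulrBr mulr1 mulVf ?inv_tau_neq0 //.
rewrite !mulmxDl -scalemxAl; move: (e^T *m r) (e^T *m e) (r^T *m r) => X Y W.
by apply/matrixP => a b; rewrite !mxE; ring.
Qed.

Lemma inversion_arg z : z *m invmx (auto_den (inversion_at i) Om) =
  z - (z 0 i / tau) *: r.
Proof.
rewrite inversion_inv mulmxBr mulmx1 -scalemxAr mulmxA.
have -> : z *m e^T = (z 0 i)%:M.
  by rewrite [LHS]mx11_scalar /e trmx_delta -colE mxE.
by rewrite mul_scalar_mx scalerA mulrC.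
Qed.

Lemma inversion_exponent z :
  (z *m invmx (auto_den (inversion_at i) Om) *m toC (dlsubmx (inversion_at i)) *m z^T) 0 0
  = z 0 i ^+ 2 / tau.
Proof.
rewrite inversion_arg /inversion_at block_mxKdl toC_delta delta_outer.
rewrite mulmxA -(mulmxA _ e) mx11M /e trmx_delta -colE -rowE !mxE !eqxx /= -/tau.
by field; exact: inv_tau_neq0.
Qed.

(* With [N = x + k e_i] both quadratic exponents split into a part that depends
   on [x] only and the exponent of a one-variable theta term in [k]. *)
Lemma fiber_exponent x z (k : C) :
  ((x + k *: e) *m Om *m (x + k *: e)^T) 0 0 + ((x + k *: e) *m z^T) 0 0 *+ 2 =
  ((x *m Om *m x^T) 0 0 + (x *m z^T) 0 0 *+ 2) +
  (tau * k ^+ 2 + 2 * k * ((x *m (row i Om)^T) 0 0 + z 0 i)).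
Proof.
have [Os _] := hO.
have trE : (x + k *: e)^T = x^T + k *: e^T by rewrite linearD linearZ.
have a1 : (e *m Om *m x^T) 0 0 = (x *m (row i Om)^T) 0 0.
  by rewrite -[LHS]trace_mx11 -mxtrace_tr trace_mx11 trmx_mul trmxK rowE.
have a2 : (x *m Om *m e^T) 0 0 = (x *m (row i Om)^T) 0 0.
  by rewrite rowE trmx_mul Os mulmxA.
have a3 : (e *m Om *m e^T) 0 0 = tau by rewrite -rowE /e trmx_delta -colE !mxE.
have a4 : (e *m z^T) 0 0 = z 0 i by rewrite -rowE !mxE.
rewrite trE !mulmxDl !mulmxDr -!(scalemxAl, scalemxAr).
by rewrite !(addmxE, scalemxE) a1 a2 a3 a4; ring.
Qed.

(** On each line the transformed exponent is that of a one-variable term at (- 1 / tau, w / tau),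
    with the same w as in [fiber_exponent]. The leftover w^2 / tau cancels against the exponential
    in [theta_inversion]. *)
Lemma fiber_exponent_inv x z (k : C) : x 0 i = 0 ->
  let z' := z *m invmx (auto_den (inversion_at i) Om) in
  let w := (x *m (row i Om)^T) 0 0 + z 0 i in
  ((x + k *: e) *m act (inversion_at i) Om *m (x + k *: e)^T) 0 0
     + ((x + k *: e) *m z'^T) 0 0 *+ 2 =
  ((x *m Om *m x^T) 0 0 + (x *m z^T) 0 0 *+ 2) + (z 0 i ^+ 2 / tau - w ^+ 2 / tau)
  + (- tau^-1 * k ^+ 2 + 2 * k * (w / tau)).
Proof.
move=> xi z' w; rewrite inversion_act /z' inversion_arg.
pose v := x + k *: e.
have ve : (v *m e^T) 0 0 = k.
  by rewrite /v /e trmx_delta -colE !mxE xi !eqxx mulr1 add0r.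
have vr : (v *m r^T) 0 0 = (x *m (row i Om)^T) 0 0 + k * tau - k.
  have -> : v *m r^T = v *m (row i Om)^T - v *m e^T.
    by rewrite /r /inv_row linearB /= mulmxBr.
  rewrite addmxE oppmxE ve /v mulmxDl addmxE -scalemxAl scalemxE.
  congr (_ + _ * _ - _); rewrite -rowE !mxE //.
have q2 : (v *m (z - (z 0 i / tau) *: r)^T) 0 0 = (v *m z^T) 0 0 - z 0 i / tau * (v *m r^T) 0 0.
  have -> : (z - (z 0 i / tau) *: r)^T = z^T - (z 0 i / tau) *: r^T by rewrite linearB linearZ.
  by rewrite mulmxBr -scalemxAr addmxE oppmxE scalemxE.
rewrite -/v form_rank_two q2; have := fiber_exponent x z k; rewrite -/v => q0.
have -> : (v *m Om *m v^T) 0 0 = (x *m Om *m x^T) 0 0 + (x *m z^T) 0 0 *+ 2 +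
  (tau * k ^+ 2 + 2 * k * w) - (v *m z^T) 0 0 *+ 2 by rewrite -q0 addrK.
rewrite vr ve /w; field; exact: inv_tau_neq0.
Qed.

End AtPoint.

Lemma toC_fiber (N : 'rV[int]_g) (k : int) :
  toC (N + k *: delta_mx 0 i) = toC N + k%:~R *: e :> 'rV[C]_g.
Proof.
by apply/matrixP => a b; rewrite !mxE intrD intrM; congr (_ + _ * _); case: (_ && _).
Qed.

Lemma theta_summand_row Om z (N : 'rV[int]_g) : theta_summand Om z N =
  epii ((toC N *m Om *m (toC N)^T) 0 0 + (toC N *m z^T) 0 0 *+ 2).
Proof. by rewrite /theta_summand trace_mx11 addmxE mulr2n addmxE -mulr2n. Qed.

(** After the cancellation of the w^2 terms, the factor of the one-variable inversion is the same
    for all lines and leaves the sum. *)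
Lemma inversion_transforms : theta_transforms R (inversion_at i).
Proof.
have hg : siegel_modular_group (inversion_at i).
  by case: (theta_gen_group (gen_inversion i)).
exists (fun Om => sqrtc (- 'i * Om i i)); split.
- exact: scont_sqrtc.
- move=> Om hO; rewrite inversion_det //.
  rewrite (exprM _ 2 4) sqr_sqrtc exprMn (exprM _ 2 2) sqrrN sqr_i sqrrN.
  by rewrite !expr1n mul1r.
move=> Om z hO; have tau0 := im_diag_gt0 i hO.
rewrite inversion_exponent //.
have hO' := act_siegel hg hO.
have tau1 : 0 < complex.Im (- (Om i i)^-1).
  rewrite Im_opp; move: tau0; case: (Om i i) => a b /= b0.
  by rewrite opprK divr_gt0 // ltr_wpDl ?sqr_ge0 // exprn_gt0.
pose A (N : 'rV[int]_g) : C := epii ((toC N *m Om *m (toC N)^T) 0 0 + (toC N *m z^T) 0 0 *+ 2).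
pose w (N : 'rV[int]_g) : C := (toC N *m (row i Om)^T) 0 0 + z 0 i.
pose G (N : 'rV[int]_g) := A N * usum (theta_term (Om i i) (w N)).
pose c := sqrtc (- 'i * Om i i) * epii (z 0 i ^+ 2 / Om i i).
have h1 : hassum (fun N : 'rV[int]_g => if N 0 i == 0 then G N else 0) (Theta Om z).
  apply: hassum_fiber (Theta_hassum z hO) _ => N N0.
  apply: hassum_ext (hassumZ (A N) (theta_hassum (w N) tau0)) => k.
  by rewrite theta_summand_row toC_fiber fiber_exponent // epiiD.
have h2 : hassum (fun N : 'rV[int]_g => if N 0 i == 0 then c * G N else 0)
    (Theta (act (inversion_at i) Om) (z *m invmx (auto_den (inversion_at i) Om))).
  apply: hassum_fiber (Theta_hassum _ hO') _ => N N0.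
  have xi : (toC N : 'rV[C]_g) 0 i = 0 by rewrite mxE N0.
  have h := theta_hassum (w N / Om i i) tau1.
  have := hassumZ (A N * epii (z 0 i ^+ 2 / Om i i - w N ^+ 2 / Om i i)) h.
  rewrite (theta_inversion tau0 (theta_hassum (w N) tau0) h) => hs.
  have -> : c * G N = A N * epii (z 0 i ^+ 2 / Om i i - w N ^+ 2 / Om i i) *
     (sqrtc (- 'i * Om i i) * epii (w N ^+ 2 / Om i i) * usum (theta_term (Om i i) (w N))).
    by rewrite /c /G epiiD epiiN; field; exact: epii_neq0.
  apply: hassum_ext hs => k.
  by rewrite theta_summand_row toC_fiber fiber_exponent_inv // /theta_term /A -!epiiD.
rewrite -/c; apply: hassum_unique h2 _.
by apply: hassum_ext (hassumZ c h1) => N; case: ifP; rewrite ?mulr0.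
Qed.

End InversionTransforms.

(** * The transformation formula *)

(** Completes the square in N + L; for integral N and M the last term is an even integer. *)
Lemma theta_exponent_shift (K : comPzRingType) m n (Om : 'M[K]_n) (N Z L M : 'M[K]_(m, n)) :
  Om^T = Om ->
  \tr (N *m Om *m N^T) + \tr (N *m (Z + L *m Om + M)^T) *+ 2 =
  - \tr (L *m Om *m L^T) - \tr (L *m Z^T) *+ 2
  + (\tr ((N + L) *m Om *m (N + L)^T) + \tr ((N + L) *m Z^T) *+ 2) + \tr (N *m M^T) *+ 2.
Proof.
move=> Os.
have t1 : \tr (L *m Om *m N^T) = \tr (N *m Om *m L^T).
  by rewrite -mxtrace_tr !trmx_mul trmxK Os mulmxA.
have t2 : \tr (N *m (L *m Om)^T) = \tr (N *m Om *m L^T).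
  by rewrite trmx_mul Os mulmxA.
have tD (A B : 'M[K]_(m, n)) : (A + B)^T = A^T + B^T by rewrite linearD.
rewrite !tD !mulmxDl !mulmxDr !mxtraceD t1 t2.
by move: (\tr _) (\tr _) (\tr _) (\tr _) (\tr _) (\tr _) => a b c d e f; ring.
Qed.

Section Assembly.
Variables (R : realType) (g : nat).
Local Notation C := R[i].
Implicit Types (Om : 'M[C]_g).

Lemma theta_group_transforms gam : theta_group gam -> @theta_transforms R g gam.
Proof.
move/theta_group_gen; elim=> {gam} [S hS|A D AD|i|M N hM tM hN tN].
- exact: trans_transforms.
- exact: levi_transforms.
- exact: inversion_transforms.
- by apply: theta_transformsM => //; [case: (theta_gen_group hM)|case: (theta_gen_group hN)].
Qed.

Lemma siegel_base : siegel_space (('i%C)%:M : 'M[C]_g).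
Proof.
split; first by rewrite tr_scalar_mx.
have -> : map_mx (@complex.Im R) (('i%C)%:M : 'M[C]_g) = 1%:M.
  by apply/matrixP => a b; rewrite !mxE; case: eqP.
split; first exact: trmx1.
move=> v v0; rewrite mulmx1 mxE.
have [j vj] : exists j, v 0 j != 0.
  apply/existsP; apply: contraNT v0; rewrite negb_exists => /forallP h.
  by apply/eqP/matrixP => a b; rewrite ord1 mxE; apply/eqP; have := h b; rewrite negbK.
rewrite (bigD1 j) //= mxE ltr_pwDl //.
  by rewrite -expr2 lt_def sqr_ge0 sqrf_eq0 vj.
by apply: sumr_ge0 => a _; rewrite mxE -expr2 sqr_ge0.
Qed.

Definition segment Om1 Om2 (t : R) : 'M[C]_g := Om1 + t%:C *: (Om2 - Om1).

Lemma segment_siegel Om1 Om2 t : siegel_space Om1 -> siegel_space Om2 -> 0 <= t <= 1 ->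
  siegel_space (segment Om1 Om2 t).
Proof.
move=> [s1 [t1 p1]] [s2 [t2 p2]] /andP[t0 t1'].
pose Y1 := map_mx (@complex.Im R) Om1; pose Y2 := map_mx (@complex.Im R) Om2.
have sym : (segment Om1 Om2 t)^T = segment Om1 Om2 t.
  by rewrite /segment linearD linearZ /= linearB /= s1 s2.
split=> //; split; first exact: tr_im.
move=> v v0; have -> : map_mx (@complex.Im R) (segment Om1 Om2 t) = (1 - t) *: Y1 + t *: Y2.
  by apply/matrixP => a b; rewrite !mxE Im_add Im_realM Im_add Im_opp; ring.
rewrite mulmxDr mulmxDl -!(scalemxAr, scalemxAl) addmxE !scalemxE.
have := p1 v v0; have := p2 v v0; rewrite -/Y1 -/Y2.
move: ((v *m Y1 *m v^T) 0 0) ((v *m Y2 *m v^T) 0 0) => a b b0 a0.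
have [->|tn0] := eqVneq t 0; first by rewrite subr0 mul1r mul0r addr0.
rewrite ltr_wpDl // ?mulr_ge0 ?subr_ge0 ?(ltW a0) // mulr_gt0 // lt_def tn0 //.
Qed.

(** The other fourth roots of unity are -1, i and -i. *)
Lemma fourth_root_Re (z : C) : z ^+ 4 = 1 -> z != 1 -> complex.Re z <= 0.
Proof.
move=> z4 z1; have : (z ^+ 2 - 1) * (z ^+ 2 + 1) = 0.
  by rewrite -subr_sqr -exprM z4 expr1n subrr.
move=> /eqP; rewrite mulf_eq0 subr_eq0 sqrf_eq1 (negPf z1) /= => /orP[/eqP->|].
  by rewrite Re_opp /= oppr_le0.
case: z {z4 z1} => a b; rewrite expr2 eq_complex /= => /andP[/eqP h1 /eqP h2].
by nra.
Qed.

(* The Siegel space is convex, so along a segment the real part would have to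
   take the value 1/2. *)
Lemma scont_fourth_root F Om1 Om2 : scont F ->
  (forall Om, siegel_space Om -> F Om ^+ 4 = 1) ->
  siegel_space Om1 -> siegel_space Om2 -> F Om1 = F Om2.
Proof.
move=> hF F4 h1 h2; have F1 : F Om1 != 0.
  by apply/eqP => F0; have := F4 _ h1; rewrite F0 expr0n => /eqP; rewrite eq_sym oner_eq0.
pose r t := F (segment Om1 Om2 t) / F Om1.
have r4 t : 0 <= t <= 1 -> r t ^+ 4 = 1.
  by move=> t01; rewrite /r expr_div_n !F4 ?divr1 //; exact: segment_siegel.
have r0 : r 0 = 1 by rewrite /r /segment scale0r addr0 divff.
have r1E : r 1 = F Om2 / F Om1 by rewrite /r /segment scale1r addrC subrK.
have [e|ne] := eqVneq (r 1) 1.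
  by rewrite -[F Om1]mul1r -e r1E divfK.
have f1 : complex.Re (r 1) <= 0 by apply: fourth_root_Re => //; apply: r4; rewrite ler01 lexx.
pose f t := complex.Re (r t).
have cf : {within `[0, 1], continuous f}%classic.
  apply/subspace_continuousP => t; rewrite /= in_itv /= => t01.
  apply/cvgrPdist_lt => e e0.
  have n1 : 0 < normc (F Om1) by rewrite normc_gt0.
  have [d d0 hd] := hF _ (segment_siegel h1 h2 t01) (e * normc (F Om1)) (mulr_gt0 e0 n1).
  (* A positive bound on the entries of Om2 - Om1, so that |s - t| < d / B moves each entry by less
     than d. *)
  pose B := 1 + \sum_a \sum_b normc ((Om2 - Om1) a b).
  have nn a b : 0 <= normc ((Om2 - Om1) a b) := normc_ge0 _.
  have B0 : 0 < B.
    by rewrite ltr_pwDl // sumr_ge0 // => a _; rewrite sumr_ge0.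
  have hB a b : normc ((Om2 - Om1) a b) <= B.
    apply: (@le_trans _ _ (\sum_c normc ((Om2 - Om1) a c))).
      by rewrite (bigD1 b) //= lerDl sumr_ge0.
    rewrite /B [X in _ <= _ + X](bigD1 a) //= addrCA lerDl addr_ge0 // sumr_ge0 // => c _.
    by rewrite sumr_ge0.
  rewrite near_withinE; near=> s; rewrite /= in_itv /= => s01.
  have st : `|t - s| < d / B.
    near: s; apply/nbhs_ballP; exists (d / B) => [|s] /=; first exact: divr_gt0.
    by rewrite -ball_normE.
  have := hd _ (segment_siegel h1 h2 s01) _ => hh.
  have hs : normc (F (segment Om1 Om2 s) - F (segment Om1 Om2 t)) < e * normc (F Om1).
    apply: hh => a b.
    have -> : segment Om1 Om2 s a b - segment Om1 Om2 t a b = (s - t)%:C * (Om2 - Om1) a b.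
      have seg u : segment Om1 Om2 u a b = Om1 a b + u%:C * (Om2 - Om1) a b.
        by rewrite /segment [LHS]mxE scalemxE.
      by rewrite !seg rmorphB mulrBl opprD addrACA subrr add0r.
    rewrite normcM normcR distrC.
    apply: le_lt_trans (ler_wpM2l (normr_ge0 _) (hB a b)) _.
    by rewrite -ltr_pdivlMr.
  rewrite /f -Re_opp -Re_add; apply: le_lt_trans (normc_Re _) _.
  by rewrite /r -mulrBl normcM normcV normcBC ltr_pdivrMr.
have := @IVT R f 0 1 (1 / 2) ler01 cf.
have f0 : f 0 = 1 by rewrite /f r0.
have -> : Num.min (f 0) (f 1) <= 1 / 2 <= Num.max (f 0) (f 1).
  rewrite f0 ge_min le_max; apply/andP; split; apply/orP.
    by right; rewrite (le_trans f1).
  by left; lra.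
move=> /(_ isT)[t]; rewrite in_itv /= => t01 ft.
have [e|ne'] := eqVneq (r t) 1.
  have : 1 = 1 / 2 :> R by rewrite -ft /f e.
  by move=> h; exfalso; clear -h; lra.
by have := fourth_root_Re (r4 t t01) ne'; rewrite -/(f t) ft => h; exfalso; clear -h; lra.
Unshelve. all: by end_near.
Qed.

Lemma Theta_translate m Om (Z : 'M[C]_(m, g)) (lam mu : 'M[int]_(m, g)) : siegel_space Om ->
  Theta Om (Z + toC lam *m Om + toC mu) =
  epii (- \tr (toC lam *m Om *m (toC lam)^T) - \tr (toC lam *m Z^T) *+ 2) * Theta Om Z.
Proof.
move=> hO; have [Os _] := hO; apply: Theta_eq.
have bij : bijective (fun N : 'M[int]_(m, g) => N + lam).
  by exists (fun N => N - lam) => N; rewrite ?addrK ?subrK.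
have := hassumZ (epii (- \tr (toC lam *m Om *m (toC lam)^T) - \tr (toC lam *m Z^T) *+ 2))
  ((hassum_bij _ _ bij).1 (Theta_hassum Z hO)).
apply: hassum_ext => N /=; rewrite /theta_summand -epiiD.
have tr2 k (A B : 'M[C]_k) : \tr (A + B *+ 2) = \tr A + \tr B *+ 2.
  by rewrite mxtraceD !mulr2n mxtraceD.
have e1 : toC (N + lam) = toC N + toC lam :> 'M[C]_(m, g).
  by apply/matrixP => a b; rewrite !mxE intrD.
rewrite !tr2 (theta_exponent_shift _ _ _ _ Os) -e1.
have [k -> k1] : exists2 k : C, \tr (toC N *m (toC mu)^T) *+ 2 = k & epii k = 1.
  exists (2 * \tr (N *m mu^T))%:~R; last exact: epii_even.
  rewrite intrM mulr_natl -toC_tr -toC_mul /mxtrace rmorph_sum; congr (_ *+ 2).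
  by apply: eq_bigr => a _; rewrite mxE.
by rewrite [RHS]epiiD k1 mulr1.
Qed.

(** The factor x is common to the rows, which gives x^m, and the exponents of the rows add up to a
    trace. *)
Lemma theta_transform_rows (gam : 'M[int]_(g + g)) (x : C) m Om (W : 'M[C]_(m, g)) :
  siegel_modular_group gam -> siegel_space Om ->
  (forall z : 'rV[C]_g, Theta (act gam Om) (z *m invmx (auto_den gam Om)) =
    x * epii ((z *m invmx (auto_den gam Om) *m toC (dlsubmx gam) *m z^T) 0 0) * Theta Om z) ->
  Theta (act gam Om) (W *m invmx (auto_den gam Om)) =
  x ^+ m * epii (\tr (W *m invmx (auto_den gam Om) *m toC (dlsubmx gam) *m W^T)) * Theta Om W.
Proof.
move=> hg hO h; rewrite (Theta_rows _ (act_siegel hg hO)) (Theta_rows W hO).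
move: (invmx _) (toC _) h => J D h.
transitivity (\prod_i (x * epii ((row i W *m J *m D *m (row i W)^T) 0 0) * Theta Om (row i W))).
  by apply: eq_bigr => i _; rewrite row_mul; exact: h.
rewrite big_split big_split /= prodr_const card_ord; congr (_ * _ * _).
rewrite /mxtrace (big_morph _ (@epiiD R) (@epii0 R)); apply: eq_bigr => i _; congr epii.
rewrite -2!row_mul; move: (W *m J *m D) => M.
rewrite mxE [RHS]mxE; apply: eq_bigr => j _.
by rewrite [row i M _ _]mxE [(row i W)^T _ _]mxE [row i W _ _]mxE [W^T _ _]mxE.
Qed.

End Assembly.

Theorem theorem1p1 (R : realType) (g m : nat) (hg : (0 < g)%N) (hm : (0 < m)%N)
    (gamma : 'M[int]_(g + g)) (lambda mu : 'M[int]_(m, g)) (kappa : 'M[int]_m)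
    (hgamma : theta_jacobi_group (gamma, Heis lambda mu kappa)) :
  exists (zeta : R[i]) (eps : 'M[R[i]]_g -> R[i]),
  [/\ zeta ^+ 8 = 1,
      branch_sign gamma eps &
      forall (Omega : 'M[R[i]]_g) (Z : 'M[R[i]]_(m, g)), siegel_space Omega ->
      let W := Z + toC lambda *m Omega + toC mu in
      let J := auto_den gamma Omega in
      Theta (auto_num gamma Omega *m invmx J) (W *m invmx J) =
      (zeta * eps Omega ^+ m)
      * epii (\tr (W *m invmx J *m toC (dlsubmx gamma) *m W^T
                   - toC lambda *m Omega *m (toC lambda)^T
                   - (toC lambda *m Z^T) *+ 2))
      * half_pow (\det J) m
      * Theta Omega Z].
Proof.
have [hth _] := hgamma; have hsp : siegel_modular_group gamma by case: hth.
have [chi [chi_cont chi8 chiE]] := theta_group_transforms R hth.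
pose D (Om : 'M[R[i]]_g) := \det (auto_den gamma Om).
have D0 Om : siegel_space Om -> D Om != 0.
  by move=> hO; have := auto_den_unit hsp hO; rewrite unitmxE unitfE.
have s0 Om : siegel_space Om -> sqrtc (D Om) != 0 by move=> /D0; rewrite sqrtc_eq0.
have chi0 Om : siegel_space Om -> chi Om != 0.
  move=> hO; have := D0 _ hO; apply: contraNneq => c0.
  by move: (chi8 _ hO); rewrite c0 expr0n /= => /esym/eqP; rewrite expf_eq0.
pose base : 'M[R[i]]_g := ('i%C)%:M; have hbase : siegel_space base := siegel_base R g.
(* An eighth root of unity, since the eighth powers of [chi] and of the principal root are both
   det^4. *)
pose z0 := chi base / sqrtc (D base).
have z00 : z0 != 0 by rewrite mulf_neq0 ?invr_eq0 ?chi0 ?s0.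
(* Defined so that [eps] times the principal root is chi / z0, hence continuous, and so that [eps]
   is 1 at the base point. *)
pose eps Om := chi Om / (z0 * sqrtc (D Om)).
have chi_eps Om : siegel_space Om -> chi Om = z0 * eps Om * sqrtc (D Om).
  by move=> hO; rewrite /eps; field; rewrite z00 s0.
have psi : forall Om, siegel_space Om -> chi Om ^+ 2 / D Om = chi base ^+ 2 / D base.
  move=> Om hO; apply: (scont_fourth_root (F := fun Om => chi Om ^+ 2 / D Om)) => //.
    apply: scontM; first by apply: scontM.
    by apply: scontV => //; apply: scont_det => i j; exact: scont_auto_den.
  by move=> Om' hO'; rewrite expr_div_n -exprM chi8 // divff // expf_neq0 // D0.
exists (z0 ^+ m), eps; split.
- rewrite exprAC; suff -> : z0 ^+ 8 = 1 by rewrite expr1n.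
  rewrite /z0 expr_div_n chi8 // (exprM _ 2 4) sqr_sqrtc divff // expf_neq0 //.
  exact: D0.
- split.
  (* The square of [eps] is chi^2 / det divided by its value at the base point, and [psi] says that
     these agree. *)
  + move=> Om hO; have : eps Om ^+ 2 = 1.
      rewrite /eps expr_div_n exprMn sqr_sqrtc /z0 expr_div_n sqr_sqrtc.
      rewrite -(psi _ hO); field.
      by rewrite D0 // chi0.
    by move/eqP; rewrite sqrf_eq1 => /orP[] /eqP; [left|right].
  + by rewrite /eps -/base /z0 mulfVK ?s0 // divff // chi0.
  + apply: (@scont_continuous R g (fun Om => eps Om * half_pow (D Om) 1)).
    apply: (@scont_eq _ _ (fun Om => chi Om * z0^-1)).
      by move=> Om hO; rewrite chi_eps // /half_pow expr1; field.
    by apply: scontM => //; exact: scont_const.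
move=> Om Z hO W J.
rewrite -/(act gamma Om) (theta_transform_rows W hsp hO (fun z => chiE Om z hO)) -/J.
rewrite [in Theta Om W]/W Theta_translate // chi_eps // /half_pow -/(D Om).
have -> : \tr (W *m invmx J *m toC (dlsubmx gamma) *m W^T
   - toC lambda *m Om *m (toC lambda)^T - (toC lambda *m Z^T) *+ 2) =
   \tr (W *m invmx J *m toC (dlsubmx gamma) *m W^T) +
   (- \tr (toC lambda *m Om *m (toC lambda)^T) - \tr (toC lambda *m Z^T) *+ 2).
  by rewrite mulr2n !linearB /= mxtraceD -mulr2n addrA.
rewrite [in RHS]epiiD 2!exprMn.
by move: (z0 ^+ m) (eps Om ^+ m) (_ ^+ m) (epii _) (epii _) (Theta _ _) => a b c d e f; ring.
Qed.
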